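(* For $m\ge0$ let $\mathbb{B}_m$ denote the linear Nakayama algebra given by the Kupisch series $((2,3)^m,2,2,1)$. Let $n_1,\dots,n_k\ge0$ and $\Theta\cong\mathbb{B}_{n_1}\oplus\mathbb{B}_{n_2}\oplus\cdots\oplus\mathbb{B}_{n_k}$ (summands in this cyclic order). Then the defect invariant reverse of $\Theta$ is given by the Kupisch series obtained by concatenating, for $i=1,\dots,k$ (with $n_{k+1}=n_1$), the blocks $$\big((3,4,4)^{n_i-1},3,3,3\big)^{\delta(n_i)},\ 2,\ 3,\ 2,\ 2+\delta(n_{i+1}),$$ where $\delta(n)=0$ if $n=0$ and $\delta(n)=1$ if $n\neq0$.
   Context: A Nakayama algebra is $\mathbb{K}Q/I$ over a field $\mathbb{K}$ with $I$ admissible, $Q$ an oriented cycle (cyclic case) or a disjoint union of linearly oriented quivers of type $\mathbb{A}$ (linear case). Simples are labelled so that $S_{i+1}\cong\tau S_i$ ($\tau$ the Auslander--Reiten translate, cyclically in the cyclic case, within components in the linear case); $P_i=P(S_i)$ has composition factors $S_i,S_{i+1},\dots$ from top to socle; the Kupisch series is $(\ell(P_1),\ell(P_2),\dots)$, which determines the algebra. Exponents on blocks mean repetition; exponent $0$ means the block is omitted. For a cyclic Nakayama algebra $\Lambda$, let $\mathcal{S}(\Lambda)$ be a complete set of representatives of isomorphism classes of socles of indecomposable projective $\Lambda$-modules; put $\mathcal{P}=\bigoplus_{S\in\mathcal{S}(\Lambda)}P(\tau S)$ and define the syzygy filtered algebra $\boldsymbol\varepsilon(\Lambda):=\operatorname{End}_\Lambda(\mathcal{P})$.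 The defect $\operatorname{def}\Lambda$ is the number of isomorphism classes of indecomposable injective non-projective modules. The defect invariant reverse of $\Theta$ is the cyclic Nakayama algebra $\Lambda$ with $\boldsymbol\varepsilon(\Lambda)\cong\Theta$ and $\operatorname{def}\Lambda=\operatorname{def}\Theta$, where, when $\Theta$ has several components, the isomorphism is required to match the cyclic order: the summands $P(\tau S)$ of $\mathcal{P}$, ordered cyclically by the $\tau$-order of their tops, correspond under $\operatorname{Hom}_\Lambda(\mathcal{P},-)$ to the projective $\Theta$-modules in the chosen order (components listed one after another, within each component $P_1,P_2,\dots$). *)

(* Defs.v *)
From HB Require Import structures.
From mathcomp Require Import all_boot all_order all_algebra all_field.
Set Implicit Arguments.
Unset Strict Implicit.
Unset Printing Implicit Defensive.
Import GRing.Theory.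
Local Open Scope ring_scope.

(* Conventions.  Algebras are finite-dimensional over a field K (falgType K).
   Modules are finite-dimensional right modules: a K-vector space with a right
   action.  Homomorphisms are K-linear maps f : 'Hom(M, N) satisfying rhom f;
   submodules are K-subspaces satisfying submodule.  With right modules,
   Hom(P, -) is a right module over End(P), where the product of End(P) is the
   usual composition (f \o g)%VF. *)

Record rmodule (K : fieldType) (A : falgType K) := RModule {
  rm_sort :> vectType K;
  ract : rm_sort -> A -> rm_sort;
  ract_linearl : forall a, linear (fun x => ract x a);
  ract_linearr : forall x, linear (ract x);
  ract1 : forall x, ract x 1 = x;
  ractM : forall x a b, ract x (a * b) = ract (ract x a) b
}.

Section RightModules.

Variables (K : fieldType) (A : falgType K).
Implicit Types M N P S : rmodule A.

Definition rhom M N (f : 'Hom(M, N)) : Prop :=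
  forall x a, f (ract x a) = ract (f x) a.

Definition submodule M (U : {vspace M}) : Prop :=
  forall x a, x \in U -> ract x a \in U.

Definition injective_hom M N (f : 'Hom(M, N)) : bool := lker f == 0%VS.
Definition surjective_hom M N (f : 'Hom(M, N)) : bool := limg f == fullv.

Definition isomorphic M N : Prop :=
  exists f : 'Hom(M, N), [/\ rhom f, injective_hom f & surjective_hom f].

Definition simple_module M : Prop :=
  (fullv : {vspace M}) <> 0%VS /\
  forall U : {vspace M}, submodule U -> U = 0%VS \/ U = fullv.

Definition indecomposable M : Prop :=
  (fullv : {vspace M}) <> 0%VS /\
  forall U V : {vspace M}, submodule U -> submodule V ->
    (U + V)%VS = fullv -> (U :&: V)%VS = 0%VS -> U = 0%VS \/ V = 0%VS.

Definition projective P : Prop :=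
  forall M N (g : 'Hom(M, N)) (f : 'Hom(P, N)),
    rhom g -> surjective_hom g -> rhom f ->
    exists2 h : 'Hom(P, M), rhom h & (g \o h)%VF = f.

Definition injective_module P : Prop :=
  forall M N (g : 'Hom(M, N)) (f : 'Hom(M, P)),
    rhom g -> injective_hom g -> rhom f ->
    exists2 h : 'Hom(N, P), rhom h & (h \o g)%VF = f.

Definition superfluous M (U : {vspace M}) : Prop :=
  forall V : {vspace M}, submodule V -> (U + V)%VS = fullv -> V = fullv.

Definition projective_cover_map P M (p : 'Hom(P, M)) : Prop :=
  [/\ projective P, rhom p, surjective_hom p & superfluous (lker p)].

Definition projective_cover M P : Prop :=
  exists p : 'Hom(P, M), projective_cover_map p.

Definition composition_length M (l : nat) : Prop :=
  exists U : nat -> {vspace M},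
  [/\ U 0%N = 0%VS, U l = fullv,
      forall i, (i <= l)%N -> submodule (U i) &
      forall i, (i < l)%N ->
        [/\ (U i <= U i.+1)%VS, U i <> U i.+1 &
            forall V : {vspace M}, submodule V ->
              (U i <= V)%VS -> (V <= U i.+1)%VS -> V = U i \/ V = U i.+1]].

Definition simple_submodule M (U : {vspace M}) : Prop :=
  [/\ submodule U, U <> 0%VS &
      forall V : {vspace M}, submodule V -> (V <= U)%VS -> V = 0%VS \/ V = U].

(* The sum of all simple submodules, as the least submodule containing them. *)
Definition is_socle M (U : {vspace M}) : Prop :=
  [/\ submodule U,
      forall V, simple_submodule V -> (V <= U)%VS &
      forall W, submodule W -> (forall V, simple_submodule V -> (V <= W)%VS) ->
        (U <= W)%VS].

Definition socle_of M S : Prop :=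
  exists f : 'Hom(S, M), [/\ rhom f, injective_hom f & is_socle (limg f)].

Definition direct_sum_of (r : nat) (M : rmodule A) (X : 'I_r -> rmodule A) :=
  exists (inj : forall j, 'Hom(X j, M)) (prj : forall j, 'Hom(M, X j)),
  [/\ forall j, rhom (inj j), forall j, rhom (prj j),
      forall j, (prj j \o inj j)%VF = \1%VF,
      forall i j, i != j -> (prj i \o inj j)%VF = 0 &
      \sum_j (inj j \o prj j)%VF = \1%VF].

Definition complete_representatives (C : rmodule A -> Prop) (n : nat)
    (X : 'I_n -> rmodule A) : Prop :=
  [/\ forall i, C (X i), forall i j, isomorphic (X i) (X j) -> i = j &
      forall M, C M -> exists i, isomorphic M (X i)].

Definition regular_module : rmodule A :=
  @RModule K A A (fun x a => x * a)
    (fun a k x y => etrans (mulrDl _ _ _) (congr1 (+%R^~ _) (esym (scalerAl _ _ _))))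
    (fun x k a b => etrans (mulrDr _ _ _) (congr1 (+%R^~ _) (esym (scalerAr _ _ _))))
    (@mulr1 A) (@mulrA A).

(* ar_translate M N : N is isomorphic to D Tr M.  Choose a minimal projective
   presentation P1 -p1-> P0 -p0-> M -> 0.  Then Tr M is the cokernel of
   h0 |-> h0 \o p1 from Hom_A(P0, A) to Hom_A(P1, A), a left A-module under
   (a h)(x) = a * h x, and D Tr M consists of the K-linear functionals on
   Hom_A(P1, A) that vanish on all h0 \o p1, with (xi a)(h) = xi (a h).
   theta is the isomorphism from N; a functional on Hom_A(P1, A) is given by
   one on all of 'Hom(P1, A), and only its values at A-homomorphisms matter. *)
Definition ar_translate M N : Prop :=
  exists (P0 P1 : rmodule A) (p0 : 'Hom(P0, M)) (p1 : 'Hom(P1, P0)),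
  [/\ projective_cover_map p0,
      [/\ projective P1, rhom p1, limg p1 = lker p0 & superfluous (lker p1)] &
  exists theta : 'Hom(N, 'Hom('Hom(P1, regular_module), K^o)),
  [/\ forall x a (h : 'Hom(P1, regular_module)), rhom h ->
        theta (ract x a) h = theta x (amull a \o h)%VF,
      forall x, (forall h : 'Hom(P1, regular_module), rhom h -> theta x h = 0) ->
        x = 0 &
      forall xi : 'Hom('Hom(P1, regular_module), K^o),
        (forall h0 : 'Hom(P0, regular_module), rhom h0 -> xi (h0 \o p1)%VF = 0)
        <-> (exists x, forall h : 'Hom(P1, regular_module), rhom h ->
               theta x h = xi h)]].

Definition has_defect (d : nat) : Prop :=
  exists X : 'I_d -> rmodule A,
    complete_representatives
      (fun M => [/\ indecomposable M, injective_module M & ~ projective M]) X.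

End RightModules.

Section Nakayama.

Variable K : fieldType.

(* The quiver Q(arr) has vertex set 'I_n and an arrow i -> i + 1 (cyclically)
   for each i with arr i: it is an oriented cycle when arr holds everywhere, and
   a disjoint union of linearly oriented quivers of type A when arr fails at the
   last vertex.  A path is determined by its source i and its length l. *)
Definition is_path n (arr : pred 'I_n) (i : 'I_n) (l : nat) : bool :=
  [forall j : 'I_l, arr (iter j (@ordS n) i)].

(* Image in A of a path, for the vertices e and the arrows a; paths are written
   from left to right, so that a i = e i * a i * e (i + 1). *)
Definition path_val (A : falgType K) n (e a : 'I_n -> A) (i : 'I_n) (l : nat) : A :=
  e i * \prod_(j < l) a (iter j (@ordS n) i).

(* Image in A of the element of the path algebra KQ in which the path of source
   i and length l has coefficient (w i)`_l. *)
Definition path_alg_val (A : falgType K) n (arr : pred 'I_n) (e a : 'I_n -> A)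
    (w : 'I_n -> {poly K}) : A :=
  \sum_i \sum_(l < size (w i) | is_path arr i l) (w i)`_l *: path_val e a i l.

(* A is isomorphic to KQ/I with I admissible: e and a define a surjective
   algebra morphism KQ -> A whose kernel is contained in J^2 and contains some
   J^m, where J is the ideal of KQ generated by the arrows. *)
Definition bound_quiver_algebra n (arr : pred 'I_n) (A : falgType K) : Prop :=
  exists e a : 'I_n -> A,
  [/\ [/\ forall i j, e i * e j = if i == j then e i else 0,
          \sum_i e i = 1 &
          forall i, arr i -> e i * a i * e (ordS i) = a i],
      forall x, exists w, x = path_alg_val arr e a w,
      forall w, path_alg_val arr e a w = 0 ->
        forall i l, (l < 2)%N -> is_path arr i l -> (w i)`_l = 0 &
      exists m, forall i l, (m <= l)%N -> is_path arr i l -> path_val e a i l = 0].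

Definition cyclic_nakayama (A : falgType K) : Prop :=
  exists n, bound_quiver_algebra (@predT 'I_n) A.

Definition linear_nakayama (A : falgType K) : Prop :=
  exists n (arr : pred 'I_n),
    (forall i : 'I_n, arr i -> (i.+1 < n)%N) /\ bound_quiver_algebra arr A.

(* The simple modules S i are labelled so that S (i + 1) is the translate of
   S i whenever the latter is nonzero, P i is the projective cover of S i, and c
   lists the lengths of the P i.  In the linear case the components are listed
   one after another, each ending with a projective simple module. *)
Definition kupisch_labelling (A : falgType K) (c : seq nat)
    (S P : 'I_(size c) -> rmodule A) : Prop :=
  [/\ complete_representatives (@simple_module K A) S,
      forall i, ~ projective (S i) -> ar_translate (S i) (S (ordS i)),
      forall i, projective_cover (S i) (P i) &
      forall i, composition_length (P i) (nth 0%N c i)].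

Definition has_kupisch_series (A : falgType K) (c : seq nat) : Prop :=
  exists S P : 'I_(size c) -> rmodule A, kupisch_labelling S P.

(* For A cyclic Nakayama: the s j represent the socles of the indecomposable
   projective modules, Q j is P(tau (s j)), and the Q j are listed in the cyclic
   tau-order of their tops (L lists the simple modules in that order, starting
   anywhere on the cycle). *)
Definition syzygy_projectives (A : falgType K) (r : nat) (Q : 'I_r -> rmodule A) : Prop :=
  exists (n : nat) (L : 'I_n -> rmodule A) (t : 'I_r -> 'I_n) (s : 'I_r -> rmodule A),
  [/\ complete_representatives (@simple_module K A) L,
      forall i, ar_translate (L i) (L (ordS i)),
      forall i j : 'I_r, (i < j)%N -> (t i < t j)%N,
      complete_representatives
        (fun S => exists P, [/\ indecomposable P, projective P & socle_of P S]) s &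
      forall j, ar_translate (s j) (L (t j)) /\ projective_cover (L (t j)) (Q j)].

Definition end_algebra_iso (A B : falgType K) (M : rmodule A)
    (phi : 'Hom(B, 'End(M))) : Prop :=
  [/\ phi 1 = \1%VF,
      forall a b, phi (a * b) = (phi a \o phi b)%VF,
      lker phi = 0%VS &
      forall f : 'End(M), rhom f <-> exists b, phi b = f].

(* Hom_A(M, N), viewed as a right B-module through phi, is isomorphic to X. *)
Definition hom_module_iso (A B : falgType K) (M N : rmodule A)
    (phi : 'Hom(B, 'End(M))) (X : rmodule B) : Prop :=
  exists psi : 'Hom(X, 'Hom(M, N)),
  [/\ forall x b, psi (ract x b) = (psi x \o phi b)%VF,
      lker psi = 0%VS &
      forall f : 'Hom(M, N), rhom f <-> exists x, psi x = f].

(* B is given with its indecomposable projective modules PB in the chosen order.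
   The isomorphism of B with End(MP) is required to send the summands Q j of MP,
   in their cyclic order, to the PB j; when B is connected any isomorphism does. *)
Definition defect_invariant_reverse (A B : falgType K) (r : nat)
    (PB : 'I_r -> rmodule B) : Prop :=
  [/\ cyclic_nakayama A,
      exists (Q : 'I_r -> rmodule A) (MP : rmodule A) (phi : 'Hom(B, 'End(MP))),
        [/\ syzygy_projectives Q, direct_sum_of MP Q, end_algebra_iso phi &
            forall j, hom_module_iso (Q j) phi (PB j)] &
      exists2 d, has_defect A d & has_defect B d].

End Nakayama.

Definition repeat_block (s : seq nat) (m : nat) : seq nat := flatten (nseq m s).

Definition delta (n : nat) : nat := if n == 0%N then 0%N else 1%N.

Definition B_series (m : nat) : seq nat :=
  repeat_block [:: 2; 3]%N m ++ [:: 2; 2; 1]%N.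

(* When n = 0 the truncated n.-1 is irrelevant: the block has exponent 0. *)
Definition reverse_block (n n' : nat) : seq nat :=
  repeat_block (repeat_block [:: 3; 4; 4]%N n.-1 ++ [:: 3; 3; 3]%N) (delta n)
    ++ [:: 2; 3; 2; 2 + delta n']%N.

Definition theta_series (k : nat) (n : 'I_k -> nat) : seq nat :=
  flatten [seq B_series (n i) | i <- enum 'I_k].

Definition reverse_series (k : nat) (n : 'I_k -> nat) : seq nat :=
  flatten [seq reverse_block (n i) (n (ordS i)) | i <- enum 'I_k].

(* Main.v *)
From HB Require Import structures.
Require Import Defs.
From mathcomp Require Import all_boot all_order all_algebra all_field.
From mathcomp Require Import zify.

Set Implicit Arguments.
Unset Strict Implicit.
Unset Printing Implicit Defensive.

Import GRing.Theory.
Local Open Scope ring_scope.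

(* For a cyclic Nakayama algebra with N vertices and Kupisch series c, put
   f(i) = i + c(i) on the N-periodic integers.  The socle of P_i sits at the vertex
   f(i) - 1, so the tops t_0 < t_1 < ... of the projectives P(tau S) form the image
   of f.  The length of P_(t_j) over the syzygy filtered algebra counts the t_i in
   [t_j, f(t_j)), hence f(t_j) = t_(g(j)) with g(j) = j + c'(j) and c' the Kupisch
   series of Theta.  As f is nondecreasing onto the t_j, at least
   g(j + 1) - g(j) - 1 vertices lie strictly between t_j and t_(j + 1).  The defect
   is the number of vertices that are not socles of projectives, so it is N - r for
   Lambda, with r the number of vertices of Theta, and the sum of the numbers
   max(0, g(j + 1) - g(j) - 1) for Theta.  Equality of the defects therefore makes
   all these gaps minimal, which determines t and then f by
   f(t_j + s) = t_(g(j) + s); for Theta as in the statement this is the announced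
   series.  Conversely, that formula identifies the path basis of e Lambda e, with e
   the sum of the idempotents at the t_j, with the path basis of Theta. *)

(** * Right modules *)

(** The definitions in the statement are intrinsic: they quantify over arbitrary modules, minimal
    presentations, injectives and labellings. Most of the work makes them computable. A bound quiver
    algebra is replaced by a [nakayama_basis], a basis of paths with its multiplication table. Over
    it a simple module is recognised by its character ([simple_at]), an indecomposable projective by
    a generator ([pgen]), an indecomposable injective as the dual of a left ideal. Then
    [ar_translate], socles, the defect and Kupisch series become arithmetic of vertices and lengths.

    Both directions of the equivalence meet in one predicate, [realizes]. Any reverse satisfies it
    after a rotation that moves the first top to position 0, the announced series satisfies it by
    computation, and it determines the series. Indices are unrolled to all natural numbers with
    periodic data: the intervals [t_j, f(t_j)) may wrap around the cycle, and order and counting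
    arguments need the unrolled line. *)

Section LinearMaps.
Variables (K : fieldType).

Lemma lfun_of_linear (U V : vectType K) (f : U -> V) :
  linear f -> {g : 'Hom(U, V) | g =1 f}.
Proof.
move=> fL; pose fl := GRing.isLinear.Build _ _ _ _ f fL.
pose F : {linear U -> V} := HB.pack f fl.
by exists (linfun F) => x; rewrite lfunE.
Qed.

(** Extracted from an opaque proof, so that it never unfolds and [lfun_fromE] is the only way to
    evaluate it. *)
Definition lfun_from (U V : vectType K) (f : U -> V) (fL : linear f) :=
  sval (lfun_of_linear fL).

Lemma lfun_fromE (U V : vectType K) (f : U -> V) (fL : linear f) :
  lfun_from fL =1 f.
Proof. exact: svalP (lfun_of_linear fL). Qed.

End LinearMaps.

Section Modules.
Variables (K : fieldType) (A : falgType K).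
Implicit Types M N P : rmodule A.

Definition ractl M (x : M) : 'Hom(A, M) := lfun_from (ract_linearr x).
Definition ractr M (a : A) : 'End(M) := lfun_from (@ract_linearl K A M a).

Lemma ractlE M (x : M) a : ractl x a = ract x a.
Proof. exact: lfun_fromE. Qed.
Lemma ractrE M (x : M) a : ractr M a x = ract x a.
Proof. exact: lfun_fromE. Qed.

Lemma ractDl M (x y : M) a : ract (x + y) a = ract x a + ract y a.
Proof. by rewrite -!ractrE linearD. Qed.
Lemma ractZl M k (x : M) a : ract (k *: x) a = k *: ract x a.
Proof. by rewrite -!ractrE linearZ. Qed.
Lemma ract0l M a : ract (0 : M) a = 0.
Proof. by rewrite -!ractrE linear0. Qed.
Lemma ractDr M (x : M) a b : ract x (a + b) = ract x a + ract x b.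
Proof. by rewrite -!ractlE linearD. Qed.
Lemma ractZr M k (x : M) a : ract x (k *: a) = k *: ract x a.
Proof. by rewrite -!ractlE linearZ. Qed.
Lemma ract0r M (x : M) : ract x 0 = 0.
Proof. by rewrite -!ractlE linear0. Qed.
Lemma ract_sumr M (x : M) (I : Type) (r : seq I) (Q : pred I) (F : I -> A) :
  ract x (\sum_(i <- r | Q i) F i) = \sum_(i <- r | Q i) ract x (F i).
Proof. by rewrite -ractlE linear_sum; apply: eq_bigr => i _; exact: ractlE. Qed.

Lemma submodule0 M : submodule (0%VS : {vspace M}).
Proof. by move=> x a; rewrite !memv0 => /eqP ->; rewrite ract0l. Qed.

Lemma submodulef M : submodule (fullv : {vspace M}).
Proof. by move=> x a _; rewrite memvf. Qed.

Lemma rhom_lker M N (f : 'Hom(M, N)) : rhom f -> submodule (lker f).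
Proof. by move=> Hf x a; rewrite !memv_ker Hf => /eqP ->; rewrite ract0l. Qed.

Lemma rhom_limg M N (f : 'Hom(M, N)) (U : {vspace M}) :
  rhom f -> submodule U -> submodule (f @: U)%VS.
Proof.
by move=> Hf HU x a /memv_imgP[u uU ->]; rewrite -Hf memv_img ?HU.
Qed.

Lemma rhom_comp M N P (f : 'Hom(M, N)) (g : 'Hom(N, P)) :
  rhom f -> rhom g -> rhom (g \o f)%VF.
Proof. by move=> Hf Hg x a; rewrite !comp_lfunE Hf Hg. Qed.

Lemma rhom_id M : rhom (\1%VF : 'End(M)).
Proof. by move=> x a; rewrite !id_lfunE. Qed.

Lemma rhom_inv M N (f : 'Hom(M, N)) :
  rhom f -> injective_hom f -> surjective_hom f -> rhom (f^-1)%VF.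
Proof.
move=> Hf /lker0P fI /eqP fS x a; apply: fI.
by rewrite Hf !limg_lfunVK ?fS ?memvf.
Qed.

Lemma surjective_homP M N (f : 'Hom(M, N)) :
  reflect (forall y, exists x, y = f x) (surjective_hom f).
Proof.
apply: (iffP eqP) => [fS y|fS].
  by have /memv_imgP[x _ ->] : y \in limg f; [rewrite fS memvf|exists x].
apply/vspaceP => y; rewrite memvf; have [x ->] := fS y.
by rewrite memv_img ?memvf.
Qed.

Lemma isomorphic_sym M N : isomorphic M N -> isomorphic N M.
Proof.
move=> [f [Hf fI fS]]; exists (f^-1)%VF; split; first exact: rhom_inv.
  apply/lker0P; apply: (can_inj (g := f)) => y.
  by rewrite limg_lfunVK // (eqP fS) memvf.
by apply/surjective_homP => x; exists (f x); rewrite lker0_lfunK.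
Qed.

Lemma isomorphic_trans M N P : isomorphic M N -> isomorphic N P -> isomorphic M P.
Proof.
move=> [f [Hf /lker0P fI /surjective_homP fS]] [g [Hg /lker0P gI /surjective_homP gS]].
exists (g \o f)%VF; split; first exact: rhom_comp.
  by apply/lker0P => x y; rewrite !comp_lfunE => /gI/fI.
apply/surjective_homP => z; have [y ->] := gS z; have [x ->] := fS y.
by exists x; rewrite comp_lfunE.
Qed.

Lemma isomorphic_dim M N : isomorphic M N -> \dim {:M} = \dim {:N}.
Proof.
move=> [f [_ /eqP fI /eqP fS]]; rewrite -fS.
by rewrite limg_dim_eq // fI capv0.
Qed.

Lemma injective_dim_surjective M N (f : 'Hom(M, N)) :
  injective_hom f -> (\dim {:N} <= \dim {:M})%N -> surjective_hom f.
Proof.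
move=> /eqP fI le; rewrite /surjective_hom eqEdim subvf /=.
by rewrite limg_dim_eq // fI capv0.
Qed.

Section Submodule.
Variables (M : rmodule A) (U : {vspace M}) (HU : submodule U).

Let sact (x : subvs_of U) a : subvs_of U := vsproj U (ract (vsval x) a).

Let sactE x a : vsval (sact x a) = ract (vsval x) a.
Proof. by rewrite vsprojK ?HU ?subvsP. Qed.

Let vsvalP k (x y : subvs_of U) : vsval (k *: x + y) = k *: vsval x + vsval y.
Proof. by []. Qed.

Let sact_linearl a : linear (sact^~ a).
Proof.
by move=> k x y; apply: subvs_inj; rewrite vsvalP !sactE vsvalP ractDl ractZl.
Qed.

Let sact_linearr x : linear (sact x).
Proof.
by move=> k a b; apply: subvs_inj; rewrite vsvalP !sactE ractDr ractZr.
Qed.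

Let sact1 x : sact x 1 = x.
Proof. by apply: subvs_inj; rewrite sactE ract1. Qed.

Let sactM x a b : sact x (a * b) = sact (sact x a) b.
Proof. by apply: subvs_inj; rewrite !sactE ractM. Qed.

Definition sub_rmodule : rmodule A :=
  RModule sact_linearl sact_linearr sact1 sactM.

Definition sub_val (x : sub_rmodule) : M := vsval (x : subvs_of U).
Definition sub_proj (x : M) : sub_rmodule := vsproj U x.

Lemma sub_val_linear : linear sub_val.
Proof. by []. Qed.

Lemma sub_proj_linear : linear sub_proj.
Proof. by move=> k x y; rewrite /sub_proj linearP. Qed.

Definition sub_incl : 'Hom(sub_rmodule, M) := lfun_from sub_val_linear.

Lemma sub_ractE x a : sub_val (ract x a) = ract (sub_val x) a.
Proof. exact: sactE. Qed.

Lemma sub_inclE x : sub_incl x = sub_val x.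
Proof. exact: lfun_fromE. Qed.

Lemma sub_valP x : sub_val x \in U.
Proof. exact: subvsP. Qed.

Lemma sub_val_inj : injective sub_val.
Proof. exact: subvs_inj. Qed.

Lemma sub_projK x : x \in U -> sub_val (sub_proj x) = x.
Proof. exact: vsprojK. Qed.

Lemma rhom_sub_incl : rhom sub_incl.
Proof. by move=> x a; rewrite !sub_inclE sub_ractE. Qed.

Lemma dim_sub_rmodule : \dim {:sub_rmodule} = \dim U.
Proof. by rewrite dimvf. Qed.

End Submodule.

End Modules.

(** * Path bases *)

Section Shift.
Variable n : nat.
Implicit Types i j : 'I_n.

Definition sh i (l : nat) : 'I_n := iter l (@ordS n) i.

Lemma sh0 i : sh i 0 = i. Proof. by []. Qed.
Lemma sh1 i : sh i 1 = ordS i. Proof. by []. Qed.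

Lemma shD i l m : sh i (l + m) = sh (sh i l) m.
Proof. by rewrite /sh addnC iterD. Qed.

Lemma val_sh i l : sh i l = ((i + l) %% n)%N :> nat.
Proof.
elim: l => [|l IH]; first by rewrite addn0 modn_small.
by rewrite /sh iterS /= -/(sh i l) IH -[in LHS]addn1 modnDml addn1 addnS.
Qed.

Lemma sh_inj l : injective (fun i => sh i l).
Proof. by elim: l => [|l IH] i j //= /(@ordS_inj n)/IH. Qed.

Lemma sh_eq i j l m : (sh i l == sh j m) = (i + l == j + m %[mod n])%N.
Proof. by rewrite -val_eqE /= !val_sh. Qed.

End Shift.

Section NakayamaBasis.
Variables (K : fieldType) (A : falgType K) (n : nat) (c : nat -> nat).

(* The vector [b i l] is the class of the path of source [i] and length [l];
   it vanishes from length [c i] on. *)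
Definition nakayama_basis (b : 'I_n -> nat -> A) : Prop :=
  [/\ forall i : 'I_n, (0 < c i)%N /\ b i (c i).-1 != 0,
      forall (i : 'I_n) l, (c i <= l)%N -> b i l = 0,
      forall i l j m, b i l * b j m = if sh i l == j then b i (l + m)%N else 0,
      \sum_i b i 0%N = 1 &
      forall x : A, exists w : 'I_n -> nat -> K,
        x = \sum_(i < n) \sum_(l < c i) w i l *: b i l].

Variable b : 'I_n -> nat -> A.

Definition path_index := {i : 'I_n & 'I_(c i)}.
Definition path_tuple : #|{: path_index}|.-tuple A :=
  [tuple b (tag (enum_val k)) (tagged (enum_val k)) | k < #|{: path_index}|].

Lemma path_coord_linear k : linear (coord path_tuple k : A -> K^o).
Proof. by move=> a x y; rewrite linearP. Qed.

(** The coordinate along a path. Out of range it is the zero map, so that [cfE] needs no bound on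
    [l]. *)
Definition cf (i : 'I_n) (l : nat) : 'Hom(A, K^o) :=
  if insub l is Some l' then
    lfun_from (path_coord_linear
      (enum_rank (Tagged (fun i : 'I_n => 'I_(c i)) (l' : 'I_(c i)))))
  else 0.

Hypothesis Hb : nakayama_basis b.

Lemma nb_gt0 (i : 'I_n) : (0 < c i)%N. Proof. by case: Hb => /(_ i) []. Qed.
Lemma nb_last (i : 'I_n) : b i (c i).-1 != 0. Proof. by case: Hb => /(_ i) []. Qed.
Lemma nb_eq0 (i : 'I_n) l : (c i <= l)%N -> b i l = 0.
Proof. by case: Hb => _ H _ _ _; apply: H. Qed.
Lemma nb_mul i l j m : b i l * b j m = if sh i l == j then b i (l + m)%N else 0.
Proof. by case: Hb. Qed.
Lemma nb_one : \sum_i b i 0%N = 1. Proof. by case: Hb. Qed.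

(** Every shorter path is a left factor of the last one, which is nonzero. *)
Lemma nb_neq0 (i : 'I_n) l : (l < c i)%N -> b i l != 0.
Proof.
move=> lt; apply: contra_neq (nb_last i) => b0.
have -> : b i (c i).-1 = b i l * b (sh i l) ((c i).-1 - l)%N.
  by rewrite nb_mul eqxx subnKC // -ltnS prednK ?nb_gt0.
by rewrite b0 mul0r.
Qed.

Lemma nb_mule i j m : b i 0%N * b j m = if i == j then b j m else 0.
Proof. by rewrite nb_mul sh0 add0n; case: eqP => // ->. Qed.

Lemma nb_emul i l j : b i l * b j 0%N = if sh i l == j then b i l else 0.
Proof. by rewrite nb_mul addn0. Qed.

(** Kupisch inequality: the last path at [i] is the arrow followed by a path of length [(c i).-2]
    from the next vertex, and this factor cannot vanish. *)
Lemma nb_succ (i : 'I_n) : (1 < c i)%N -> (c i <= (c (ordS i)).+1)%N.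
Proof.
move=> c1; have := nb_mul i 1 (ordS i) (c i).-2; rewrite sh1 eqxx add1n.
have -> : ((c i).-2.+1 = (c i).-1)%N by case: (c i) c1 => [|[]].
rewrite leqNgt => E; apply/negP => lt; move: (nb_last i); rewrite -E.
by rewrite (@nb_eq0 (ordS i)) ?mulr0 ?eqxx //; case: (c i) lt => [|[]].
Qed.

(* Multiplying a relation on the left by [b i 0] and on the right by the longest
   path that does not kill its lowest term isolates that term. *)
Lemma nb_indep (w : 'I_n -> nat -> K) :
  \sum_(i < n) \sum_(l < c i) w i l *: b i l = 0 ->
  forall (i : 'I_n) l, (l < c i)%N -> w i l = 0.
Proof.
move=> w0 i l; elim/ltn_ind: l => l IH lt.
have := congr1 (fun x => b i 0%N * x * b (sh i l) ((c i).-1 - l)%N) w0.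
rewrite mulr0 mul0r mulr_sumr mulr_suml (bigD1 i) //= [X in _ + X]big1 ?addr0; last first.
  move=> j ji; rewrite mulr_sumr mulr_suml big1 // => m _.
  by rewrite -scalerAr nb_mule eq_sym (negPf ji) scaler0 mul0r.
rewrite mulr_sumr mulr_suml (bigD1 (Ordinal lt)) //= [X in _ + X]big1 ?addr0.
  rewrite -scalerAr nb_mule eqxx -scalerAl nb_mul eqxx subnKC; last first.
    by rewrite -ltnS prednK ?nb_gt0.
  by move/eqP; rewrite scaler_eq0 (negPf (nb_last i)) orbF => /eqP.
move=> m; rewrite -val_eqE /= => ml.
have [mlt|] := ltnP m l; first by rewrite IH ?scale0r ?mulr0 ?mul0r.
rewrite leq_eqVlt eq_sym (negPf ml) /= => lm.
rewrite -scalerAr nb_mule eqxx -scalerAl nb_mul; case: ifP => _; rewrite ?scaler0 //.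
rewrite nb_eq0 ?scaler0 // addnBA; first by have := nb_gt0 i; lia.
by have := nb_gt0 i; lia.
Qed.

Lemma path_tuple_nth (u : path_index) :
  path_tuple`_(enum_rank u) = b (tag u) (tagged u).
Proof.
have := tnth_nth 0 path_tuple (enum_rank u) => /= <-.
by rewrite tnth_map tnth_ord_tuple enum_rankK.
Qed.

Lemma path_tuple_sum (k : 'I_#|{: path_index}| -> K) :
  \sum_j k j *: path_tuple`_j =
  \sum_(i < n) \sum_(l < c i) k (enum_rank (Tagged (fun i : 'I_n => 'I_(c i)) l)) *: b i l.
Proof.
rewrite sig_big_dep /= (reindex (@enum_rank path_index)) /=; last first.
  exact/onW_bij/enum_rank_bij.
apply: eq_bigr => -[i l] _ /=.
by rewrite path_tuple_nth.
Qed.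

Lemma path_tuple_free : free path_tuple.
Proof.
apply/freeP => k; rewrite path_tuple_sum => k0 j.
pose w (i : 'I_n) (l : nat) : K := if insub l is Some l' then
  k (enum_rank (Tagged (fun i : 'I_n => 'I_(c i)) (l' : 'I_(c i)))) else 0.
have wE (i : 'I_n) (l : 'I_(c i)) :
  w i l = k (enum_rank (Tagged (fun i : 'I_n => 'I_(c i)) l)) by rewrite /w valK.
rewrite -(enum_valK j); case: (enum_val j) => i l.
rewrite -wE; apply: nb_indep (ltn_ord l); rewrite -[RHS]k0.
by apply: eq_bigr => i' _; apply: eq_bigr => l' _; rewrite wE.
Qed.

Lemma cfE (i : 'I_n) l (j : 'I_n) m : (m < c j)%N -> cf i l (b j m) = ((i == j) && (l == m))%:R.
Proof.
move=> lt; rewrite /cf; case: insubP => [l' _ <-|]; last first.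
  rewrite zero_lfunE => nl; case: eqP => //= ij; case: eqP => // lm.
  by rewrite ij lm lt in nl.
pose u := Tagged (fun i : 'I_n => 'I_(c i)) (Ordinal lt).
have -> : b j m = path_tuple`_(enum_rank u).
  by rewrite path_tuple_nth.
rewrite lfun_fromE coord_free ?path_tuple_free // eq_sym.
rewrite (inj_eq enum_rank_inj) eq_sym {}/u.
have [ij|ij] := eqVneq i j; last by rewrite -tag_eqE /tag_eq /= eq_sym (negPf ij).
by subst j; rewrite eq_Tagged -val_eqE /= eq_sym.
Qed.

Lemma nb_dec x : x = \sum_(i < n) \sum_(l < c i) cf i l x *: b i l.
Proof.
case: Hb => _ _ _ _ /(_ x) [w xE]; rewrite {1}xE.
apply: eq_bigr => i _; apply: eq_bigr => l _; congr (_ *: _).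
rewrite xE linear_sum (bigD1 i) //= linear_sum (bigD1 l) //= linearZ /= cfE // !eqxx.
rewrite !big1 ?addr0 => [|j ji|m ml]; first exact/esym/mulr1.
  by rewrite linear_sum big1 // => m _; rewrite linearZ /= cfE // eq_sym (negPf ji) scaler0.
by rewrite linearZ /= cfE // eqxx (inj_eq val_inj) eq_sym (negPf ml) scaler0.
Qed.

Lemma nb_ind (U : {vspace A}) : (forall i l, b i l \in U) -> forall x, x \in U.
Proof. by move=> HU x; rewrite [x]nb_dec !memv_suml // => i _; rewrite memv_suml // => l _; rewrite memvZ. Qed.

Lemma nb_lfunP (V : vectType K) (f g : 'Hom(A, V)) :
  (forall (i : 'I_n) l, (l < c i)%N -> f (b i l) = g (b i l)) -> f =1 g.
Proof.
move=> fg x; apply/eqlfunP; move: x; apply: nb_ind => i l; apply/eqlfunP.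
by have [/fg//|/nb_eq0 ->] := ltnP l (c i); rewrite !linear0.
Qed.

(** Nilpotency of the radical; it bounds the searches for a longest path in [eigenvector] and
    [coeigen_functional]. *)
Lemma nb_bump : exists m, forall i l, (m <= l)%N -> b i l = 0.
Proof.
exists (\max_(i < n) c i)%N => i l le; apply: nb_eq0.
by apply: leq_trans le; apply: (leq_bigmax (F := fun i : 'I_n => c i)).
Qed.

End NakayamaBasis.

(** * Modules over an algebra with a path basis *)

Section RightIdeals.
Variables (K : fieldType) (A : falgType K).
Implicit Types (M N P : rmodule A) (e : A).

Lemma amullE (x y : A) : amull x y = x * y.
Proof. by rewrite lfunE. Qed.
Lemma amulrE (x y : A) : amulr x y = y * x.
Proof. by rewrite lfunE. Qed.

Lemma right_ideal_submodule e :
  @submodule K A (regular_module A) (fixedSpace (amull e)).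
Proof.
by move=> x a /fixedSpaceP; rewrite amullE => ex; apply/fixedSpaceP; rewrite amullE mulrA ex.
Qed.

(** The fixed points of left multiplication by [e] form [e A] when [e] is idempotent. *)
Definition right_ideal e : rmodule A := sub_rmodule (@right_ideal_submodule e).

Definition ri_val e (x : right_ideal e) : A := sub_val x.
Definition ri_mk e (a : A) : right_ideal e :=
  sub_proj (@right_ideal_submodule e) (e * a).

Lemma ri_val_inj e : injective (@ri_val e).
Proof. exact: (@sub_val_inj _ _ (regular_module A)). Qed.

Lemma ri_valP e (x : right_ideal e) : e * ri_val x = ri_val x.
Proof. by have /fixedSpaceP := sub_valP x; rewrite amullE. Qed.

Lemma ri_mkK e a : e * e = e -> ri_val (ri_mk e a) = e * a.
Proof.
by move=> ee; apply: (@sub_projK _ _ (regular_module A) _ (@right_ideal_submodule e)); apply/fixedSpaceP; rewrite amullE mulrA ee.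
Qed.

Lemma ri_valE e (x : right_ideal e) a : ri_val (ract x a) = ri_val x * a.
Proof. exact: (@sub_ractE _ _ (regular_module A)). Qed.

Lemma ri_val_linear e : linear (@ri_val e).
Proof. exact: (@sub_val_linear _ _ (regular_module A)). Qed.

Lemma ri_mk_linear e : linear (ri_mk e).
Proof.
move=> k x y; rewrite /ri_mk mulrDr -scalerAr; exact: (@sub_proj_linear _ _ (regular_module A)).
Qed.

Definition ri_inc e : 'Hom(right_ideal e, A) := lfun_from (@ri_val_linear e).
Lemma ri_incE e x : @ri_inc e x = ri_val x.
Proof. exact: lfun_fromE. Qed.

Lemma ri_val0 e : ri_val (0 : right_ideal e) = 0.
Proof. by rewrite -ri_incE linear0. Qed.
Lemma ri_valB e (x y : right_ideal e) : ri_val (x - y) = ri_val x - ri_val y.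
Proof. by rewrite -!ri_incE linearB. Qed.

Definition ri_hom e M (m : M) : 'Hom(right_ideal e, M) := (ractl m \o ri_inc e)%VF.

Lemma ri_homE e M (m : M) x : ri_hom e m x = ract m (ri_val x).
Proof. by rewrite comp_lfunE ri_incE ractlE. Qed.

Lemma rhom_ri_hom e M (m : M) : rhom (ri_hom e m).
Proof. by move=> x a; rewrite !ri_homE ri_valE ractM. Qed.

Lemma ri_gen e (x : right_ideal e) : e * e = e -> ract (ri_mk e 1) (ri_val x) = x.
Proof. by move=> ee; apply: ri_val_inj; rewrite ri_valE ri_mkK // mulr1 ri_valP. Qed.

Lemma right_ideal_projective e : e * e = e -> projective (right_ideal e).
Proof.
move=> ee M N g f Hg /surjective_homP gS Hf.
have [m fm] := gS (f (ri_mk e 1)).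
exists (ri_hom e m); first exact: rhom_ri_hom.
by apply/lfunP => x; rewrite comp_lfunE ri_homE Hg -fm -Hf ri_gen.
Qed.

Lemma projective_iso M N : isomorphic M N -> projective M -> projective N.
Proof.
move=> [f [Hf fI fS]] HM M' N' g h Hg gS Hh.
have [h' Hh' E] := HM M' N' g (h \o f)%VF Hg gS (rhom_comp Hf Hh).
exists (h' \o f^-1)%VF; first exact: rhom_comp (rhom_inv Hf fI fS) Hh'.
apply/lfunP => x; rewrite comp_lfunE comp_lfunE -(comp_lfunE g) E comp_lfunE.
by rewrite limg_lfunVK // (eqP fS) memvf.
Qed.

End RightIdeals.

(** * Simple modules, characters and composition length *)

Section NakayamaModules.
Variables (K : fieldType) (A : falgType K) (n : nat) (c : nat -> nat).
Variable b : 'I_n -> nat -> A.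
Hypothesis Hb : nakayama_basis c b.
Implicit Types (M N P S : rmodule A) (i j k : 'I_n).

Local Notation cf := (cf c b).

Lemma idemE i : b i 0%N * b i 0%N = b i 0%N.
Proof. by rewrite (nb_mule Hb) eqxx. Qed.

Lemma cf_idem i j l : cf i l (b j 0%N) = ((i == j) && (l == 0%N))%:R.
Proof. by rewrite (cfE Hb) ?(nb_gt0 Hb). Qed.

Lemma cf_idem_mul i l j a : cf i l (b j 0%N * a) = (i == j)%:R * cf i l a.
Proof.
pose f : 'Hom(A, K^o) := (cf i l \o amull (b j 0%N))%VF.
pose g : 'Hom(A, K^o) := (i == j)%:R *: cf i l.
suff /(_ a) : f =1 g by rewrite comp_lfunE amullE scale_lfunE.
apply: (nb_lfunP Hb) => k m km; rewrite comp_lfunE amullE scale_lfunE (nb_mule Hb).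
rewrite (cfE Hb) //; have [jk|jk] := eqVneq j k.
  by rewrite (cfE Hb) // jk; case: eqP; rewrite ?scale1r ?scale0r.
rewrite linear0; have [ij|] := eqVneq i j; last by rewrite scale0r.
by rewrite ij (negPf jk) /= scaler0.
Qed.

(** The paths of positive length span a two-sided ideal, so the coefficient of an idempotent is a
    character of [A]. It defines the simple module at [i]. *)
Lemma cf0M i x y : cf i 0 (x * y) = cf i 0 x * cf i 0 y.
Proof.
pose f z : 'Hom(A, K^o) := (cf i 0 \o amulr z)%VF.
pose g z : 'Hom(A, K^o) := (cf i 0 z : K) *: cf i 0.
suff /(_ x) : f y =1 g y.
  by rewrite comp_lfunE amulrE scale_lfunE => ->; apply: mulrC.
apply: (nb_lfunP Hb) => k m km; rewrite comp_lfunE amulrE scale_lfunE.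
rewrite (cfE Hb) //.
pose f' : 'Hom(A, K^o) := (cf i 0 \o amull (b k m))%VF.
pose g' : 'Hom(A, K^o) := ((i == k) && (0%N == m))%:R *: cf i 0.
suff /(_ y) : f' =1 g'.
  by rewrite comp_lfunE amullE scale_lfunE => ->; apply: mulrC.
apply: (nb_lfunP Hb) => j l jl; rewrite comp_lfunE amullE scale_lfunE.
rewrite (nb_mul Hb) (cfE Hb) //.
have [E|] := eqVneq (sh k m) j.
  have [km'|km'] := ltnP (m + l)%N (c k); last first.
    rewrite (nb_eq0 Hb) // linear0; case: eqP => //= [ik|]; rewrite ?scale0r //.
    case: eqP => /= [m0|]; rewrite ?scale0r //.
    move: E km' jl; rewrite -m0 sh0 => ->; rewrite add0n => le lt.
    by rewrite leqNgt lt in le.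
  rewrite (cfE Hb) // [(0 == m + l)%N]eq_sym addn_eq0 [(0 == m)%N]eq_sym [(0 == l)%N]eq_sym.
  case: (eqVneq m 0%N) E => [->|m0] E; last by rewrite !andbF scale0r.
  by rewrite -E sh0; case: eqP; rewrite ?scale1r ?scale0r //= scale1r.
rewrite linear0 => E; case: eqP => //= [ik|]; rewrite ?scale0r //.
case: eqP => /= [m0|]; rewrite ?scale0r //.
by move: E; rewrite -m0 sh0 -ik => /negPf ->; rewrite scaler0.
Qed.

Lemma cf01 i : cf i 0 1 = 1.
Proof.
rewrite -(nb_one Hb) linear_sum (bigD1 i) //= cf_idem !eqxx big1 ?addr0 //.
by move=> j ji; rewrite cf_idem eq_sym (negPf ji).
Qed.

Lemma right_ideal_dec j a :
  b j 0%N * a = a -> a = \sum_(l < c j) cf j l a *: b j l.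
Proof.
move=> ja; rewrite {1}(nb_dec Hb a) (bigD1 j) //= [X in _ + X]big1 ?addr0 //.
move=> i ij; rewrite big1 // => l _.
by rewrite -ja cf_idem_mul (negPf ij) mul0r scale0r.
Qed.

(* The last nonzero stage of the radical filtration of [W] relative to [U]. *)
Lemma eigenvector M (U W : {vspace M}) :
  submodule W -> ~~ (W <= U)%VS ->
  exists j w, [/\ w \in W, w \notin U, ract w (b j 0%N) = w &
    forall i l, (0 < l)%N -> ract w (b i l) \in U].
Proof.
move=> HW /subvPn[w0 w0W w0U].
pose Q l := [exists i, ract w0 (b i l) \notin U].
have Q0 : exists l : nat, Q l.
  exists 0%N; apply: contraR w0U; rewrite negb_exists => /forallP w0e.
  rewrite -[w0]ract1 -(nb_one Hb) ract_sumr memv_suml // => i _.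
  by have := w0e i; rewrite negbK.
have [m mP] := nb_bump Hb.
have Qb l : Q l -> (l <= m)%N.
  by move=> /existsP[i]; apply: contraR; rewrite -ltnNge => /ltnW/mP ->; rewrite ract0r mem0v.
case: (ex_maxnP Q0 Qb) => l /existsP[i w1U] lmax.
exists (sh i l), (ract w0 (b i l)); split=> //; first exact: HW.
  by rewrite -ractM (nb_emul Hb) eqxx.
move=> k p p0; rewrite -ractM (nb_mul Hb); case: ifP => _; rewrite ?ract0r ?mem0v //.
apply: contraTT p0 => nU; rewrite -leqNgt -(leq_add2l l) addn0; apply: lmax.
by apply/existsP; exists i.
Qed.

(** Modulo [U] the vector [w] spans a copy of the simple module at [j]. *)
Lemma eigenvector_act M (U : {vspace M}) j (w : M) a :
  ract w (b j 0%N) = w -> (forall i l, (0 < l)%N -> ract w (b i l) \in U) ->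
  ract w a - cf j 0 a *: w \in U.
Proof.
move=> wj wU.
have FL : linear (fun a => ract w a - cf j 0 a *: w).
  move=> k x y; rewrite ractDr ractZr linearP /= scalerDl scalerBr scalerA.
  by rewrite opprD addrACA.
rewrite -(lfun_fromE FL) memv_preim; move: a; apply: (nb_ind Hb) => i l.
rewrite -memv_preim lfun_fromE.
case: l => [|l].
  rewrite cf_idem eqxx andbT -{1}wj -ractM (nb_mule Hb).
  by case: eqP => [<-|_]; rewrite ?ract0r ?scale0r ?scale1r ?wj subrr mem0v.
rewrite memvB ?wU //.
have [lt|/(nb_eq0 Hb) ->] := ltnP l.+1 (c i); last by rewrite linear0 scale0r mem0v.
by rewrite (cfE Hb) // andbF scale0r mem0v.
Qed.

(** Adjoining to [U] an eigenvector of [W] relative to [U] raises the dimension by exactly one. This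
    is why composition length is dimension. *)
Lemma composition_step M (U W : {vspace M}) :
  submodule U -> submodule W -> (U <= W)%VS -> U <> W ->
  exists V : {vspace M}, [/\ submodule V, (U <= V)%VS, (V <= W)%VS &
    \dim V = (\dim U).+1].
Proof.
move=> HU HW UW UnW.
have /(eigenvector HW)[j [w [wW wU wj wrad]]] : ~~ (W <= U)%VS.
  by apply/negP => WU; apply: UnW; apply/eqP; rewrite eqEsubv UW WU.
exists (U + <[w]>)%VS; split.
- move=> x a /memv_addP[u uU [v /vlineP[k ->] ->]].
  rewrite ractDl ractZl -[ract w a](subrK (cf j 0 a *: w)) scalerDr addrA.
  rewrite memv_add //; last by rewrite !memvZ ?memv_line.
  by rewrite memvD ?HU // memvZ // eigenvector_act.
- exact: addvSl.
- by rewrite subv_add UW -memvE.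
rewrite dimv_disjoint_sum; last first.
  apply/eqP; rewrite -subv0; apply/subvP => x /memv_capP[xU /vlineP[k xE]].
  rewrite memv0 xE; apply: contraNT wU; rewrite scaler_eq0 negb_or => /andP[k0 _].
  by rewrite -[w](scalerK k0) memvZ // -xE.
rewrite dim_vline; case: eqP wU => [->|_]; rewrite ?mem0v //.
by rewrite addn1.
Qed.

Lemma composition_lengthP M l : composition_length M l <-> \dim {:M} = l.
Proof.
split=> [[U [U0 Ul HU Ustep]]|<-].
  rewrite -Ul; suff dU : forall i : nat, (i <= l)%N -> \dim (U i) = i; first exact: (dU l (leqnn l)).
  elim=> [|i IH] il; first by rewrite U0 dimv0.
  have [UU Un Umax] := Ustep i il.
  have [V [HV UV VU dV]] := composition_step (HU i (ltnW il)) (HU _ il) UU Un.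
  have [E|<-] := Umax V HV UV VU; last by rewrite dV IH // ltnW.
  by move: dV; rewrite E => /eqP; rewrite (ltn_eqF (ltnSn _)).
have [U [U0 HU dU UU]] : exists U : nat -> {vspace M}, [/\ U 0%N = 0%VS,
   forall i : nat, (i <= \dim {:M})%N -> submodule (U i),
   forall i : nat, (i <= \dim {:M})%N -> \dim (U i) = i &
   forall i : nat, (i < \dim {:M})%N -> (U i <= U i.+1)%VS].
  elim: {-2}(\dim {:M}) (leqnn (\dim {:M})) => [|k IH] kM.
    exists (fun=> 0%VS); split=> // i; first by move=> _; apply: submodule0.
    by rewrite leqn0 => /eqP ->; rewrite dimv0.
  have [U [U0 HU dU UU]] := IH (ltnW kM).
  have [||V [HV UV _ dV]] := @composition_step M (U k) fullv (HU k (leqnn k)) (@submodulef _ _ M).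
  - exact: subvf.
  - by move=> E; move: kM; rewrite -E dU // ltnn.
  exists (fun i : nat => if (i <= k)%N then U i else V); split=> //.
  - by move=> i _; case: leqP => [/HU|].
  - move=> i ik1; case: leqP => [/dU//|ki].
    by rewrite dV dU //; apply/eqP; rewrite eqn_leq ki ik1.
  - move=> i ik1; case: ltnP => [ik|ki]; first by rewrite ltnW ?UU.
    by rewrite (_ : i = k) ?leqnn //; apply/eqP; rewrite eqn_leq ki -ltnS ik1.
exists U; split=> //.
  by apply/eqP; rewrite eqEdim subvf (dU _ (leqnn _)) leqnn.
move=> i il; have d0 := dU i (ltnW il); have d1 := dU i.+1 il.
split; first exact: UU.
  by move=> E; move: d1; rewrite -E d0 => /eqP; rewrite (ltn_eqF (ltnSn i)).
move=> V HV UV VU; have := dimvS UV; have := dimvS VU; rewrite d0 d1 => le1 le0.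
have [d|d] := leqP (\dim V) i; [left|right]; apply/eqP.
  by rewrite eq_sym eqEdim UV d0.
by rewrite eqEdim VU d1.
Qed.

(** Dual to [eigenvector]: a nonzero module has a one-dimensional quotient. Take any nonzero
    functional and precompose it with the action of a longest path that does not annihilate it; the
    source of that path is [j]. *)
Lemma coeigen_functional M : (fullv : {vspace M}) <> 0%VS ->
  exists j (phi : 'Hom(M, K^o)), phi <> 0 /\
    forall y a, phi (ract y a) = cf j 0 a * phi y.
Proof.
move=> M0.
have [phi0 phi0P] : exists phi : 'Hom(M, K^o), phi != 0.
  pose X := vbasis {:M}; pose v := vpick {:M}.
  have v0 : v != 0 by rewrite vpick0; apply/eqP.
  have [k kv] : exists k : 'I_(\dim {:M}), coord X k v != 0.
    apply/existsP; apply: contraNT v0; rewrite negb_exists => /forallP v0.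
    rewrite (coord_vbasis (memvf v)) big1 // => k _.
    by have := v0 k; rewrite negbK => /eqP ->; rewrite scale0r.
  have fL : linear (coord X k : M -> K^o) by move=> a x y; rewrite linearP.
  exists (lfun_from fL); apply: contraNneq kv => f0.
  by have := lfun_fromE fL v; rewrite f0 zero_lfunE => <-.
pose Q l := [exists i, (phi0 \o ractr M (b i l))%VF != 0].
have Q0 : exists l : nat, Q l.
  exists 0%N; apply: contraR phi0P; rewrite negb_exists => /forallP f0.
  apply/eqP/lfunP => x; rewrite -[x in phi0 x]ract1 -(nb_one Hb) ract_sumr linear_sum.
  rewrite big1 ?zero_lfunE // => i _.
  have := f0 i; rewrite negbK => /eqP/lfunP/(_ x).
  by rewrite comp_lfunE ractrE zero_lfunE.
have [m mP] := nb_bump Hb.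
have Qb l : Q l -> (l <= m)%N.
  move=> /existsP[i]; apply: contraR; rewrite -ltnNge => /ltnW/mP ->.
  by apply/eqP/lfunP => x; rewrite comp_lfunE ractrE ract0r linear0 zero_lfunE.
case: (ex_maxnP Q0 Qb) => l /existsP[i f1] lmax.
exists i, (phi0 \o ractr M (b i l))%VF; split; first exact/eqP.
move=> y a.
pose f : 'Hom(A, K^o) := (phi0 \o ractr M (b i l) \o ractl y)%VF.
pose g : 'Hom(A, K^o) := phi0 (ract y (b i l)) *: cf i 0.
suff /(_ a) : f =1 g.
  by rewrite !comp_lfunE scale_lfunE !ractrE ractlE => ->; apply: mulrC.
apply: (nb_lfunP Hb) => k p pk; rewrite !comp_lfunE scale_lfunE !ractrE ractlE.
rewrite -ractM (nb_mul Hb) (cfE Hb) //; case: p pk => [|p] pk.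
  rewrite sh0 add0n andbT eq_sym; case: eqP => [->|_]; first by rewrite [RHS]mulr1.
  by rewrite ract0r linear0 scaler0.
rewrite andbF scaler0; case: eqP => [E|_]; last by rewrite ract0r linear0.
apply/eqP; apply: contraTT (ltn0Sn p) => f0; rewrite -leqNgt.
rewrite -(leq_add2r l) add0n; apply: lmax; apply/existsP; exists k.
by apply: contraNneq f0 => /lfunP/(_ y); rewrite comp_lfunE ractrE zero_lfunE => ->.
Qed.

Section SimpleModule.
Variable j : 'I_n.

Let act (x : K^o) (a : A) : K^o := cf j 0 a *: x.

Let act_linearl a : linear (act^~ a).
Proof. by move=> k x y; rewrite /act scalerDr !scalerA mulrC. Qed.

Let act_linearr x : linear (act x).
Proof. by move=> k a a'; rewrite /act linearP /= scalerDl scalerA. Qed.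

Let act1 x : act x 1 = x.
Proof. by rewrite /act cf01 scale1r. Qed.

Let actM x a a' : act x (a * a') = act (act x a) a'.
Proof. by rewrite /act cf0M scalerA mulrC. Qed.

Definition simple_mod : rmodule A := RModule act_linearl act_linearr act1 actM.

End SimpleModule.

(** These conditions fix the isomorphism class ([simple_at_iso]) and the vertex ([simple_at_inj]),
    so simple modules can be compared through their vertices. *)
Definition simple_at j M : Prop :=
  \dim {:M} = 1%N /\ forall x a, ract x a = cf j 0 a *: x :> M.

Lemma simple_mod_at j : simple_at j (simple_mod j).
Proof. by split=> //; rewrite dimvf. Qed.

Lemma simple_at_iso j M N : simple_at j M -> simple_at j N -> isomorphic M N.
Proof.
move=> [dM aM] [dN aN].
pose v := vpick {:M}; pose w := vpick {:N}.
have v0 : v != 0 by rewrite vpick0 -dimv_eq0 dM.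
have w0 : w != 0 by rewrite vpick0 -dimv_eq0 dN.
have Mv : <[v]>%VS = {:M}%VS by apply/eqP; rewrite eqEdim subvf dim_vline v0 dM.
have Nw : <[w]>%VS = {:N}%VS by apply/eqP; rewrite eqEdim subvf dim_vline w0 dN.
have fL : linear (fun x : M => coord [tuple v] ord0 x *: w).
  by move=> k x y; rewrite linearP /= scalerDl scalerA.
pose f : 'Hom(M, N) := lfun_from fL.
have cv : coord [tuple v] ord0 v = 1.
  have free_v : free [tuple v] by rewrite seq1_free.
  exact: (coord_free (@ord0 0) ord0 free_v).
have fv : f v = w by rewrite lfun_fromE cv scale1r.
exists f; split.
- by move=> x a; rewrite aM aN linearZ.
- apply/eqP/vspaceP => x; rewrite memv_ker memv0.
  have /vlineP[k ->] : x \in <[v]>%VS by rewrite Mv memvf.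
  by rewrite linearZ /= fv !scaler_eq0 (negPf v0) (negPf w0).
- apply/surjective_homP => y; have /vlineP[k ->] : y \in <[w]>%VS by rewrite Nw memvf.
  by exists (k *: v); rewrite linearZ /= fv.
Qed.

Lemma simple_at_transfer j M N : isomorphic M N -> simple_at j M -> simple_at j N.
Proof.
move=> iMN [dM aM]; split; first by rewrite -(isomorphic_dim iMN).
move=> y a; have [f [Hf _ /surjective_homP fS]] := iMN.
by have [x ->] := fS y; rewrite -Hf aM linearZ.
Qed.

Lemma simple_at_inj i j M : simple_at i M -> simple_at j M -> i = j.
Proof.
move=> [dM aM] [_ aM']; apply/eqP; apply: contraTT isT => ij.
have v0 : vpick {:M} != 0 by rewrite vpick0 -dimv_eq0 dM.
have := aM (vpick {:M}) (b i 0%N); rewrite aM' !cf_idem !eqxx !andbT scale1r.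
by rewrite eq_sym (negPf ij) scale0r => E; rewrite -E eqxx in v0.
Qed.

Lemma simple_atP M : simple_module M <-> exists j, simple_at j M.
Proof.
split=> [[M0 Mmin]|[j [dM aM]]]; last first.
  split=> [E|U _]; first by rewrite E dimv0 in dM.
  have := dimvS (subvf U); rewrite dM; case d: (\dim U) => [|[|]] // _.
    by left; apply/eqP; rewrite -dimv_eq0 d.
  by right; apply/eqP; rewrite eqEdim subvf dM d.
have /(eigenvector (@submodulef _ _ M))[j [w [_ w0 wj wrad]]] : ~~ ({:M} <= 0)%VS.
  by rewrite subv0; apply/eqP.
have wa a : ract w a = cf j 0 a *: w.
  by apply/eqP; rewrite -subr_eq0 -memv0 eigenvector_act.
rewrite memv0 in w0.
have wM : <[w]>%VS = fullv.
  have [||//] := Mmin <[w]>%VS.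
    move=> x a /vlineP[k ->]; rewrite ractZl wa !memvZ ?memv_line //.
  by move/eqP; rewrite -dimv_eq0 dim_vline w0.
exists j; split; first by rewrite -wM dim_vline w0.
move=> x a; have /vlineP[k ->] : x \in <[w]>%VS by rewrite wM memvf.
by rewrite ractZl wa !scalerA mulrC.
Qed.

Lemma simple_mod_simple j : simple_module (simple_mod j).
Proof. by apply/simple_atP; exists j; apply: simple_mod_at. Qed.

End NakayamaModules.

Lemma injective_homP (K : fieldType) (A : falgType K) (M N : rmodule A) (f : 'Hom(M, N)) :
  (forall x, f x = 0 -> x = 0) -> injective_hom f.
Proof.
move=> f0; apply/eqP/vspaceP => x; rewrite memv_ker memv0.
by apply/eqP/eqP => [/f0|->]; rewrite ?linear0.
Qed.

Lemma dim1_vline (K : fieldType) (V : vectType K) (v : V) :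
  \dim {:V} = 1%N -> v != 0 -> forall x, exists k, x = k *: v.
Proof.
move=> d1 v0 x; apply/vlineP.
have -> : <[v]>%VS = {:V}%VS by apply/eqP; rewrite eqEdim subvf dim_vline v0 d1.
exact: memvf.
Qed.

Lemma dim1_neq0 (K : fieldType) (V : vectType K) :
  \dim {:V} = 1%N -> exists v : V, v != 0.
Proof. by move=> d1; exists (vpick {:V}); rewrite vpick0 -dimv_eq0 d1. Qed.

(** * Indecomposable projectives: units, generators, socles, covers *)

Section NakayamaProjectives.
Variables (K : fieldType) (A : falgType K) (n : nat) (c : nat -> nat).
Variable b : 'I_n -> nat -> A.
Hypothesis Hb : nakayama_basis c b.
Implicit Types (M N P S : rmodule A) (i j k : 'I_n).

Local Notation cf := (cf c b).
Local Notation simple_at := (simple_at c b).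

(** A path composed with the last path at [j] gives that path again only if it is the idempotent at
    [j]. Thus the effect of [u] on the socle shows whether [u] is a unit at [j]. *)
Lemma cf_last i j u : cf j (c j).-1 (u * b j (c j).-1) = cf j 0 u.
Proof.
pose f : 'Hom(A, K^o) := (cf j (c j).-1 \o amulr (b j (c j).-1))%VF.
suff /(_ u) : f =1 cf j 0 by rewrite comp_lfunE amulrE.
apply: (nb_lfunP Hb) => k l lk; rewrite comp_lfunE amulrE (nb_mul Hb) (cfE Hb) //.
have cj := nb_gt0 Hb j.
case: eqP => [E|kj].
  case: l lk E => [|l] lk E; first by rewrite add0n -E (cfE Hb) ?eqxx ?sh0 ?prednK // (nb_gt0 Hb).
  have [lt|/(nb_eq0 Hb) ->] := ltnP (l.+1 + (c j).-1)%N (c k); last by rewrite linear0 andbF.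
  by rewrite (cfE Hb) // andbF ltn_eqF ?andbF //; lia.
rewrite linear0; case: eqP => //= jk; case: eqP => // l0.
by case: kj; rewrite jk -l0 sh0.
Qed.

(** Used to see that the kernel of the map between the projectives at [ordS i] and [i] given by the
    arrow lies in the radical. *)
Lemma cf_first i a : (1 < c i)%N -> cf i 1 (b i 1 * a) = cf (ordS i) 0 a.
Proof.
move=> ci; pose f : 'Hom(A, K^o) := (cf i 1 \o amull (b i 1))%VF.
suff /(_ a) : f =1 cf (ordS i) 0 by rewrite comp_lfunE amullE.
apply: (nb_lfunP Hb) => k l lk; rewrite comp_lfunE amullE (nb_mul Hb) (cfE Hb) // sh1.
case: eqP => [E|]; last by rewrite linear0.
have [lt|ge] := ltnP (1 + l)%N (c i); first by rewrite (cfE Hb) // eqxx /= add1n eqSS.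
by rewrite (nb_eq0 Hb) // linear0 [X in _ && X]ltn_eqF ?andbF //; lia.
Qed.

(** Multiplying [a] by the arrow at the end of the path of length [l] moves its coefficient to
    length [l.+1]. If the product is zero, that coefficient vanishes unless the path is the last
    one. *)
Lemma right_ideal_socle j a : b j 0%N * a = a ->
  (forall i l, (0 < l)%N -> a * b i l = 0) ->
  a = cf j (c j).-1 a *: b j (c j).-1.
Proof.
move=> ja arad; have cj := nb_gt0 Hb j.
have a0 l : (l.+1 < c j)%N -> cf j l a = 0.
  move=> lj; have := arad (sh j l) 1%N isT.
  rewrite [in X in X -> _](right_ideal_dec Hb ja) mulr_suml => /(congr1 (cf j l.+1)).
  rewrite linear0 linear_sum (bigD1 (Ordinal (ltnW lj))) //= big1 ?addr0.
    rewrite -scalerAl linearZ /= (nb_mul Hb) eqxx addn1 (cfE Hb) // !eqxx /= => <-.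
    by rewrite [RHS]mulr1.
  move=> m; rewrite -val_eqE /= => ml; rewrite -scalerAl linearZ /= (nb_mul Hb).
  case: eqP => _; last by rewrite linear0 scaler0.
  have [lt|/(nb_eq0 Hb) ->] := ltnP (m + 1)%N (c j); last by rewrite linear0 scaler0.
  by rewrite (cfE Hb) // addn1 eqSS [l == m]eq_sym (negPf ml) andbF scaler0.
rewrite {1}(right_ideal_dec Hb ja).
have lt : ((c j).-1 < c j)%N by rewrite prednK.
rewrite (bigD1 (Ordinal lt)) //= big1 ?addr0 // => m; rewrite -val_eqE /= => ml.
by rewrite a0 ?scale0r //; have := ltn_ord m; lia.
Qed.

(* The kernel of left multiplication by [u] would otherwise meet the socle. *)
Lemma unit_inj j u a : cf j 0 u <> 0 -> b j 0%N * a = a -> u * a = 0 -> a = 0.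
Proof.
move=> u0 ja ua.
pose P := right_ideal (b j 0%N).
pose f : 'Hom(P, regular_module A) := (amull u \o ri_inc (b j 0%N))%VF.
have fE x : f x = u * ri_val x by rewrite comp_lfunE amullE ri_incE.
have Hf : rhom f by move=> x y; rewrite !fE ri_valE mulrA.
have [E|] := boolP (lker f <= 0)%VS.
  have : ri_mk (b j 0%N) a \in lker f by rewrite memv_ker fE ri_mkK ?(idemE Hb) // ja ua.
  move=> /(subvP E); rewrite memv0 => /eqP /(congr1 (ri_val (e := _))).
  by rewrite ri_mkK ?(idemE Hb) // ja => ->; rewrite -ri_incE linear0.
move=> /(eigenvector Hb (rhom_lker Hf)) [k [w [wf w0 wk wrad]]].
rewrite memv0 in w0.
have wE : ri_val w = cf j (c j).-1 (ri_val w) *: b j (c j).-1.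
  apply: right_ideal_socle; first exact: ri_valP.
  move=> i l /(wrad i); rewrite memv0 => /eqP/(congr1 (ri_val (e := _))).
  by rewrite ri_valE => ->; rewrite -ri_incE linear0.
move: wf; rewrite memv_ker fE => /eqP/(congr1 (cf j (c j).-1)).
rewrite linear0 wE -scalerAr linearZ /= cf_last // => /eqP.
rewrite scaler_eq0 => /orP[/eqP l0|/eqP//].
have : ri_val w = 0 by rewrite wE l0 scale0r.
rewrite -ri_incE => /eqP; rewrite ri_incE; move=> /eqP w0'.
by case/eqP: w0; apply: ri_val_inj; rewrite w0' -ri_incE linear0.
Qed.

(* [P] is a copy of [b j 0 * A] with generator [x]. *)
Definition pgen j P (x : P) : Prop :=
  [/\ ract x (b j 0%N) = x, forall y, exists a, y = ract x a &
      forall a, ract x a = 0 -> b j 0%N * a = 0].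

Lemma pgen_right_ideal j : pgen j (ri_mk (b j 0%N) 1).
Proof.
have jj := idemE Hb j; split.
- by apply: ri_val_inj; rewrite ri_valE ri_mkK // mulr1.
- by move=> y; exists (ri_val y); rewrite ri_gen.
- move=> a /(congr1 (ri_val (e := _))); rewrite ri_valE ri_mkK // mulr1 => ->.
  by rewrite -ri_incE linear0.
Qed.

Lemma pgen_neq0 j P (x : P) : pgen j x -> x != 0.
Proof.
move=> [_ _ xI]; apply: contra_neq (nb_neq0 Hb (nb_gt0 Hb j)) => x0.
by rewrite -(idemE Hb) xI // x0 ract0l.
Qed.

Lemma pgen_iso j P (x : P) : pgen j x -> isomorphic (right_ideal (b j 0%N)) P.
Proof.
move=> [xj xS xI]; exists (ri_hom (b j 0%N) x); split; first exact: rhom_ri_hom.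
  apply: injective_homP => y; rewrite ri_homE => /xI; rewrite ri_valP => y0.
  by apply: ri_val_inj; rewrite y0 -ri_incE linear0.
apply/surjective_homP => y; have [a ->] := xS y.
by exists (ri_mk (b j 0%N) a); rewrite ri_homE ri_mkK ?(idemE Hb) // ractM xj.
Qed.

Lemma pgen_projective j P (x : P) : pgen j x -> projective P.
Proof.
move=> /pgen_iso/projective_iso; apply.
exact: right_ideal_projective (idemE Hb j).
Qed.

(** The inverse of the isomorphism from [b j 0 * A], with values in [A]: computations in [P] become
    products in [A]. *)
Lemma pgen_rep j P (x : P) : pgen j x ->
  exists rep : 'Hom(P, A), (forall y, ract x (rep y) = y) /\
    forall a, rep (ract x a) = b j 0%N * a.
Proof.
move=> Hx; have [xj xS xI] := Hx.
pose f := ri_hom (b j 0%N) x.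
have f0 : lker f == 0%VS.
  apply: injective_homP => y; rewrite ri_homE => /xI; rewrite ri_valP => y0.
  by apply: ri_val_inj; rewrite y0 -ri_incE linear0.
have xfE a : ract x a = f (ri_mk (b j 0%N) a).
  by rewrite ri_homE ri_mkK ?(idemE Hb) // ractM xj.
exists (ri_inc (b j 0%N) \o f^-1)%VF; split=> [y|a].
  have [a ->] := xS y.
  by rewrite comp_lfunE (xfE a) lker0_lfunK // ri_incE -ri_homE.
by rewrite comp_lfunE xfE lker0_lfunK // ri_incE ri_mkK ?(idemE Hb).
Qed.

Lemma rep_lid j P (x : P) (rep : 'Hom(P, A)) :
  (forall y, ract x (rep y) = y) -> (forall a, rep (ract x a) = b j 0%N * a) ->
  forall y, b j 0%N * rep y = rep y.
Proof. by move=> r1 r2 y; rewrite -r2 r1. Qed.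

Lemma rep_ract j P (x : P) (rep : 'Hom(P, A)) :
  (forall y, ract x (rep y) = y) -> (forall a, rep (ract x a) = b j 0%N * a) ->
  forall y a, rep (ract y a) = rep y * a.
Proof.
by move=> r1 r2 y a; rewrite -{1}(r1 y) -ractM r2 mulrA (rep_lid r1 r2).
Qed.

Lemma pgen_hom j P (x : P) M (m : M) : pgen j x -> ract m (b j 0%N) = m ->
  exists2 h : 'Hom(P, M), rhom h & h x = m.
Proof.
move=> Hx mj; have [rep [r1 r2]] := pgen_rep Hx.
exists (ractl m \o rep)%VF => [y a|].
  by rewrite !comp_lfunE !ractlE (rep_ract r1 r2) ractM.
by rewrite comp_lfunE ractlE -[x]ract1 r2 mulr1 mj.
Qed.

(** Stated for an arbitrary list of lengths: all lengths give the dimension of [P], and selected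
    lengths give the dimension of a Hom space in [hom_sum_dim]. *)
Lemma pgen_span j P (x : P) s : pgen j x -> uniq s -> all (fun l => l < c j)%N s ->
  \dim <<[seq ract x (b j l) | l <- s]>> = size s.
Proof.
move=> Hx; have [rep [r1 r2]] := pgen_rep Hx.
move=> us ss; suff /eqP : free [seq ract x (b j l) | l <- s] by rewrite size_map.
elim: s us ss => [|l s IH] /=; first by rewrite nil_free.
move=> /andP[ls us] /andP[lj ss]; rewrite free_cons IH // andbT.
pose f : 'Hom(P, K^o) := (cf j l \o rep)%VF.
have fE m : (m < c j)%N -> f (ract x (b j m)) = (l == m)%:R.
  by move=> mj; rewrite comp_lfunE r2 (nb_mule Hb) eqxx (cfE Hb) // eqxx.
have : (<<[seq ract x (b j l) | l <- s]>> <= lker f)%VS.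
  apply/span_subvP => _ /mapP[m ms ->]; rewrite memv_ker fE; last exact: (allP ss).
  by case: (l =P m) ls => [->|_ _]; rewrite ?ms ?eqxx.
move/subvP => sub; apply/negP => /sub; rewrite memv_ker fE // eqxx.
by rewrite oner_eq0.
Qed.

Lemma pgen_dim j P (x : P) : pgen j x -> \dim {:P} = c j.
Proof.
move=> Hx; have [xj xS xI] := Hx.
have := @pgen_span j P x (iota 0 (c j)) Hx (iota_uniq _ _).
rewrite size_iota => <-; last by apply/allP => l; rewrite mem_iota.
congr (\dim _); apply/eqP; rewrite eq_sym eqEsubv subvf /=; apply/subvP => y _.
have [a ->] := xS y; have -> : ract x a = ract x (b j 0%N * a) by rewrite ractM xj.
have ja : b j 0%N * (b j 0%N * a) = b j 0%N * a by rewrite mulrA (idemE Hb).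
rewrite (right_ideal_dec Hb ja).
rewrite ract_sumr memv_suml // => l _; rewrite ractZr memvZ // memv_span //.
by apply/mapP; exists (l : nat); rewrite // mem_iota add0n leq0n ltn_ord.
Qed.

(** Left multiplication by [u] on [b j 0 * A] is injective by [unit_inj], hence surjective by
    dimension; [z] is a preimage of the idempotent. *)
Lemma unit_inv j u : b j 0%N * u = u -> cf j 0 u <> 0 ->
  exists z, u * z = b j 0%N.
Proof.
move=> ju u0; have jj := idemE Hb j.
pose f := ri_hom (b j 0%N) (ri_mk (b j 0%N) u).
have fE y : ri_val (f y) = u * ri_val y by rewrite ri_homE ri_valE ri_mkK // ju.
have /surjective_homP fS : surjective_hom f.
  apply: injective_dim_surjective => //; apply: injective_homP => y /(congr1 (ri_val (e := _))).
  rewrite fE -[ri_val 0]ri_incE linear0 => /(unit_inj u0 (ri_valP y)) y0.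
  by apply: ri_val_inj; rewrite y0 -ri_incE linear0.
have [y /(congr1 (ri_val (e := _)))] := fS (ri_mk (b j 0%N) 1).
by rewrite fE ri_mkK // mulr1 => ->; exists (ri_val y).
Qed.

(* The functional shows that [x] survives in a simple quotient, so that a section
   of [b j 0 * A -> P] maps [x] to a unit of the corner ring at [j]. *)
Lemma cyclic_projective j P (x : P) : projective P -> ract x (b j 0%N) = x ->
  x != 0 -> (forall y, exists a, y = ract x a) -> pgen j x.
Proof.
move=> HP xj x0 xS; split=> // a xa.
have jj := idemE Hb j.
pose f := ri_hom (b j 0%N) x.
have fS : surjective_hom f.
  apply/surjective_homP => y; have [a' ->] := xS y.
  by exists (ri_mk (b j 0%N) a'); rewrite ri_homE ri_mkK // ractM xj.
have [s Hs sE] := HP _ _ f \1%VF (@rhom_ri_hom _ _ _ _ _) fS (@rhom_id _ _ _).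
pose u := ri_val (s x).
have xu : ract x u = x by rewrite /u -ri_homE -comp_lfunE sE id_lfunE.
have uE y : ri_val (s (ract x y)) = u * y by rewrite Hs ri_valE.
have [|i [phi [phi0 phiE]]] := @coeigen_functional _ _ _ _ _ Hb P.
  by move=> P0; move: (memvf x); rewrite P0 memv0 (negPf x0).
have phix : phi x <> 0.
  by move=> phix; apply: phi0; apply/lfunP => y; have [a' ->] := xS y; rewrite phiE phix mulr0 zero_lfunE.
have u1 : cf i 0 u = 1.
  have := phiE x u; rewrite xu -[LHS]mul1r => /eqP.
  by rewrite eq_sym -subr_eq0 -mulrBl mulf_eq0 subr_eq0 => /orP[/eqP//|/eqP].
have ij : i = j.
  have := phiE x (b j 0%N); rewrite xj (cf_idem Hb) andbT; case: eqP => // _.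
  by rewrite mul0r.
rewrite ij in u1.
apply: (@unit_inj j u); first by rewrite u1; apply/eqP/oner_neq0.
  by rewrite mulrA jj.
by rewrite mulrA -uE xj -/u -uE xa linear0 -ri_incE linear0.
Qed.

(** Take a simple quotient [phi] of [P], at the vertex [j], and a vector [x] at [j] that it does not
    kill. Projectivity lifts [phi] to a map [q] into [b j 0 * A]. Since [q x] is right invertible at
    [j], [q] maps [x A] isomorphically onto [b j 0 * A], so [P] is the direct sum of [x A] and the
    kernel of [q]; as [P] is indecomposable, the kernel is zero. *)
Lemma indecomposable_projective P : indecomposable P -> projective P ->
  exists j (x : P), pgen j x.
Proof.
move=> [P0 Pind] HP.
have [j [phi [phi0 phiE]]] := coeigen_functional Hb P0.
have jj := idemE Hb j.
have [x0 phix0] : exists x0, phi x0 != 0.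
  have : phi != 0 by apply/eqP.
  by move=> /lfunPn[x]; rewrite zero_lfunE; exists x.
pose x := ract x0 (b j 0%N).
have xj : ract x (b j 0%N) = x by rewrite -ractM jj.
have phix : phi x != 0 by rewrite phiE (cf_idem Hb) !eqxx mul1r.
pose g : 'Hom(right_ideal (b j 0%N), simple_mod Hb j) := (cf j 0 \o ri_inc (b j 0%N))%VF.
have gE y : g y = cf j 0 (ri_val y) by rewrite comp_lfunE ri_incE.
have Hg : rhom g by move=> y a; rewrite !gE ri_valE (cf0M Hb) [LHS]mulrC.
have gS : surjective_hom g.
  apply/surjective_homP => k; exists ((k : K) *: ri_mk (b j 0%N) 1).
  by rewrite linearZ /= gE ri_mkK // mulr1 (cf_idem Hb) !eqxx [RHS]mulr1.
have [q Hq qE] := HP _ (simple_mod Hb j) g phi Hg gS phiE.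
have gq y : cf j 0 (ri_val (q y)) = phi y by rewrite -gE -comp_lfunE qE.
pose u := ri_val (q x).
have uP a : ri_val (q (ract x a)) = u * a by rewrite Hq ri_valE.
have u0 : cf j 0 u <> 0 by rewrite gq; apply/eqP.
have ju : b j 0%N * u = u by rewrite ri_valP.
have [z uz] := unit_inv ju u0.
have xI a : u * a = 0 -> b j 0%N * a = 0.
  by move=> ua; apply: (unit_inj u0); rewrite mulrA ?jj // -uP xj -/u ua.
have HU : submodule (limg (ractl x)).
  move=> y a /memv_imgP[a' _ ->]; rewrite ractlE -ractM -ractlE memv_img ?memvf //.
exists j, x.
have [||UE|VE] := Pind (limg (ractl x)) (lker q) HU (rhom_lker Hq).
- apply/vspaceP => y; rewrite memvf -[y](subrK (ract x (z * ri_val (q y)))) addrC.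
  apply: memv_add; first by rewrite -ractlE memv_img ?memvf.
  rewrite memv_ker; apply/eqP; apply: ri_val_inj.
  by rewrite linearB ri_valB uP mulrA uz ri_valP subrr ri_val0.
- apply/eqP; rewrite -subv0; apply/subvP => y /memv_capP[/memv_imgP[a _ ->]].
  rewrite ractlE memv_ker memv0 => /eqP/(congr1 (ri_val (e := _))).
  rewrite uP -[ri_val 0]ri_incE linear0 => /xI ja.
  by rewrite -xj -ractM ja ract0r.
- have : x \in limg (ractl x) by rewrite -[x in x \in _]ract1 -ractlE memv_img ?memvf.
  by rewrite UE memv0 => /eqP x0'; rewrite x0' linear0 eqxx in phix.
have xS y : exists a, y = ract x a.
  exists (z * ri_val (q y)); apply/eqP; rewrite -subr_eq0 -memv0 -VE memv_ker.
  apply/eqP; apply: ri_val_inj.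
  by rewrite linearB ri_valB uP mulrA uz ri_valP subrr ri_val0.
split=> // a xa; apply: xI; rewrite -uP xa linear0 -ri_incE linear0 //.
Qed.

Section Socle.
Variables (j : 'I_n) (P : rmodule A) (x : P).
Hypothesis Hx : pgen j x.

Let s := ract x (b j (c j).-1).
Let k := sh j (c j).-1.

Lemma pgen_socle_neq0 : s != 0.
Proof.
case: Hx => _ _ xI; apply/eqP => /xI; rewrite (nb_mule Hb) eqxx => /eqP.
by apply/negP/(nb_last Hb).
Qed.

Lemma pgen_socle_act a : ract s a = cf k 0 a *: s.
Proof.
apply/eqP; rewrite -subr_eq0 -memv0; apply: (eigenvector_act Hb).
  by rewrite -ractM (nb_emul Hb) eqxx.
move=> i l l0; rewrite -ractM (nb_mul Hb).
case: (_ =P i) => _; last by rewrite ract0r mem0v.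
by rewrite (nb_eq0 Hb) ?ract0r ?mem0v //; have := nb_gt0 Hb j; lia.
Qed.

(** An eigenvector of [U] relative to 0 is annihilated by the radical, hence is a multiple of [s] by
    [right_ideal_socle]. *)
Lemma submodule_has_socle (U : {vspace P}) : submodule U -> U <> 0%VS -> s \in U.
Proof.
move=> HU U0; have [rep [r1 r2]] := pgen_rep Hx.
have /(eigenvector Hb HU)[i [w [wU w0 _ wrad]]] : ~~ (U <= 0)%VS.
  by rewrite subv0; apply/eqP.
have wE := right_ideal_socle (rep_lid r1 r2 w).
have {}wE : w = cf j (c j).-1 (rep w) *: s.
  rewrite -{1}(r1 w) {1}wE ?ractZr // => i' l /(wrad i'); rewrite memv0 => /eqP.
  by rewrite -(rep_ract r1 r2) => ->; rewrite linear0.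
rewrite memv0 in w0; have l0 : cf j (c j).-1 (rep w) != 0.
  by apply: contraNneq w0 => l0; rewrite wE l0 scale0r.
by rewrite -[s](scalerK l0) -wE memvZ.
Qed.

Lemma pgen_socle_submodule : submodule <[s]>%VS.
Proof.
by move=> y a /vlineP[l ->]; rewrite ractZl pgen_socle_act !memvZ ?memv_line.
Qed.

Lemma pgen_is_socle : is_socle <[s]>%VS.
Proof.
have s0 := pgen_socle_neq0.
have sN0 : <[s]>%VS <> 0%VS.
  by move/eqP; rewrite -dimv_eq0 dim_vline s0.
split; first exact: pgen_socle_submodule.
  move=> V [HV V0 Vmin].
  have [|//|<-//] := Vmin _ pgen_socle_submodule.
  by rewrite -memvE submodule_has_socle.
move=> W HW; apply; split=> //; first exact: pgen_socle_submodule.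
move=> V HV Vs; have [->|/eqP V0] := eqVneq V 0%VS; [by left|right].
by apply/eqP; rewrite eqEsubv Vs -memvE submodule_has_socle.
Qed.

Lemma pgen_indecomposable : indecomposable P.
Proof.
split=> [P0|U V HU HV _ UV].
  by have := pgen_neq0 Hx; rewrite -memv0 -P0 memvf.
have [->|/eqP U0] := eqVneq U 0%VS; [by left|].
have [->|/eqP V0] := eqVneq V 0%VS; [by right|].
have : s \in (U :&: V)%VS by rewrite memv_cap !submodule_has_socle.
by rewrite UV memv0 (negPf pgen_socle_neq0).
Qed.

Lemma pgen_socle_of S : socle_of P S <-> simple_at k S.
Proof.
split=> [[f [Hf fI [HU socU Umin]]]|HS].
  have [Hs socs smin] := pgen_is_socle.
  have E : limg f = <[s]>%VS.
    by apply/eqP; rewrite eqEsubv smin ?Umin.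
  split; first by rewrite -(limg_dim_eq (f := f)) ?E ?dim_vline ?pgen_socle_neq0 // (eqP fI) capv0.
  move=> y a; have /lker0P fJ := fI; apply: fJ; rewrite Hf linearZ /=.
  have /vlineP[l ->] : f y \in <[s]>%VS by rewrite -E memv_img ?memvf.
  by rewrite ractZl pgen_socle_act !scalerA mulrC.
have Hk : simple_at k (sub_rmodule pgen_socle_submodule).
  split; first by rewrite dim_sub_rmodule dim_vline pgen_socle_neq0.
  move=> y a; apply: sub_val_inj; rewrite sub_ractE.
  have /vlineP[l yE] := sub_valP y.
  rewrite -[sub_val (_ *: _)]sub_inclE linearZ /= sub_inclE yE.
  by rewrite ractZl pgen_socle_act !scalerA mulrC.
have [f [Hf fI /surjective_homP fS]] := simple_at_iso HS Hk.
exists (sub_incl pgen_socle_submodule \o f)%VF; split.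
- exact: rhom_comp Hf (@rhom_sub_incl _ _ _ _ _).
- apply: injective_homP => y; rewrite comp_lfunE sub_inclE => f0.
  have /lker0P fJ := fI; apply: fJ; rewrite linear0; apply: sub_val_inj.
  by rewrite f0 -sub_inclE linear0.
- suff -> : limg (sub_incl pgen_socle_submodule \o f)%VF = <[s]>%VS by exact: pgen_is_socle.
  apply/vspaceP => y; apply/memv_imgP/idP => [[z _ ->]|ys].
    by rewrite comp_lfunE sub_inclE sub_valP.
  have [z zE] := fS (sub_proj pgen_socle_submodule y).
  by exists z; rewrite ?memvf // comp_lfunE -zE sub_inclE sub_projK.
Qed.

End Socle.

Lemma projective_cover_pgen i M P (p : 'Hom(P, M)) :
  simple_at i M -> projective_cover_map p -> exists2 x, pgen i x & p x != 0.
Proof.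
move=> [dM aM] [HP Hp /surjective_homP pS pker].
have [v v0] := dim1_neq0 dM; have [y yE] := pS v.
pose x := ract y (b i 0%N).
have px : p x = v by rewrite Hp -yE aM (cf_idem Hb) !eqxx scale1r.
have xi : ract x (b i 0%N) = x by rewrite -ractM (idemE Hb).
exists x; last by rewrite px.
have HU : submodule (limg (ractl x)).
  by move=> z a /memv_imgP[a' _ ->]; rewrite ractlE -ractM -ractlE memv_img ?memvf.
have UE := pker _ HU; apply: cyclic_projective => //.
  by apply: contraNneq v0 => x0; rewrite -px x0 linear0.
move=> z; have : z \in limg (ractl x).
  rewrite UE ?memvf //; apply/vspaceP => w; rewrite memvf.
  have [l wE] := dim1_vline dM v0 (p w).
  rewrite -[w](subrK (l *: x)); apply: memv_add.
    by rewrite memv_ker linearB linearZ /= wE px subrr.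
  by rewrite memvZ // -[x in x \in _]ract1 -ractlE memv_img ?memvf.
by move=> /memv_imgP[a _ ->]; exists a; rewrite ractlE.
Qed.

(** If [V] is a submodule with [U + V] full, it contains some [ract x a] whose [a] has coefficient 1
    at the idempotent. Then [b j 0 * a] is right invertible and [x] itself lies in [V]. *)
Lemma pgen_superfluous j P (x : P) (U : {vspace P}) : pgen j x ->
  (forall a, ract x a \in U -> cf j 0 a = 0) -> superfluous U.
Proof.
move=> Hx HU V HV UV; have [xj xS xI] := Hx.
have [u uU [v vV xE]] : exists2 u, u \in U & exists2 v, v \in V & x = u + v.
  by apply/memv_addP; rewrite UV memvf.
have [a vE] := xS v.
have a1 : cf j 0 a = 1.
  have : ract x (1 - a) \in U by rewrite ractDr ract1 -scaleN1r ractZr scaleN1r -vE {1}xE addrK.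
  move=> /HU; rewrite linearB /= (cf01 Hb) => /eqP.
  by rewrite subr_eq0 eq_sym => /eqP.
have [||z zE] := @unit_inv j (b j 0%N * a).
- by rewrite mulrA (idemE Hb).
- by rewrite (cf_idem_mul Hb) eqxx mul1r a1; apply/eqP/oner_neq0.
have xV : x \in V by rewrite -xj -zE -mulrA ractM xj ractM -vE HV.
by apply/vspaceP => y; rewrite memvf; have [a' ->] := xS y; rewrite HV.
Qed.

Lemma pgen_cover i M P (x : P) : simple_at i M -> pgen i x ->
  exists2 p : 'Hom(P, M), projective_cover_map p & forall a, p (ract x a) = 0 <-> cf i 0 a = 0.
Proof.
move=> [dM aM] Hx; have [v v0] := dim1_neq0 dM.
have [|p Hp px] := @pgen_hom i P x M v Hx; first by rewrite aM (cf_idem Hb) !eqxx scale1r.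
have pE a : p (ract x a) = cf i 0 a *: v by rewrite Hp px aM.
have p0 a : p (ract x a) = 0 <-> cf i 0 a = 0.
  rewrite pE; split=> [/eqP|->]; rewrite ?scale0r // scaler_eq0 (negPf v0) orbF.
  by move/eqP.
exists p => //; split=> //; first exact: pgen_projective Hx.
  apply/surjective_homP => y; have [l ->] := dim1_vline dM v0 y.
  by exists (l *: x); rewrite linearZ /= px.
by apply: (pgen_superfluous Hx) => a; rewrite memv_ker => /eqP/p0.
Qed.

Lemma simple_projectiveP i M : simple_at i M -> (projective M <-> c i = 1%N).
Proof.
move=> HM; have [dM aM] := HM; split=> [HP|ci].
  have [v v0] := dim1_neq0 dM.
  rewrite -dM -(@pgen_dim i M v) //; apply: cyclic_projective => //.
    by rewrite aM (cf_idem Hb) !eqxx scale1r.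
  move=> y; have [l ->] := dim1_vline dM v0 y; exists (l%:A).
  by rewrite ractZr ract1.
have Hx := pgen_right_ideal i; have [xj xS xI] := Hx.
apply: (@projective_iso _ _ (right_ideal (b i 0%N))); last exact: right_ideal_projective (idemE Hb i).
apply: (@simple_at_iso _ _ _ _ _ i) => //; split; first by rewrite (pgen_dim Hx).
set x := ri_mk _ _ in Hx xj xS xI.
have xa a : ract x a = cf i 0 a *: x.
  apply/eqP; rewrite -subr_eq0 -memv0; apply: (eigenvector_act Hb) => // k l l0.
  have -> : ract x (b k l) = ract x (b i 0%N * b k l) by rewrite ractM xj.
  rewrite (nb_mule Hb); case: (_ =P k) => [E|_]; last by rewrite ract0r mem0v.
  have -> : b k l = 0 by apply: (nb_eq0 Hb); rewrite -E ci.
  by rewrite ract0r mem0v.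
by move=> y a; have [a' ->] := xS y; rewrite -ractM !xa (cf0M Hb) scalerA mulrC.
Qed.

End NakayamaProjectives.

(** * The Auslander-Reiten translate *)

Section NakayamaTranslate.
Variables (K : fieldType) (A : falgType K) (n : nat) (c : nat -> nat).
Variable b : 'I_n -> nat -> A.
Hypothesis Hb : nakayama_basis c b.
Implicit Types (M N P S : rmodule A) (i j k : 'I_n).

Local Notation cf := (cf c b).
Local Notation simple_at := (simple_at c b).
Local Notation pgen := (pgen b).

Lemma radical_left i a : b i 0%N * a = a -> cf i 0 a = 0 ->
  exists a', a = b i 1 * a'.
Proof.
move=> ia a0; exists (\sum_(l < c i) cf i l a *: b (ordS i) l.-1).
rewrite {1}(right_ideal_dec Hb ia) mulr_sumr; apply: eq_bigr => l _.
rewrite -scalerAr (nb_mul Hb) eqxx add1n; case: l => [[|l] lt] //=.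
by rewrite a0 !scale0r.
Qed.

(** At most one arrow ends at a vertex, so a path of positive length ending at [ordS i] has the
    arrow at [i] as its last factor. *)
Lemma radical_right i a : a * b (ordS i) 0%N = a -> cf (ordS i) 0 a = 0 ->
  exists a', a = a' * b i 1.
Proof.
move=> aj a0.
exists (\sum_(k < n) \sum_(l < c k | sh k l == ordS i) cf k l a *: b k l.-1).
rewrite -{1}aj {1}(nb_dec Hb a) !mulr_suml; apply: eq_bigr => k _.
rewrite !mulr_suml [RHS]big_mkcond /=; apply: eq_bigr => l _.
rewrite -scalerAl (nb_emul Hb); case: eqP => E; last by rewrite scaler0.
rewrite -scalerAl (nb_mul Hb); case: l E => [[|l] lt] /= E.
  by move: a0; rewrite -E ?sh0 => ->; rewrite !scale0r.
by rewrite addn1 (_ : sh k l == i) //; apply/eqP/(@ordS_inj n).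
Qed.

(* [Hom(P1, A) = A b j 0] is, modulo the maps that factor through [p1], spanned
   by the class of the idempotent at [j = ordS i], i.e. by the map [rep1]. *)
Lemma presentation_functional i P0 P1 (p1 : 'Hom(P1, P0)) (x0 : P0) (y1 : P1)
    (rep1 : 'Hom(P1, regular_module A)) (h : 'Hom(P1, regular_module A))
    (xi : 'Hom('Hom(P1, regular_module A), K^o)) :
  pgen i x0 -> pgen (ordS i) y1 -> rhom p1 -> p1 y1 = ract x0 (b i 1) ->
  rhom rep1 -> rep1 y1 = b (ordS i) 0%N -> rhom h ->
  (forall h0 : 'Hom(P0, regular_module A), rhom h0 -> xi (h0 \o p1)%VF = 0) ->
  xi h = cf (ordS i) 0 (h y1) * xi rep1.
Proof.
move=> Hx Hy Hp p1y Hrep repy Hh xi0; have [yj yS yI] := Hy.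
set k := cf _ _ _.
have hyj : h y1 * b (ordS i) 0%N = h y1 by rewrite -{2}yj Hh.
pose z : A := h y1 - k *: b (ordS i) 0%N.
have [||z' zE] := @radical_right i z.
- by rewrite mulrBl hyj -scalerAl (idemE Hb).
- by rewrite linearB linearZ /= (cf_idem Hb) !eqxx [_ *: _]mulr1 subrr.
have [|h0 Hh0 h0x] := @pgen_hom _ _ _ _ _ Hb i P0 x0 (regular_module A) (z' * b i 0%N) Hx.
  by rewrite /= -mulrA (idemE Hb).
have -> : h = k *: rep1 + (h0 \o p1)%VF.
  apply/lfunP => y; have [a ->] := yS y.
  rewrite add_lfunE scale_lfunE comp_lfunE Hh Hrep Hp p1y -ractM Hh0 h0x repy /=.
  rewrite -mulrA mulrA [X in _ = _ + X]mulrA -[z' * _ * _]mulrA (nb_mule Hb) eqxx -zE.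
  by rewrite mulrBl -scalerAl addrC subrK.
by rewrite linearD linearZ /= xi0 // addr0.
Qed.

(** The presentation is arbitrary here, so its terms must be recognised: minimality makes [P0] the
    projective at [i], generated by [x0], and [P1] the projective at [ordS i], generated by a
    preimage of [x0] times the arrow. By [presentation_functional] each [theta x] is then known from
    its value at [rep1], and evaluation there embeds [N] into the base field. *)
Lemma ar_translate_simple i M N : simple_at i M -> (1 < c i)%N ->
  ar_translate M N -> simple_at (ordS i) N.
Proof.
move=> HM ci [P0 [P1 [p0 [p1 [Hp0 [HP1 Hp1 p1ker p1sup] [theta [th1 th2 th3]]]]]]].
set j := ordS i.
have [x0 Hx0 p0x0] := projective_cover_pgen Hb HM Hp0.
have [_ Hp0h _ _] := Hp0; have [x0i x0S x0I] := Hx0; have [dM aM] := HM.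
pose y0 := ract x0 (b i 1).
have bi1 : b i 1 != 0 by apply: (nb_neq0 Hb).
have y0j : ract y0 (b j 0%N) = y0 by rewrite -ractM (nb_emul Hb) eqxx.
have y0N : y0 != 0.
  by apply: contra_neq bi1 => /x0I; rewrite (nb_mule Hb) eqxx.
have [y p1y] : exists y, p1 y = y0.
  have : y0 \in limg p1.
    by rewrite p1ker memv_ker Hp0h aM (cfE Hb) // andbF scale0r.
  by move=> /memv_imgP[y _ ->]; exists y.
pose y1 := ract y (b j 0%N).
have p1y1 : p1 y1 = y0 by rewrite Hp1 p1y.
have y1j : ract y1 (b j 0%N) = y1 by rewrite -ractM (idemE Hb).
have HU : submodule (limg (ractl y1)).
  by move=> z a /memv_imgP[a' _ ->]; rewrite ractlE -ractM -ractlE memv_img ?memvf.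
have y1S z : exists a, z = ract y1 a.
  suff : z \in limg (ractl y1) by move=> /memv_imgP[a _ ->]; exists a; rewrite ractlE.
  rewrite (p1sup _ HU) ?memvf //; apply/vspaceP => w; rewrite memvf.
  have : p1 w \in lker p0 by rewrite -p1ker memv_img ?memvf.
  have [a p1w] := x0S (p1 w); rewrite memv_ker p1w Hp0h aM scaler_eq0 (negPf p0x0) orbF => /eqP a0.
  have [||a' aE] := @radical_left i (b i 0%N * a).
  - by rewrite mulrA (idemE Hb).
  - by rewrite (cf_idem_mul Hb) eqxx mul1r.
  have p1w' : p1 w = p1 (ract y1 a').
    by rewrite Hp1 p1y1 -ractM -aE ractM x0i.
  rewrite -[w](subrK (ract y1 a')); apply: memv_add; last first.
    by rewrite -ractlE memv_img ?memvf.
  by rewrite memv_ker linearB /= p1w' subrr.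
have Hy1 : pgen j y1.
  apply: (cyclic_projective Hb) => //.
  by apply: contra_neq y0N => y10; rewrite -p1y1 y10 linear0.
have [|rep1 Hrep1 rep1y] := @pgen_hom _ _ _ _ _ Hb j P1 y1 (regular_module A) (b j 0%N) Hy1.
  exact: (idemE Hb).
pose ev x : K^o := theta x rep1.
have evL : linear ev by move=> k x x'; rewrite /ev linearP add_lfunE scale_lfunE.
pose f : 'Hom(N, K^o) := lfun_from evL.
have thE x h : rhom h -> theta x h = cf j 0 (h y1) * ev x.
  move=> Hh; apply: (presentation_functional Hx0 Hy1 Hp1 p1y1 Hrep1 rep1y Hh).
  by apply/th3; exists x.
have f0 : lker f == 0%VS.
  apply/eqP/vspaceP => x; rewrite memv_ker memv0 lfun_fromE.
  apply/eqP/eqP => [ex|->]; last by rewrite /ev linear0 zero_lfunE.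
  by apply: th2 => h Hh; rewrite thE // ex mulr0.
have aN (x : N) a : ract x a = cf j 0 a *: x.
  have /lker0P fI := f0; apply: fI; rewrite linearZ /= !lfun_fromE /ev th1 // thE; last first.
    by move=> z a'; rewrite !comp_lfunE Hrep1 !amullE /= mulrA.
  by rewrite comp_lfunE amullE rep1y (cf0M Hb) (cf_idem Hb) !eqxx mulr1.
split=> //.
have fS : limg f = fullv.
  (* The coefficient of [h y1] at the idempotent kills every map factoring through [p1], because
     [p1 y1] lies in the radical. It is the functional that makes [N] nonzero. *)
  have xiL : linear (fun h : 'Hom(P1, regular_module A) => cf j 0 (h y1) : K^o).
    by move=> k h h'; rewrite add_lfunE scale_lfunE linearP.
  have [|x xE] := (th3 (lfun_from xiL)).1.
    move=> h0 Hh0; rewrite lfun_fromE comp_lfunE p1y1 Hh0 /= (cf0M Hb) (cfE Hb) //.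
    by rewrite andbF mulr0.
  have fx : f x = 1.
    by rewrite lfun_fromE /ev xE // lfun_fromE rep1y (cf_idem Hb) !eqxx.
  apply/vspaceP => k; rewrite memvf; apply/memv_imgP; exists ((k : K) *: x); rewrite ?memvf //.
  by rewrite linearZ /= fx [RHS]mulr1.
by rewrite -(limg_dim_eq (f := f)) ?fS ?dimvf // (eqP f0) capv0.
Qed.

(** Here the presentation is chosen: the projective at [ordS i] maps to the one at [i] by left
    multiplication with the arrow. The admissible functionals form the line spanned by [xi0], and
    [theta] matches it with [N] by a coordinate. *)
Lemma simple_ar_translate i M N : simple_at i M -> (1 < c i)%N ->
  simple_at (ordS i) N -> ar_translate M N.
Proof.
move=> HM ci [dN aN]; set j := ordS i.
pose P0 := right_ideal (b i 0%N); pose P1 := right_ideal (b j 0%N).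
have ii := idemE Hb i; have jj := idemE Hb j.
have Hx0 := pgen_right_ideal Hb i; have Hy1 := pgen_right_ideal Hb j.
set x0 := ri_mk (b i 0%N) 1 in Hx0; set y1 := ri_mk (b j 0%N) 1 in Hy1.
have [p0 Hp0 p0E] := pgen_cover Hb HM Hx0.
have [x0i x0S x0I] := Hx0; have [y1j y1S y1I] := Hy1.
pose p1 := ri_hom (b j 0%N) (ract x0 (b i 1)).
have Hp1 : rhom p1 by apply: rhom_ri_hom.
have ij1 : b i 1 * b j 0%N = b i 1 by rewrite (nb_emul Hb) eqxx.
have p1E a : p1 (ract y1 a) = ract x0 (b i 1 * a).
  by rewrite Hp1 ri_homE ri_mkK // mulr1 -!ractM mulrA ij1.
have p1y1 : p1 y1 = ract x0 (b i 1) by rewrite -[y1]ract1 p1E mulr1.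
exists P0, P1, p0, p1; split=> //.
  split=> //; first exact: (pgen_projective Hb Hy1).
    apply/vspaceP => y; rewrite memv_ker; apply/memv_imgP/eqP => [[z _ ->]|].
      have [a ->] := y1S z; rewrite p1E; apply/p0E.
      by rewrite (cf0M Hb) (cfE Hb) // andbF mul0r.
    have [a ->] := x0S y => /p0E a0.
    have [||a' aE] := @radical_left i (b i 0%N * a).
    - by rewrite mulrA ii.
    - by rewrite (cf_idem_mul Hb) eqxx mul1r.
    by exists (ract y1 a'); rewrite ?memvf // p1E -aE ractM x0i.
  apply: (pgen_superfluous Hb Hy1) => a; rewrite memv_ker p1E => /eqP/x0I.
  by rewrite mulrA (nb_mule Hb) eqxx => E; rewrite -(cf_first Hb) // E linear0.
have [v v0] := dim1_neq0 dN.
have free_v : free [tuple v] by rewrite seq1_free.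
have kL : linear (coord [tuple v] ord0 : N -> K^o) by move=> k x y; rewrite linearP.
pose kap : 'Hom(N, K^o) := lfun_from kL.
have kv : kap v = 1 by rewrite lfun_fromE; exact: (coord_free (@ord0 0) ord0 free_v).
have kE x : x = kap x *: v.
  by have [l ->] := dim1_vline dN v0 x; rewrite linearZ /= kv [_ *: 1]mulr1.
have xiL : linear (fun h : 'Hom(P1, regular_module A) => cf j 0 (h y1) : K^o).
  by move=> k h h'; rewrite add_lfunE scale_lfunE linearP.
pose xi0 := lfun_from xiL.
have thL : linear (fun x : N => kap x *: xi0).
  by move=> k x y; rewrite linearP /= scalerDl scalerA.
have [|rep1 Hrep1 rep1y] := @pgen_hom _ _ _ _ _ Hb j P1 y1 (regular_module A) (b j 0%N) Hy1.
  exact: jj.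
exists (lfun_from thL); split.
- move=> x a h Hh; rewrite !lfun_fromE !scale_lfunE !lfun_fromE comp_lfunE amullE.
  rewrite (cf0M Hb) aN linearZ /=.
  exact: (etrans (esym (mulrA _ _ _)) (mulrCA _ _ _)).
- move=> x /(_ _ Hrep1); rewrite lfun_fromE scale_lfunE [xi0 _]lfun_fromE rep1y.
  rewrite (cf_idem Hb) !eqxx => /eqP; rewrite [_ *: _]mulr1 => /eqP k0.
  by rewrite [x]kE k0 scale0r.
move=> xi; split=> [xiP|[x xE] h0 Hh0].
  exists (xi rep1 *: v) => h Hh; rewrite lfun_fromE scale_lfunE [xi0 _]lfun_fromE.
  rewrite linearZ /= kv [_ *: 1]mulr1 (presentation_functional Hx0 Hy1 Hp1 p1y1 Hrep1 rep1y Hh xiP).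
  exact: mulrC.
rewrite -xE; last exact: rhom_comp.
rewrite lfun_fromE scale_lfunE [xi0 _]lfun_fromE comp_lfunE p1y1 Hh0 /= (cf0M Hb) (cfE Hb) //.
by rewrite andbF mulr0 scaler0.
Qed.

Lemma ar_translateP i M N : simple_at i M -> (1 < c i)%N ->
  (ar_translate M N <-> simple_at (ordS i) N).
Proof.
by move=> HM ci; split; [apply: ar_translate_simple|apply: simple_ar_translate].
Qed.

End NakayamaTranslate.

(** * Injectives and the defect *)

Section InjectiveHull.
Variables (K : fieldType) (A : falgType K) (e : A).
Hypothesis ee : e * e = e.

Let act (xi : 'Hom(A, K^o)) (a : A) : 'Hom(A, K^o) := (xi \o amull a)%VF.

Let actE xi a z : act xi a z = xi (a * z).
Proof. by rewrite comp_lfunE amullE. Qed.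

Let act_linearl a : linear (act^~ a).
Proof.
by move=> k x y; apply/lfunP => z; rewrite actE !add_lfunE !scale_lfunE !actE.
Qed.

Let act_linearr x : linear (act x).
Proof.
move=> k a a'; apply/lfunP => z; rewrite actE add_lfunE scale_lfunE !actE.
by rewrite mulrDl -scalerAl linearP.
Qed.

Let act1 x : act x 1 = x.
Proof. by apply/lfunP => z; rewrite actE mul1r. Qed.

Let actM x a a' : act x (a * a') = act (act x a) a'.
Proof. by apply/lfunP => z; rewrite !actE mulrA. Qed.

Let dual : rmodule A := RModule act_linearl act_linearr act1 actM.

(** A functional on [A e] is encoded as a functional on [A] invariant under this truncation, which
    makes the dual a submodule of the dual of [A]. *)
Let trunc (xi : dual) : dual := (xi \o amulr e)%VF.

Let truncE xi z : (trunc xi : 'Hom(A, K^o)) z = xi (z * e).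
Proof. by rewrite comp_lfunE amulrE. Qed.

Let trunc_linear : linear trunc.
Proof.
move=> k x y; apply/lfunP => z; rewrite truncE.
by rewrite !add_lfunE !scale_lfunE !truncE.
Qed.

Let U := fixedSpace (lfun_from trunc_linear).

Let UP (xi : dual) : reflect (trunc xi = xi) (xi \in U).
Proof. by apply: (iffP fixedSpaceP); rewrite lfun_fromE. Qed.

Let HU : submodule U.
Proof.
move=> x a /UP xU; apply/UP/lfunP => z.
by rewrite truncE /= !actE mulrA -[in RHS]xU truncE.
Qed.

(* The dual of the left ideal [A e], as functionals on [A]. *)
Definition inj_hull : rmodule A := sub_rmodule HU.

Definition ih_val (x : inj_hull) : 'Hom(A, K^o) := sub_val x.
Definition ih_mk (xi : 'Hom(A, K^o)) : inj_hull := sub_proj HU (trunc xi).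

Lemma ih_val_inj : injective ih_val.
Proof. exact: (@sub_val_inj _ _ dual). Qed.

Lemma ih_valP x z : ih_val x (z * e) = ih_val x z.
Proof. by have /UP xU := sub_valP x; rewrite -[in RHS]/(ih_val x) /ih_val -[in RHS]xU truncE. Qed.

Lemma ih_mkE xi z : ih_val (ih_mk xi) z = xi (z * e).
Proof.
rewrite /ih_val /ih_mk sub_projK ?truncE //.
by apply/UP/lfunP => y; rewrite !truncE -mulrA ee.
Qed.

Lemma ih_actE x a z : ih_val (ract x a) z = ih_val x (a * z).
Proof. by rewrite /ih_val sub_ractE /= actE. Qed.

Lemma ih_val_linear : linear ih_val.
Proof. exact: (@sub_val_linear _ _ dual). Qed.

Lemma ih_val_act x z : ih_val x z = ih_val (ract x z) 1.
Proof. by rewrite ih_actE mulr1. Qed.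

Lemma ih_hom_linear (M : rmodule A) (psi : 'Hom(M, K^o)) :
  linear (fun y : M => ih_mk (psi \o ractl y)%VF).
Proof.
move=> k x y; apply: ih_val_inj; apply/lfunP => z.
rewrite ih_val_linear add_lfunE scale_lfunE !ih_mkE !comp_lfunE !ractlE.
by rewrite ractDl ractZl linearP.
Qed.

Definition ih_hom (M : rmodule A) (psi : 'Hom(M, K^o)) : 'Hom(M, inj_hull) :=
  lfun_from (ih_hom_linear psi).

Lemma ih_homE (M : rmodule A) (psi : 'Hom(M, K^o)) y z :
  ih_val (ih_hom psi y) z = psi (ract y (z * e)).
Proof. by rewrite lfun_fromE ih_mkE comp_lfunE ractlE. Qed.

Lemma rhom_ih_hom (M : rmodule A) (psi : 'Hom(M, K^o)) : rhom (ih_hom psi).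
Proof.
move=> x a; apply: ih_val_inj; apply/lfunP => z.
by rewrite ih_actE !ih_homE -ractM mulrA.
Qed.

(** A morphism into the hull is determined by the functional obtained by evaluating at 1. Extending
    a morphism thus amounts to extending a functional along the injective [g], which its one-sided
    linear inverse does. *)
Lemma inj_hull_injective : injective_module inj_hull.
Proof.
move=> M N g f Hg gI Hf.
have psiL : linear (fun x : M => ih_val (f x) 1 : K^o).
  by move=> k x y; rewrite linearP ih_val_linear add_lfunE scale_lfunE.
pose psi : 'Hom(M, K^o) := lfun_from psiL.
exists (ih_hom (psi \o g^-1)%VF); first exact: rhom_ih_hom.
apply/lfunP => x; apply: ih_val_inj; apply/lfunP => z.
rewrite comp_lfunE ih_homE comp_lfunE -Hg lker0_lfunK // lfun_fromE Hf ih_actE.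
by rewrite mulr1 ih_valP.
Qed.

End InjectiveHull.

Section NakayamaInjectives.
Variables (K : fieldType) (A : falgType K) (n : nat) (c : nat -> nat).
Variable b : 'I_n -> nat -> A.
Hypothesis Hb : nakayama_basis c b.
Implicit Types (M N P E : rmodule A) (i j k : 'I_n).

Local Notation cf := (cf c b).
Local Notation hull j := (inj_hull (b j 0%N)).

(** The character at [j] spans the simple socle of the hull. *)
Definition ih_soc j : hull j := ih_mk (b j 0%N) (cf j 0).

Lemma ih_socE j z : ih_val (ih_soc j) z = cf j 0 z.
Proof. by rewrite ih_mkE ?(idemE Hb) // (cf0M Hb) (cf_idem Hb) !eqxx mulr1. Qed.

Lemma ih_val0 j : ih_val (0 : hull j) = 0.
Proof.
have := ih_val_linear 1 (0 : hull j) 0; rewrite !scale1r addr0 => /eqP.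
by rewrite -[X in X == _]addr0 (inj_eq (addrI _)) eq_sym => /eqP.
Qed.

Lemma ih_valZ j (l : K) (x : hull j) z : ih_val (l *: x) z = l *: ih_val x z.
Proof.
by have := ih_val_linear l x 0; rewrite ih_val0 !addr0 => ->; rewrite scale_lfunE.
Qed.

Lemma ih_soc_neq0 j : ih_soc j != 0.
Proof.
apply/negP => /eqP /(congr1 (fun x => ih_val x 1)).
by rewrite ih_socE (cf01 Hb) ih_val0 zero_lfunE => /eqP; rewrite oner_eq0.
Qed.

Lemma ih_soc_act j a : ract (ih_soc j) a = cf j 0 a *: ih_soc j.
Proof.
apply: ih_val_inj; apply/lfunP => z.
by rewrite ih_actE ih_valZ !ih_socE (cf0M Hb).
Qed.

Lemma ih_soc_submodule j : submodule <[ih_soc j]>%VS.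
Proof.
by move=> y a /vlineP[l ->]; rewrite ractZl ih_soc_act !memvZ ?memv_line.
Qed.

Lemma hull_submodule_soc j (U : {vspace hull j}) :
  submodule U -> U <> 0%VS -> ih_soc j \in U.
Proof.
move=> HU U0.
have /(eigenvector Hb HU)[k [w [wU w0 wk wrad]]] : ~~ (U <= 0)%VS.
  by rewrite subv0; apply/eqP.
have wa a : ract w a = cf k 0 a *: w.
  by apply/eqP; rewrite -subr_eq0 -memv0 (eigenvector_act Hb).
rewrite memv0 in w0.
have wz z : ih_val w z = cf k 0 z *: ih_val w 1 by rewrite ih_val_act wa ih_valZ.
have w1 : ih_val w 1 != 0.
  apply: contraNneq w0 => w1; apply/eqP/ih_val_inj; rewrite ih_val0.
  by apply/lfunP => z; rewrite wz w1 scaler0 zero_lfunE.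
have kj : k = j.
  apply/eqP; apply: contraNT w1 => kj.
  rewrite -ih_valP wz mul1r (cf_idem Hb) (negPf kj) scale0r //.
rewrite -[ih_soc j](scalerK w1) memvZ // (_ : _ *: _ = w) //.
apply: ih_val_inj; apply/lfunP => z.
by rewrite ih_valZ ih_socE [RHS]wz kj; apply: mulrC.
Qed.

Lemma hull_indecomposable j : indecomposable (hull j).
Proof.
have s0 := ih_soc_neq0 j.
split=> [U0|U V HU HV _ UV]; first by rewrite -memv0 -U0 memvf in s0.
have [->|/eqP U0] := eqVneq U 0%VS; [by left|].
have [->|/eqP V0] := eqVneq V 0%VS; [by right|].
have : ih_soc j \in (U :&: V)%VS by rewrite memv_cap !hull_submodule_soc.
by rewrite UV memv0 (negPf s0).
Qed.

Lemma hull_iso_inj j k : isomorphic (hull j) (hull k) -> j = k.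
Proof.
move=> [f [Hf /lker0P fI _]].
have fw0 : f (ih_soc j) != 0.
  by rewrite -(linear0 f) (inj_eq fI) ih_soc_neq0.
have HU : submodule <[f (ih_soc j)]>%VS.
  move=> y a /vlineP[l ->]; rewrite ractZl -Hf ih_soc_act linearZ !memvZ ?memv_line //.
have /(hull_submodule_soc HU)/vlineP[l lE] : <[f (ih_soc j)]>%VS <> 0%VS.
  by move/eqP; rewrite -dimv_eq0 dim_vline fw0.
have := ih_soc_act k (b k 0%N); rewrite (cf_idem Hb) !eqxx scale1r.
rewrite {1}lE ractZl -Hf ih_soc_act linearZ /= (cf_idem Hb) andbT.
case: eqP => // _; rewrite scale0r scaler0 => /esym/eqP.
by rewrite (negPf (ih_soc_neq0 k)).
Qed.

(** Dual to [indecomposable_projective]. An eigenvector [x] of [E] gives [q] from [E] to the hull,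
    and injectivity of [E] gives [pi] back, with the socle generator going to [x]. The composite
    [q \o pi] does not kill the socle, so it is bijective, and [E] splits as the image of [pi] plus
    the kernel of [q]. *)
Lemma indecomposable_injective E : indecomposable E -> injective_module E ->
  exists j, isomorphic E (hull j).
Proof.
move=> [E0 Eind] HE.
have /(eigenvector Hb (@submodulef _ _ E))[j [x [_ x0 xj xrad]]] : ~~ (fullv <= (0 : {vspace E}))%VS.
  by rewrite subv0; apply/eqP.
have xa a : ract x a = cf j 0 a *: x.
  by apply/eqP; rewrite -subr_eq0 -memv0 (eigenvector_act Hb).
rewrite memv0 in x0; exists j.
have [phi phix] : exists phi : 'Hom(E, K^o), phi x != 0.
  have [k kx] : exists k : 'I_(\dim {:E}), coord (vbasis {:E}) k x != 0.
    apply/existsP; apply: contraNT x0; rewrite negb_exists => /forallP x0.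
    rewrite (coord_vbasis (memvf x)) big1 // => k _.
    by have := x0 k; rewrite negbK => /eqP ->; rewrite scale0r.
  have fL : linear (coord (vbasis {:E}) k : E -> K^o) by move=> a y z; rewrite linearP.
  by exists (lfun_from fL); rewrite lfun_fromE.
pose q := ih_hom (idemE Hb j) phi.
have Hq : rhom q by apply: rhom_ih_hom.
have qx : q x = phi x *: ih_soc j.
  apply: ih_val_inj; apply/lfunP => z; rewrite ih_homE ?(idemE Hb) // xa linearZ /=.
  by rewrite ih_valZ ih_socE (cf0M Hb) (cf_idem Hb) !eqxx mulr1; apply: mulrC.
pose S := sub_rmodule (@ih_soc_submodule j).
have fL : linear (fun y : S => ih_val (sub_val y) 1 *: x).
  move=> k y z; rewrite (@sub_val_linear _ _ _ _ (@ih_soc_submodule j)).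
  by rewrite ih_val_linear add_lfunE scale_lfunE scalerDl scalerA.
pose f : 'Hom(S, E) := lfun_from fL.
have Hf : rhom f.
  move=> y a; rewrite !lfun_fromE sub_ractE; have /vlineP[l ->] := sub_valP y.
  have E1 : ih_val (ract (l *: ih_soc j) a) 1 = l * cf j 0 a :> K.
    by rewrite ih_actE mulr1 ih_valZ ih_socE.
  have E2 : ih_val (l *: ih_soc j) 1 = l :> K.
    by rewrite ih_valZ ih_socE (cf01 Hb); apply: mulr1.
  by rewrite E1 E2 ractZl xa scalerA.
have gI : injective_hom (sub_incl (@ih_soc_submodule j)).
  apply: injective_homP => y; rewrite sub_inclE => y0; apply: sub_val_inj.
  by rewrite y0 -sub_inclE linear0.
have [pi Hpi piE] := HE _ _ _ f (@rhom_sub_incl _ _ _ _ _) gI Hf.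
have pis : pi (ih_soc j) = x.
  pose s : S := sub_proj (@ih_soc_submodule j) (ih_soc j).
  have sE : sub_val s = ih_soc j by rewrite sub_projK ?memv_line.
  by rewrite -sE -sub_inclE -comp_lfunE piE lfun_fromE sE ih_socE (cf01 Hb) scale1r.
have qpI : injective_hom (q \o pi)%VF.
  rewrite /injective_hom; apply/eqP; have [//|/eqP nz] := eqVneq (lker (q \o pi)%VF) 0%VS.
  have := hull_submodule_soc (rhom_lker (rhom_comp Hpi Hq)) nz.
  rewrite memv_ker comp_lfunE pis qx scaler_eq0 (negPf phix).
  by rewrite (negPf (ih_soc_neq0 j)).
have /surjective_homP qpS : surjective_hom (q \o pi)%VF by apply: injective_dim_surjective.
have /lker0P qpJ := qpI.
have [||UE|VE] := Eind (limg pi) (lker q) (rhom_limg Hpi (@submodulef _ _ _)) (rhom_lker Hq).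
- apply/vspaceP => y; rewrite memvf; have [z zE] := qpS (q y).
  rewrite -[y](subrK (pi z)) addrC; apply: memv_add; first by rewrite memv_img ?memvf.
  by rewrite memv_ker linearB /= -comp_lfunE zE subrr.
- apply/eqP; rewrite -subv0; apply/subvP => y /memv_capP[/memv_imgP[z _ ->]].
  rewrite memv_ker memv0 -comp_lfunE => /eqP qz.
  have -> : z = 0 by apply: qpJ; rewrite qz linear0.
  by rewrite linear0.
- have : x \in limg pi by rewrite -pis memv_img ?memvf.
  by rewrite UE memv0 (negPf x0).
exists q; split=> //; first by rewrite /injective_hom VE.
by apply/surjective_homP => y; have [z ->] := qpS y; exists (pi z); rewrite comp_lfunE.
Qed.

(** Otherwise a tail of length [c i] of the path starts at the predecessor [k'] of [i]. By the
    Kupisch inequality [c k'] is [(c i).+1], so the projective at [k'] also has its socle at [j] and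
    is longer than the one at [i]. *)
Lemma longest_path_end i j k p : sh i (c i).-1 = j ->
  (forall i', sh i' (c i').-1 = j -> (c i' <= c i)%N) ->
  (p < c k)%N -> sh k p = j -> (p < c i)%N.
Proof.
move=> ij imax pk kj; rewrite ltnNge; apply/negP => ip.
pose k' := sh k (p - c i)%N.
have k'n : b k' (c i) != 0.
  have := nb_neq0 Hb pk; have -> : b k p = b k (p - c i)%N * b k' (c i).
    by rewrite (nb_mul Hb) eqxx subnK.
  by apply: contra_neq => ->; rewrite mulr0.
have ck' : (c i < c k')%N.
  by rewrite ltnNge; apply: contra_neqN k'n => /(nb_eq0 Hb).
have k'j : sh k' (c i) = j by rewrite -shD subnK.
have i0 := nb_gt0 Hb i.
have k'i : ordS k' = i.
  apply: (@sh_inj n (c i).-1); rewrite ij -k'j -sh1 -shD add1n prednK //.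
have := nb_succ Hb (leq_ltn_trans i0 ck'); rewrite k'i => le.
have E : (c k' = (c i).+1)%N by apply/eqP; rewrite eqn_leq le ck'.
by have := imax k'; rewrite E /= k'j ltnn => /(_ erefl).
Qed.

(** The coefficient of the last path at [i] pairs [b i 0 * A] with [A * b j 0]. The induced map to
    the hull is injective since it does not kill the socle, and surjective because by
    [longest_path_end] every nonzero path ending at [j] is a right factor of the last path at
    [i]. *)
Lemma hull_projective_socle i j : sh i (c i).-1 = j ->
  (forall i', sh i' (c i').-1 = j -> (c i' <= c i)%N) -> projective (hull j).
Proof.
move=> ij imax; have jj := idemE Hb j; have ii := idemE Hb i.
have i0 := nb_gt0 Hb i; have lasti : ((c i).-1 < c i)%N by rewrite prednK.
have Hx := pgen_right_ideal Hb i; have [xi xS xI] := Hx.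
pose P := right_ideal (b i 0%N).
pose psi : 'Hom(P, K^o) := (cf i (c i).-1 \o ri_inc (b i 0%N))%VF.
pose f := ih_hom jj psi.
have fE y z : ih_val (f y) z = cf i (c i).-1 (ri_val y * (z * b j 0%N)).
  by rewrite ih_homE // comp_lfunE ri_incE ri_valE.
apply: (projective_iso _ (right_ideal_projective ii)); exists f; split.
- exact: rhom_ih_hom.
- rewrite /injective_hom; apply/eqP; have [//|/eqP nz] := eqVneq (lker f) 0%VS.
  have := submodule_has_socle Hb Hx (rhom_lker (rhom_ih_hom jj psi)) nz.
  rewrite memv_ker => /eqP/(congr1 (fun y => ih_val y 1)).
  rewrite fE mul1r ih_val0 zero_lfunE ri_valE ri_mkK // mulr1 (nb_mule Hb) eqxx.
  rewrite (nb_emul Hb) ij eqxx (cfE Hb) // !eqxx => /eqP.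
  by rewrite oner_eq0.
apply/surjective_homP => x; set L := (c i).-1 in fE lasti *.
(* The preimage has, along the path of length [m], the value of [x] on the complementary path of
   length [L - m], the one that completes it to the last path. *)
pose a := \sum_(m < c i) ih_val x (b (sh i m) (L - m)%N) *: b i m.
have ia : b i 0%N * a = a.
  by rewrite mulr_sumr; apply: eq_bigr => m _; rewrite -scalerAr (nb_mule Hb) eqxx.
exists (ri_mk (b i 0%N) a); apply: ih_val_inj; apply/lfunP => z.
have gL : linear (fun z => cf i L (a * (z * b j 0%N)) : K^o).
  by move=> k y y'; rewrite mulrDl mulrDr -scalerAl -scalerAr linearP.
rewrite fE ri_mkK // ia -(lfun_fromE gL); move: z; apply: (nb_lfunP Hb) => k p pk.
rewrite lfun_fromE (nb_emul Hb); case: eqP => [kj|kj]; last first.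
  by rewrite mulr0 linear0 -ih_valP (nb_emul Hb) (introF eqP kj) linear0.
have pi := longest_path_end ij imax pk kj.
have pL : (p <= L)%N by rewrite -ltnS prednK.
have kE : sh i (L - p)%N = k.
  by apply: (@sh_inj n p); rewrite -shD subnK // ij kj.
have mlt : (L - p < c i)%N by apply: leq_ltn_trans (leq_subr _ _) lasti.
rewrite mulr_suml (bigD1 (Ordinal mlt)) //= linearD /= linear_sum big1 ?addr0.
  rewrite -scalerAl linearZ /= (nb_mul Hb) kE eqxx subnK // (cfE Hb) // !eqxx.
  by rewrite subKn // [RHS]mulr1.
move=> m; rewrite -val_eqE /= => mp; rewrite -scalerAl linearZ /= (nb_mul Hb).
case: eqP => _; last by rewrite linear0 scaler0.
have [lt|/(nb_eq0 Hb) ->] := ltnP (m + p)%N (c i); last by rewrite linear0 scaler0.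
rewrite (cfE Hb) // eqxx (_ : (L == m + p)%N = false) ?scaler0 //.
by apply/eqP => E; move/eqP: mp; rewrite E addnK.
Qed.

(** Among the projectives with socle at [j], the longest one is the hull. Conversely a projective
    hull is the projective at some [i], and comparing the actions on its socle gives the end of the
    last path. *)
Lemma hull_projectiveP j :
  projective (hull j) <-> exists i, sh i (c i).-1 = j.
Proof.
split=> [HP|[i0 i0j]]; last first.
  have i0j' : sh i0 (c i0).-1 == j by apply/eqP.
  case: (@arg_maxnP _ i0 (fun i => sh i (c i).-1 == j) (fun i => c i) i0j') => i /eqP ij imax.
  by apply: (hull_projective_socle ij) => i' /eqP/imax.
have [i [x Hx]] := indecomposable_projective Hb (hull_indecomposable j) HP.
have s0 := ih_soc_neq0 j.
have /(submodule_has_socle Hb Hx (@ih_soc_submodule j))/vlineP[l lE] : <[ih_soc j]>%VS <> 0%VS.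
  by move/eqP; rewrite -dimv_eq0 dim_vline s0.
exists i; have := pgen_socle_act Hb i x (b j 0%N).
rewrite lE ractZl ih_soc_act !(cf_idem Hb) !eqxx scale1r.
have := pgen_socle_neq0 Hb Hx; rewrite lE => ls.
case: eqP => [//|_]; rewrite scale0r => E.
by rewrite E eqxx in ls.
Qed.

Lemma has_defectP d :
  has_defect A d <-> d = #|[set j : 'I_n | ~~ [exists i : 'I_n, sh i (c i).-1 == j]]|.
Proof.
set D := [set j : 'I_n | _].
have DP j : reflect (~ projective (hull j)) (j \in D).
  rewrite inE; apply: (iffP idP) => [|nP].
    move=> /existsPn nj /hull_projectiveP[i ij]; by have := nj i; rewrite ij eqxx.
  by apply/existsPn => i; apply/eqP => ij; apply: nP; apply/hull_projectiveP; exists i.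
have CP j : j \in D -> [/\ indecomposable (hull j), injective_module (hull j) & ~ projective (hull j)].
  move=> /DP jP; split=> //; first exact: hull_indecomposable.
  exact/inj_hull_injective/(idemE Hb).
have PC M : [/\ indecomposable M, injective_module M & ~ projective M] ->
    exists2 j, j \in D & isomorphic M (hull j).
  move=> [Mi Minj MP]; have [j Mj] := indecomposable_injective Mi Minj.
  exists j => //; apply/DP => /(projective_iso (isomorphic_sym Mj)); exact: MP.
split=> [[X [XC Xi Xs]]|->].
  have tE (u : 'I_d) : exists j, j \in D /\ isomorphic (X u) (hull j).
    by have [j jD Xj] := PC _ (XC u); exists j.
  have [t tP] := fin_all_exists tE.
  have tI : injective t.
    move=> i i' tii; apply: Xi; apply: isomorphic_trans (tP i).2 _.
    by rewrite tii; apply/isomorphic_sym/(tP i').2.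
  rewrite -[LHS]card_ord -(card_imset _ tI); congr #|pred_of_set _|.
  apply/setP => j; apply/imsetP/idP => [[i _ ->]|jD]; first exact: (tP i).1.
  have [i Mi] := Xs _ (CP j jD); exists i => //.
  exact: hull_iso_inj (isomorphic_trans Mi (tP i).2).
exists (fun u : 'I_#|D| => hull (enum_val u)); split.
- by move=> u; apply/CP/enum_valP.
- by move=> u v /hull_iso_inj/enum_val_inj.
move=> M /PC[j jD Mj]; exists (enum_rank_in jD j).
by rewrite enum_rankK_in.
Qed.

End NakayamaInjectives.

(** * Bound quivers and Kupisch series *)

Lemma sum_ord_tail (V : nmodType) (F : nat -> V) p q :
  (forall l, (p <= l)%N -> F l = 0) -> (forall l, (q <= l)%N -> F l = 0) ->
  \sum_(l < p) F l = \sum_(l < q) F l.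
Proof.
have tail r s : (forall l, (r <= l)%N -> F l = 0) ->
    \sum_(l < r + s) F l = \sum_(l < r) F l.
  move=> F0; rewrite big_split_ord /= [X in _ + X]big1 ?addr0 // => i _.
  by rewrite F0 ?leq_addr.
by move=> Fp Fq; rewrite -(tail p q Fp) addnC tail.
Qed.

(* A function on ['I_n] as a function on [nat], with junk value 0 from [n] on. *)
Definition ord_ext n (f : 'I_n -> nat) (x : nat) : nat := oapp f 0%N (insub x).

Lemma ord_extE n (f : 'I_n -> nat) (i : 'I_n) : ord_ext f i = f i.
Proof. by rewrite /ord_ext valK. Qed.

Section BoundQuiver.
Variables (K : fieldType) (A : falgType K) (n : nat).

Section Basis.
Variables (arr : pred 'I_n) (e a : 'I_n -> A) (m : nat).
Hypothesis ee : forall i j, e i * e j = if i == j then e i else 0.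
Hypothesis e1 : \sum_i e i = 1.
Hypothesis ea : forall i, arr i -> e i * a i * e (ordS i) = a i.
Hypothesis esurj : forall x, exists w, x = path_alg_val arr e a w.
Hypothesis ker : forall w, path_alg_val arr e a w = 0 ->
  forall i l, (l < 2)%N -> is_path arr i l -> (w i)`_l = 0.
Hypothesis nil : forall i l, (m <= l)%N -> is_path arr i l -> path_val e a i l = 0.

(** Where there is no arrow, [a i] is unconstrained, so the value is forced to be 0 off the
    quiver. *)
Let b (i : 'I_n) (l : nat) : A := if is_path arr i l then path_val e a i l else 0.

Lemma is_pathD (i : 'I_n) l k :
  is_path arr i (l + k) = is_path arr i l && is_path arr (sh i l) k.
Proof.
apply/forallP/andP => [H|[/forallP H1 /forallP H2] j].
  split; apply/forallP => j; first exact: (H (lshift k j)).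
  by have := H (rshift l j); rewrite /= -/(sh i (l + j)) shD.
case: (split_ordP j) => j' ->; first exact: H1.
by have := H2 j'; rewrite /= -/(sh i (l + j')) shD.
Qed.

Lemma path_valS (i : 'I_n) l : path_val e a i l.+1 = path_val e a i l * a (sh i l).
Proof. by rewrite /path_val big_ord_recr mulrA. Qed.

Lemma path_val_end (i : 'I_n) l : is_path arr i l ->
  path_val e a i l * e (sh i l) = path_val e a i l.
Proof.
case: l => [|l]; first by rewrite /path_val big_ord0 mulr1 sh0 ee eqxx.
rewrite -addn1 is_pathD => /andP[_ /forallP/(_ ord0) /= arl].
rewrite addn1 path_valS -mulrA -[a _](ea arl) -!mulrA.
by rewrite (_ : sh i l.+1 = ordS (sh i l)) // ee eqxx.
Qed.

Lemma path_val_mul (i j : 'I_n) l k : is_path arr i l ->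
  path_val e a i l * path_val e a j k =
  if sh i l == j then path_val e a i (l + k) else 0.
Proof.
move=> pil; rewrite -{1}(path_val_end pil) {2}/path_val mulrA -(mulrA (path_val e a i l)) ee.
case: eqP => [<-|_]; last by rewrite mulr0 mul0r.
rewrite path_val_end // /path_val -mulrA big_split_ord /=; congr (_ * (_ * _)).
by apply: eq_bigr => u _; rewrite -/(sh i (l + u)) shD.
Qed.

Let b_mul i l j k : b i l * b j k = if sh i l == j then b i (l + k)%N else 0.
Proof.
rewrite /b is_pathD; case: ifP => [pil|_]; last by rewrite mul0r if_same.
case: ifP => [pjk|pjk]; last by rewrite mulr0; case: eqP => // ->; rewrite pjk.
by rewrite path_val_mul //; case: eqP => // ->; rewrite pjk.
Qed.

Let w1 (i : 'I_n) (l : nat) : 'I_n -> {poly K} := fun j => if j == i then 'X^l else 0.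

Let w1E i l : is_path arr i l -> path_alg_val arr e a (w1 i l) = path_val e a i l.
Proof.
move=> pil; rewrite /path_alg_val (bigD1 i) //= [X in _ + X]big1 ?addr0; last first.
  by move=> j ji; rewrite /w1 (negPf ji) size_poly0 big_ord0.
rewrite /w1 eqxx size_polyXn (bigD1 ord_max) //= big1 ?addr0.
  by rewrite coefXn eqxx scale1r.
move=> j /andP[_]; rewrite -val_eqE /= => jl.
by rewrite coefXn (negPf jl) scale0r.
Qed.

Let b_neq0 i l : (l < 2)%N -> is_path arr i l -> b i l != 0.
Proof.
move=> l2 pil; apply/eqP; rewrite /b pil -(w1E pil) => /ker/(_ i l l2 pil).
by rewrite /w1 eqxx coefXn eqxx => /eqP; rewrite oner_eq0.
Qed.

Let is_path0 i : is_path arr i 0.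
Proof. by apply/forallP => -[]. Qed.

Let b_ex i : exists l, b i l == 0.
Proof. by exists m; rewrite /b; case: ifP => // /nil ->. Qed.

Let c := ord_ext (fun i => ex_minn (b_ex i)).

Let cP i : b i (c i) = 0 /\ forall l, b i l = 0 -> (c i <= l)%N.
Proof.
rewrite /c ord_extE; case: ex_minnP => k /eqP bk kmin; split=> // l /eqP.
exact: kmin.
Qed.

Let c_gt0 (i : 'I_n) : (0 < c i)%N.
Proof.
have [c0 _] := cP i; rewrite lt0n; apply/eqP => ci.
by have := @b_neq0 i 0 isT (is_path0 i); rewrite ci in c0; rewrite c0 eqxx.
Qed.

(** Here [c i] is the least length of a vanishing path at [i]. Vertices and arrows survive because
    the kernel lies in the square of the arrow ideal; this gives [0 < c i] and lets [1 < c i] detect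
    arrows. *)
Lemma bound_quiver_basis_aux :
  exists c b, nakayama_basis (A := A) (n := n) c b /\ forall i : 'I_n, (1 < c i)%N = arr i.
Proof.
exists c, b.
have b0 (i : 'I_n) l : (c i <= l)%N -> b i l = 0.
  move=> le; have := b_mul i (c i) (sh i (c i)) (l - c i); rewrite eqxx subnKC //.
  by rewrite (cP i).1 mul0r.
split; last first.
  move=> i; have E : is_path arr i 1 = arr i.
    by apply/forallP/idP => [/(_ ord0)|ai [[|l] lt]].
  apply/idP/idP => [|ai]; last first.
    rewrite ltnNge; apply: contraTN (@b_neq0 i 1 isT (etrans E ai)) => /b0 ->.
    by rewrite negbK eqxx.
  rewrite -E; apply: contraTT => np; rewrite -leqNgt; apply: (cP i).2.
  by rewrite /b (negPf np).
split=> //.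
- move=> i; split; first exact: c_gt0.
  by apply/eqP => /(cP i).2; have := c_gt0 i; lia.
- rewrite -[RHS]e1; apply: eq_bigr => i _.
  by rewrite /b is_path0 /path_val big_ord0 mulr1.
move=> x; have [w ->] := esurj x; exists (fun i l => (w i)`_l).
apply: eq_bigr => i _; rewrite big_mkcond /=.
transitivity (\sum_(l < size (w i)) (w i)`_l *: b i l).
  by apply: eq_bigr => l _; rewrite /b; case: ifP => _; rewrite ?scaler0.
apply: (sum_ord_tail (F := fun l => (w i)`_l *: b i l)) => l le.
  by rewrite nth_default // scale0r.
by rewrite b0 // scaler0.
Qed.

End Basis.

Lemma bound_quiver_basis (arr : pred 'I_n) : bound_quiver_algebra arr A ->
  exists c b, nakayama_basis (A := A) (n := n) c b /\ forall i : 'I_n, (1 < c i)%N = arr i.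
Proof.
move=> [e [a [[ee e1 ea] esurj ker [m nil]]]].
exact: bound_quiver_basis_aux ee e1 ea esurj ker nil.
Qed.

(** The bound [1 < c i] puts the kernel into the square of the arrow ideal. *)
Lemma nakayama_basis_cyclic c (b : 'I_n -> nat -> A) :
  nakayama_basis c b -> (forall i : 'I_n, (1 < c i)%N) -> cyclic_nakayama A.
Proof.
move=> Hb c1; exists n, (fun i => b i 0%N), (fun i => b i 1).
have pathE (i : 'I_n) l : path_val (fun i => b i 0%N) (fun i => b i 1) i l = b i l.
  elim: l => [|l IH]; first by rewrite /path_val big_ord0 mulr1.
  by rewrite path_valS IH (nb_mul Hb) eqxx addn1.
have algE w : path_alg_val predT (fun i => b i 0%N) (fun i => b i 1) w =
    \sum_(i < n) \sum_(l < c i) (w i)`_l *: b i l.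
  apply: eq_bigr => i _.
  rewrite (eq_bigl predT) => [|l]; last by apply/forallP.
  under eq_bigr do rewrite pathE.
  apply: (sum_ord_tail (F := fun l => (w i)`_l *: b i l)) => l le.
    by rewrite nth_default // scale0r.
  by rewrite (nb_eq0 Hb) // scaler0.
split.
- split=> [i j||i _].
  + by rewrite (nb_mule Hb); case: eqP => // ->.
  + exact: (nb_one Hb).
  + by rewrite (nb_mule Hb) eqxx (nb_emul Hb) eqxx.
- move=> x; exists (fun i : 'I_n => \poly_(l < c i) cf c b i l x); rewrite algE {1}(nb_dec Hb x).
  apply: eq_bigr => i _; apply: eq_bigr => l _.
  by rewrite coef_poly ltn_ord.
- move=> w; rewrite algE => w0 i l l2 _.
  by apply: (nb_indep Hb (w := fun i l => (w i)`_l) w0); apply: leq_trans (c1 i).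
by have [m mP] := nb_bump Hb; exists m => i l ml _; rewrite pathE mP.
Qed.

End BoundQuiver.

Section Relabel.
Variables (K : fieldType) (A : falgType K) (n : nat) (c : nat -> nat).
Variable b : 'I_n -> nat -> A.
Hypothesis Hb : nakayama_basis c b.
Variables (m : nat) (sigma : 'I_m -> 'I_n) (c' : nat -> nat).
Hypothesis sigma_bij : bijective sigma.
Hypothesis cE : forall i : 'I_m, c' i = c (sigma i).
Hypothesis sigmaS : forall i, (1 < c (sigma i))%N -> sigma (ordS i) = ordS (sigma i).

Let b' (i : 'I_m) (l : nat) : A := b (sigma i) l.

(** [sigma] has to respect successors only at vertices with an arrow, which leaves the order of the
    components free. Along a nonzero path only such vertices are crossed, so [sigma] commutes with
    the shift there; all other products are zero. *)
Lemma relabel_basis : nakayama_basis c' b'.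
Proof.
have sigma_sh i l : (l < c (sigma i))%N -> sh (sigma i) l = sigma (sh i l).
  elim: l => [//|l IH] lt; have {}IH := IH (ltnW lt).
  rewrite /sh !iterS -!/(sh _ l) IH sigmaS // -IH ltnNge; apply/negP => le.
  have := nb_neq0 Hb lt; rewrite -addn1.
  have := nb_mul Hb (sigma i) l (sh (sigma i) l) 1; rewrite eqxx => <-.
  by rewrite (nb_eq0 Hb le) mulr0 eqxx.
split.
- by move=> i; rewrite cE; split; [exact: (nb_gt0 Hb)|exact: (nb_last Hb)].
- by move=> i l; rewrite cE; apply: (nb_eq0 Hb).
- move=> i l j k; have [lt|ge] := ltnP l (c (sigma i)).
    by rewrite /b' (nb_mul Hb) sigma_sh // (inj_eq (bij_inj sigma_bij)).
  rewrite /b' (nb_eq0 Hb ge) mul0r; case: eqP => // _.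
  by rewrite (nb_eq0 Hb) //; apply: leq_trans (leq_addr _ _).
- by rewrite -(nb_one Hb) (reindex sigma) //; apply: onW_bij.
move=> x; exists (fun i l => cf c b (sigma i) l x).
rewrite {1}(nb_dec Hb x) (reindex sigma) /=; last exact: onW_bij.
by apply: eq_bigr => i _; rewrite cE.
Qed.

Lemma relabel_cf i l : cf c' b' i l =1 cf c b (sigma i) l.
Proof.
apply: (nb_lfunP relabel_basis) => j k kj; rewrite (cfE relabel_basis) //.
by rewrite (cfE Hb) -?cE // (inj_eq (bij_inj sigma_bij)).
Qed.

Lemma relabel_simple_at i M : simple_at c' b' i M <-> simple_at c b (sigma i) M.
Proof. by split=> -[dM aM]; split=> // x a; rewrite aM relabel_cf. Qed.

End Relabel.

Section Labelling.
Variables (K : fieldType) (A : falgType K) (n : nat) (c : nat -> nat).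
Variable b : 'I_n -> nat -> A.
Hypothesis Hb : nakayama_basis c b.

(** Simple modules correspond to vertices, and by [ar_translateP] the translate moves a vertex to
    its successor. Vertices without an arrow carry projective simple modules and impose nothing. *)
Lemma translate_labelling m (L : 'I_m -> rmodule A) :
  complete_representatives (@simple_module K A) L ->
  (forall i, ~ projective (L i) -> ar_translate (L i) (L (ordS i))) ->
  exists sigma : 'I_m -> 'I_n, [/\ bijective sigma,
    forall i, simple_at c b (sigma i) (L i) &
    forall i, (1 < c (sigma i))%N -> sigma (ordS i) = ordS (sigma i)].
Proof.
move=> [LS Linj Lsurj] Ltau.
have [sigma sP] : exists sigma : 'I_m -> 'I_n, forall i, simple_at c b (sigma i) (L i).
  exact: (fin_all_exists (fun i => (simple_atP Hb (L i)).1 (LS i))).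
have sI : injective sigma.
  by move=> i j E; apply: Linj; apply: (simple_at_iso (sP i)); rewrite E.
have sS (j : 'I_n) : exists i, j = sigma i.
  have [i Li] := Lsurj _ (simple_mod_simple Hb j); exists i.
  exact: (simple_at_inj Hb (simple_at_transfer Li (simple_mod_at Hb j)) (sP i)).
have [tau tauE] := fin_all_exists sS.
exists sigma; split=> //.
  by exists tau => [i|j]; [apply: sI|].
move=> i ci; apply: (simple_at_inj Hb (sP (ordS i))).
apply/(ar_translateP Hb _ (sP i) ci)/Ltau => /(simple_projectiveP Hb (sP i)) E.
by rewrite E in ci.
Qed.

Lemma kupisch_labelling_basis (s : seq nat) (S P : 'I_(size s) -> rmodule A) :
  kupisch_labelling S P ->
  exists b' : 'I_(size s) -> nat -> A, [/\ nakayama_basis (nth 0%N s) b',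
    forall i, simple_at (nth 0%N s) b' i (S i) &
    forall i, exists x : P i, pgen b' i x].
Proof.
move=> [Srep Stau SP Plen].
have [sigma [sB sP sS]] := translate_labelling Srep Stau.
have Pgen i : exists x : P i, pgen b (sigma i) x.
  have [p Hp] := SP i; have [x Hx _] := projective_cover_pgen Hb (sP i) Hp.
  by exists x.
have cE (i : 'I_(size s)) : nth 0%N s i = c (sigma i).
  have [x Hx] := Pgen i; rewrite -(pgen_dim Hb Hx).
  by apply/esym/(composition_lengthP Hb).
exists (fun i => b (sigma i)); split=> //.
  exact: (relabel_basis Hb sB cE sS).
by move=> i; apply/(relabel_simple_at Hb sB cE sS).
Qed.

End Labelling.

Lemma basis_kupisch_labelling (K : fieldType) (A : falgType K) (s : seq nat)
    (b : 'I_(size s) -> nat -> A) (Hb : nakayama_basis (nth 0%N s) b) :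
  kupisch_labelling (simple_mod Hb) (fun i => right_ideal (b i 0%N)).
Proof.
split.
- split=> [i|i j iij|M /(simple_atP Hb)[j Mj]]; first exact: simple_mod_simple.
    exact: (simple_at_inj Hb (simple_at_transfer iij (simple_mod_at Hb i)) (simple_mod_at Hb j)).
  by exists j; apply: simple_at_iso Mj (simple_mod_at Hb j).
- move=> i nP; apply/(ar_translateP Hb _ (simple_mod_at Hb i)); last exact: simple_mod_at.
  rewrite ltn_neqAle (nb_gt0 Hb) andbT; apply/eqP => ci; apply: nP.
  by apply/(simple_projectiveP Hb (simple_mod_at Hb i)).
- move=> i; have [p Hp _] := pgen_cover Hb (simple_mod_at Hb i) (pgen_right_ideal Hb i).
  by exists p.
- by move=> i; apply/(composition_lengthP Hb); apply: pgen_dim (pgen_right_ideal Hb i).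
Qed.

Lemma has_kupisch_seriesP (K : fieldType) (A : falgType K) (s : seq nat) n
    (c : nat -> nat) (b : 'I_n -> nat -> A) : nakayama_basis c b ->
  (has_kupisch_series A s <->
   exists b' : 'I_(size s) -> nat -> A, nakayama_basis (nth 0%N s) b').
Proof.
move=> Hb; split=> [[S [P SP]]|[b' Hb']].
  by have [b' [Hb' _ _]] := kupisch_labelling_basis Hb SP; exists b'.
by exists (simple_mod Hb'), (fun i => right_ideal (b' i 0%N)); apply: basis_kupisch_labelling.
Qed.

(** * Positions of the tops *)

Section ReverseCombinatorics.
Local Open Scope nat_scope.
Variables (r : nat) (c' : nat -> nat).
Let g j := j + c' j.

Definition rise j := g j.+1 - g j.
(** The expression [(rise i).-1.+1] is the maximum of 1 and [rise i], the smallest possible gap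
    between consecutive tops. *)
Definition tpos j := \sum_(i < j) (rise i).-1.+1.

Lemma tposS j : tpos j.+1 = tpos j + (rise j).-1.+1.
Proof. by rewrite /tpos big_ord_recr. Qed.

Lemma tpos_sum : tpos r = r + \sum_(j < r) (rise j).-1.
Proof.
rewrite /tpos (eq_bigr (fun j : 'I_r => 1 + (rise j).-1)) => [|j _]; last by rewrite add1n.
by rewrite big_split /= sum_nat_const card_ord muln1.
Qed.

Lemma tpos_lt j k : j < k -> tpos j < tpos k.
Proof. by apply: (homo_ltn ltn_trans) => i; rewrite tposS; lia. Qed.

Lemma tpos_cover x : exists j s, s <= (rise j).-1 /\ x = tpos j + s.
Proof.
elim: x => [|x [j [s [sj ->]]]].
  by exists 0, 0; rewrite /tpos big_ord0.
have [lt|ge] := ltnP s (rise j).-1; first by exists j, s.+1; rewrite lt addnS.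
by exists j.+1, 0; rewrite tposS; split=> //; lia.
Qed.

(* [realizes N c]: the cyclic sequence [c] of length [N] is the Kupisch series of
   the algebra whose tops are placed at the positions [tpos j]. *)
Definition realizes N (c : nat -> nat) : Prop :=
  tpos r = N /\ forall j s, s <= (rise j).-1 ->
    tpos j + s + c (tpos j + s) = tpos (g j + s).

Lemma realizes_inj N N1 c c1 : realizes N c -> realizes N1 c1 ->
  N = N1 /\ forall x, c x = c1 x.
Proof.
move=> [<- H] [<- H1]; split=> // x.
have [j [s [sj ->]]] := tpos_cover x.
by have := H j s sj; have := H1 j s sj; lia.
Qed.

(** Turns a number of tops in an interval of vertices, which is the dimension of a Hom space, into a
    difference of indices. *)
Lemma tpos_count (P : pred nat) (tt : nat -> nat) j m :
  (forall i, tt i < tt i.+1) -> (forall x, P x <-> exists u, x = tt u) -> j <= m ->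
  count P (iota (tt j) (tt m - tt j)) = m - j.
Proof.
move=> tlt PP; have th : {homo tt : i j / i < j} by exact: homo_ltn ltn_trans tlt.
have tle : {homo tt : i j / i <= j}.
  by apply: (homo_leq leqnn leq_trans) => i; apply: ltnW.
elim: m => [|m IH] jm; first by move: jm; rewrite leqn0 => /eqP ->; rewrite !subnn.
move: jm; rewrite leq_eqVlt => /orP[/eqP ->|jm]; first by rewrite !subnn.
have lt := tlt m; have le := tle _ _ (jm : j <= m).
rewrite (_ : tt m.+1 - tt j = (tt m - tt j) + (tt m.+1 - tt m)); last by lia.
rewrite iotaD count_cat IH // subnKC //.
have -> : tt m.+1 - tt m = (tt m.+1 - tt m).-1.+1 by lia.
rewrite /= (_ : P (tt m) = true); last by apply/PP; exists m.
rewrite (_ : count P _ = 0); first by rewrite subSn // addn1.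
apply/eqP; rewrite -leqn0 leqNgt -has_count; apply/hasPn => x.
rewrite mem_iota => /andP[x1 x2]; apply/negP => /PP[u xu].
have [um|mu] := leqP u m; first by have := tle _ _ um; lia.
by have := tle _ _ (mu : m.+1 <= u); lia.
Qed.

Hypothesis r_gt0 : 0 < r.
Hypothesis c'_period : forall j, c' (j + r) = c' j.

Lemma rise_period j : rise (j + r) = rise j.
Proof. by rewrite /rise /g -addSn !c'_period; lia. Qed.

Lemma tpos_period j q : tpos (j + q * r) = tpos j + q * tpos r.
Proof.
have one k : tpos (k + r) = tpos k + tpos r.
  elim: k => [|k IH]; first by rewrite add0n /(tpos 0) /tpos big_ord0.
  by rewrite addSn !tposS IH rise_period; lia.
elim: q => [|q IH]; first by rewrite !addn0.
by rewrite mulSn addnCA addnC one IH; lia.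
Qed.

Lemma realizes_surj N c : realizes N c -> (forall j, g j <= g j.+1) ->
  forall m, exists x q, x + c x = tpos m + q * N.
Proof.
(* Adding [g 0] periods to [m] brings it above [g 0], so that there is a last [j] with
   [g j <= M]. *)
move=> [tN cE] gS m; set M := m + g 0 * r.
have g_ge j : j <= g j by rewrite /g leq_addr.
have ex : exists j, g j <= M.
  by exists 0; rewrite /M; apply: leq_trans (leq_addl _ _); rewrite leq_pmulr.
have bd j : g j <= M -> j <= M by apply: leq_trans.
case: (ex_maxnP ex bd) => j jM jmax.
have Mj : M < g j.+1 by rewrite ltnNge; apply/negP => /jmax; rewrite ltnn.
exists (tpos j + (M - g j)), (g 0); rewrite cE; last by rewrite /rise; lia.
by rewrite subnKC // /M tpos_period tN.
Qed.

(** * Uniqueness of the positions of the tops *)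

Section Uniqueness.
Variables (N : nat) (c tt : nat -> nat).
Hypothesis c_period : forall i, c (i + N) = c i.
Let f i := i + c i.
Hypothesis f_mono : forall i, f i <= f i.+1.
Hypothesis tt_lt : forall j, tt j < tt j.+1.
Hypothesis tt_period : forall j, tt (j + r) = tt j + N.
Hypothesis f_im : forall i, exists j, f i = tt j.
Hypothesis f_surj : forall j, exists i q, f i = tt j + q * N.
Hypothesis f_tt : forall j, f (tt j) = tt (g j).
Hypothesis defect_eq : r + \sum_(j < r) (rise j).-1 = N.

Let tt_homo : {homo tt : i j / i < j}.
Proof. exact: homo_ltn ltn_trans tt_lt. Qed.

Let tt_le i j : tt i <= tt j -> i <= j.
Proof. by move=> le; rewrite leqNgt; apply/negP => /tt_homo; rewrite ltnNge le. Qed.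

Let tt_inj i j : tt i = tt j -> i = j.
Proof. by move=> E; apply/eqP; rewrite eqn_leq; apply/andP; split; apply: tt_le; rewrite E. Qed.

Let f_homo : {homo f : i j / i <= j}.
Proof. exact: homo_leq leqnn leq_trans f_mono. Qed.

Let tt_shift j q : tt (j + q * r) = tt j + q * N.
Proof.
elim: q => [|q IH]; first by rewrite !addn0.
by rewrite (_ : j + q.+1 * r = j + q * r + r) ?tt_period ?IH; lia.
Qed.

Let f_shift i q : f (i + q * N) = f i + q * N.
Proof.
elim: q => [|q IH]; first by rewrite !addn0.
rewrite (_ : i + q.+1 * N = i + q * N + N); last by lia.
by move: IH; rewrite /f c_period; lia.
Qed.

(** [f] cannot jump over a top: up to periods each top is a value of [f], and by monotonicity a
    skipped one would have to be taken strictly between [x] and [x.+1]. *)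
Let f_step x u v : f x = tt u -> f x.+1 = tt v -> v <= u.+1.
Proof.
move=> fu fv; rewrite leqNgt; apply/negP => uv.
have [i [q fi]] := f_surj u.+1.
have lt1 := tt_homo (ltnSn u); have lt2 := tt_homo uv.
have [le|gt] := leqP i (x + q * N).
  by have := f_homo le; rewrite f_shift fi fu; lia.
have : x.+1 + q * N <= i by lia.
by move/f_homo; rewrite f_shift fi fv; lia.
Qed.

Let f_steps k : forall x u v, f x = tt u -> f (x + k) = tt v -> v <= u + k.
Proof.
elim: k => [|k IH] x u v fu; first by rewrite !addn0 fu => /tt_inj ->.
rewrite addnS => fv; have [w fw] := f_im (x + k).
have := IH x u w fu fw; have := f_step fw fv; lia.
Qed.

(** From [tt j] to [tt j.+1] the value of [f] climbs [rise j] tops, at most one per vertex. A rise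
    of 0 is covered by the strict growth of [tt]. *)
Let gap_ge j : tt j + (rise j).-1.+1 <= tt j.+1.
Proof.
have := tt_lt j; have E : tt j.+1 = tt j + (tt j.+1 - tt j) by have := tt_lt j; lia.
have := f_tt j.+1; rewrite {1}E => /(f_steps (f_tt j)); rewrite /rise; lia.
Qed.

Let tt_sum k : tt k = tt 0 + \sum_(j < k) (tt j.+1 - tt j).
Proof.
elim: k => [|k IH]; first by rewrite big_ord0 addn0.
by rewrite big_ord_recr /= addnA -IH; have := tt_lt k; lia.
Qed.

(* The total of the gaps is prescribed by [defect_eq], so the bounds [gap_ge] are
   all attained. *)
Lemma gap_eq j : tt j.+1 = tt j + (rise j).-1.+1.
Proof.
suff H i : i < r -> tt i.+1 = tt i + (rise i).-1.+1.
  have Ej : j = j %% r + j %/ r * r by rewrite addnC -divn_eq.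
  have /H := ltn_pmod j r_gt0; rewrite [in tt j.+1]Ej -addSn tt_shift => ->.
  rewrite addnAC -tt_shift -Ej; congr (_ + _.-1.+1).
  rewrite [in RHS]Ej; elim: (j %/ r) => [|q IH]; first by rewrite addn0.
  by rewrite mulSn addnCA addnC rise_period.
move=> ir.
have tr : \sum_(i < r) (tt i.+1 - tt i) = N.
  by have := tt_sum r; rewrite -{1}[r]add0n tt_period; lia.
have : \sum_(i < r) (tt i.+1 - tt i) = \sum_(i < r) (rise i).-1.+1.
  by rewrite tr -defect_eq -tpos_sum.
rewrite (bigD1 (Ordinal ir)) //= [RHS](bigD1 (Ordinal ir)) //=.
set S1 := (X in _ + X = _); set S2 := (X in _ = _ + X) => E.
have le : S2 <= S1 by apply: leq_sum => k _; have := gap_ge k; lia.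
by have := gap_ge i; lia.
Qed.

Lemma tt_tpos j : tt j = tt 0 + tpos j.
Proof.
elim: j => [|j IH]; first by rewrite /tpos big_ord0 addn0.
by rewrite gap_eq IH tposS addnA.
Qed.

(** On [s] steps to the right of [tt j] the function [f] climbs at most [s] tops, and on the
    remaining [rise j - s] steps at most that many. The total climb is [rise j], so both bounds are
    equalities. *)
Lemma realizes_shift : realizes N (fun x => c (tt 0 + x)).
Proof.
split; first by rewrite tpos_sum.
move=> j s sj.
suff : f (tt j + s) = tt (g j + s) by rewrite /f (tt_tpos j) (tt_tpos (g j + s)) -!addnA; lia.
have [u fu] := f_im (tt j + s); rewrite fu; congr tt.
have le1 := f_steps (f_tt j) fu.
have [r0|rp] := posnP (rise j).
  have s0 : s = 0 by move: sj; rewrite r0; lia.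
  by move: fu; rewrite s0 addn0 f_tt => /tt_inj <-; rewrite addn0.
have E : tt j.+1 = tt j + s + (rise j - s) by rewrite gap_eq; lia.
have := f_tt j.+1; rewrite E => /(f_steps fu); move: le1 sj rp; rewrite /rise; lia.
Qed.

End Uniqueness.

(** * The defect read off from a Kupisch series *)

Section DefectCount.
Hypothesis c'_gt0 : forall j, 0 < c' j.
Hypothesis g_mono : forall j, g j <= g j.+1.

Let g_homo : {homo g : i j / i <= j}.
Proof. exact: homo_leq leqnn leq_trans g_mono. Qed.

Let g_period j : g (j + r) = g j + r.
Proof. by rewrite /g c'_period; lia. Qed.

Let g_shift j q : g (j + q * r) = g j + q * r.
Proof.
elim: q => [|q IH]; first by rewrite !addn0.
by rewrite (_ : j + q.+1 * r = j + q * r + r) ?g_period ?IH; lia.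
Qed.

Let socle (i : 'I_r) : 'I_r := sh i (c' i).-1.

Let socle_eq (i j : 'I_r) : (socle i == socle j) = (g i == g j %[mod r]).
Proof.
rewrite sh_eq -[RHS](eqn_modDr (r - 1)) /g.
rewrite (_ : i + c' i + (r - 1) = i + (c' i).-1 + r); last by have := c'_gt0 i; lia.
rewrite (_ : j + c' j + (r - 1) = j + (c' j).-1 + r); last by have := c'_gt0 j; lia.
by rewrite !modnDr.
Qed.

Let ascent := [set j : 'I_r | 0 < rise j].

Let ascent_lt j : 0 < rise j -> g j < g j.+1.
Proof. by rewrite /rise subn_gt0. Qed.

(** Over one period [g] grows by exactly [r], and it grows strictly at each ascent. The values at
    two distinct ascents therefore differ by something strictly between 0 and [r]. *)
Let socle_inj : {in ascent &, injective socle}.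
Proof.
move=> i j; rewrite !inE => ri rj /eqP; rewrite socle_eq => E.
wlog ij : i j ri rj E / i <= j.
  move=> H; have [/H|/ltnW/H H'] := leqP i j; first exact.
  by apply/esym/H' => //; rewrite eq_sym.
apply/val_inj/eqP; rewrite /= eqn_leq ij /= leqNgt; apply/negP => lt.
have le1 : g i.+1 <= g j by apply: g_homo.
have le2 : g j.+1 <= g i + r by rewrite -g_period g_homo //; have := ltn_ord j; lia.
have := ascent_lt ri; have := ascent_lt rj => a1 a2.
move: E; rewrite eq_sym eqn_mod_dvd; last by lia.
move=> /dvdn_leq H; have : r <= g j - g i by apply: H; lia.
by lia.
Qed.

(** The last index at which [g] takes a given value is an ascent; it is then reduced modulo [r]. *)
Let socle_image : [set socle i | i : 'I_r] = [set socle i | i in ascent].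
Proof.
apply/setP => v; apply/imsetP/imsetP => [[i _ ->]|[i _ ->]]; last by exists i.
have ex : exists j, g j <= g i by exists i.
have g_ge j : j <= g j by rewrite /g leq_addr.
have bd j : g j <= g i -> j <= g i by apply: leq_trans.
case: (ex_maxnP ex bd) => j ji jmax.
have gij : g j = g i by apply/eqP; rewrite eqn_leq ji g_homo ?jmax.
have rj : 0 < rise j.
  by rewrite /rise subn_gt0 ltnNge; apply/negP => le; have := jmax j.+1; rewrite ltnn => H; have := H (leq_trans le ji).
have Ej : j = j %% r + j %/ r * r by rewrite addnC -divn_eq.
pose u : 'I_r := Ordinal (ltn_pmod j r_gt0).
exists u.
  rewrite inE /=; move: rj; rewrite {1}Ej; elim: (j %/ r) => [|q IH]; first by rewrite addn0.
  by rewrite mulSn addnCA addnC rise_period.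
apply/eqP; rewrite socle_eq -gij {1}Ej g_shift /= eq_sym.
by rewrite -[X in _ == X %[mod _]]addnC modnMDl.
Qed.

(** Socles are counted by ascents, and the rises over one period add up to [r]; subtracting 1 from
    each positive rise leaves the number of vertices that are not socles. *)
Lemma defect_count :
  #|[set v : 'I_r | ~~ [exists i : 'I_r, sh i (c' i).-1 == v]]| = \sum_(j < r) (rise j).-1.
Proof.
have -> : [set v : 'I_r | ~~ [exists i : 'I_r, sh i (c' i).-1 == v]] =
          ~: [set socle i | i : 'I_r].
  apply/setP => v; rewrite !inE; congr negb; apply/existsP/imsetP => [[i /eqP <-]|[i _ ->]].
    by exists i.
  by exists i.
rewrite socle_image cardsCs setCK card_ord card_in_imset //.
have gsum k : g 0 + \sum_(j < k) rise j = g k.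
  elim: k => [|k IH]; first by rewrite big_ord0 addn0.
  by rewrite big_ord_recr /= addnA IH /rise; have := g_mono k; lia.
have rsum : \sum_(j < r) rise j = r.
  by have := gsum r; have := g_period 0; rewrite add0n; lia.
have -> : #|ascent| = \sum_(j < r) (0 < rise j).
  by rewrite -sum1dep_card big_mkcond; apply: eq_bigr => j _; case: ltnP.
rewrite -{1}rsum -sumnB => [|j _]; last by case: (rise j).
by apply: eq_bigr => j _; case: (rise j) => // k; rewrite subn1.
Qed.

End DefectCount.
End ReverseCombinatorics.

(** * The series of the statement *)

Section PeriodicConcatenation.
Local Open Scope nat_scope.
Variables (k : nat) (k_gt0 : 0 < k) (F : 'I_k -> seq nat).

Definition cyc (i : nat) : 'I_k := Ordinal (ltn_pmod i k_gt0).
(** Blocks are repeated cyclically, so block [k] starts the second period and a reference to the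
    next block never needs a special case at the end. *)
Definition block_start i := \sum_(a < i) size (F (cyc a)).

Lemma block_startS i : block_start i.+1 = block_start i + size (F (cyc i)).
Proof. by rewrite /block_start big_ord_recr. Qed.

Let s := flatten [seq F i | i <- enum 'I_k].
Let G i := F (cyc i).

Lemma cyc_val (i : 'I_k) : cyc i = i.
Proof. by apply: val_inj; rewrite /= modn_small. Qed.

Lemma cyc_ordS i : cyc i.+1 = ordS (cyc i).
Proof. by apply: val_inj; rewrite /= -[in LHS]addn1 -[in RHS]addn1 modnDml. Qed.

Let sE : s = flatten [seq G i | i <- iota 0 k].
Proof.
rewrite /s -val_enum_ord -map_comp; congr flatten.
by apply: eq_map => i; rewrite /= /G cyc_val.
Qed.

Let size_prefix i : size (flatten [seq G a | a <- iota 0 i]) = block_start i.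
Proof.
elim: i => [|i IH]; first by rewrite /block_start big_ord0.
by rewrite -addn1 iotaD map_cat flatten_cat size_cat IH addn1 block_startS /= cats0.
Qed.

Lemma size_flatten_blocks : size s = block_start k.
Proof. by rewrite sE size_prefix. Qed.

Let start_shift i q : block_start (i + q * k) = block_start i + q * block_start k.
Proof.
have one i' : block_start (i' + k) = block_start i' + block_start k.
  elim: i' => [|i' IH]; first by rewrite /(block_start 0) /block_start big_ord0.
  rewrite addSn !block_startS IH.
  have -> : cyc (i' + k) = cyc i' by apply: val_inj; rewrite /= modnDr.
  by lia.
elim: q => [|q IH]; first by rewrite !addn0.
by rewrite mulSn addnCA addnC one IH; lia.
Qed.

Let start_le i j : i <= j -> block_start i <= block_start j.
Proof. by apply: (homo_leq leqnn leq_trans) => a; rewrite block_startS leq_addr. Qed.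

Lemma nth_blocks i p : p < size (F (cyc i)) ->
  nth 0 s ((block_start i + p) %% size s) = nth 0 (F (cyc i)) p.
Proof.
move=> pi.
have Ei : i = i %% k + i %/ k * k by rewrite addnC -divn_eq.
set i0 := i %% k in Ei.
have i0k : i0 < k by rewrite ltn_pmod.
have cE : cyc i = cyc i0 by apply: val_inj; rewrite /= modn_mod.
rewrite cE in pi *; rewrite Ei start_shift size_flatten_blocks.
have lt : block_start i0 + p < block_start k.
  by have := start_le i0k; rewrite block_startS; lia.
rewrite addnAC [_ + _ * _]addnC modnMDl modn_small // sE.
rewrite (_ : k = i0 + (1 + (k - i0.+1))); last by lia.
rewrite !iotaD !map_cat !flatten_cat /= cats0 nth_cat size_prefix ltnNge leq_addr /=.
by rewrite addKn nth_cat add0n pi.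
Qed.

Lemma block_cover x : (forall i, 0 < size (F i)) ->
  exists i p, p < size (F (cyc i)) /\ x = block_start i + p.
Proof.
move=> F0; elim: x => [|x [i [p [pi ->]]]].
  by exists 0, 0; rewrite /block_start big_ord0.
have [lt|ge] := ltnP p.+1 (size (F (cyc i))); first by exists i, p.+1; rewrite lt addnS.
by exists i.+1, 0; rewrite block_startS; split; [exact: F0|lia].
Qed.

End PeriodicConcatenation.

Section Series.
Local Open Scope nat_scope.

Lemma size_B_series m : size (B_series m) = 2 * m + 3.
Proof. by elim: m => //= m IH; rewrite IH; lia. Qed.

Lemma nth_B_series m p : nth 0 (B_series m) p =
  if p < 2 * m then 2 + p %% 2 else nth 0 [:: 2; 2; 1] (p - 2 * m).
Proof.
elim: m p => [|m IH] p; first by rewrite subn0.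
case: p => [|[|p]]; rewrite ?[2 * m.+1]mulnS //; rewrite -?mulnS; rewrite (_ : nth _ _ p.+2 = nth 0 (B_series m) p) // IH.
rewrite (_ : p.+2 %% 2 = p %% 2); last by lia.
rewrite (_ : (p.+2 < 2 * m.+1) = (p < 2 * m)); last by lia.
by rewrite (_ : p.+2 - 2 * m.+1 = p - 2 * m) //; lia.
Qed.

Let long_block m x := repeat_block [:: 3; 4; 4] m ++ [:: 3; 3; 3] ++ [:: 2; 3; 2; x].

Lemma reverse_blockS m n' : reverse_block m.+1 n' = long_block m (2 + delta n').
Proof. by rewrite /reverse_block /long_block /repeat_block /= cats0 -catA. Qed.

Lemma size_reverse_block m n' : size (reverse_block m n') = 3 * m + 4.
Proof.
case: m => [//|m]; rewrite reverse_blockS.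
by elim: m => //= m IH; rewrite IH; lia.
Qed.

Lemma nth_reverse_block m n' q : nth 0 (reverse_block m n') q =
  if q + 3 < 3 * m then (if q %% 3 == 0 then 3 else 4)
  else if q < 3 * m then 3 else nth 0 [:: 2; 3; 2; 2 + delta n'] (q - 3 * m).
Proof.
case: m => [|m]; first by rewrite subn0 addn3.
rewrite reverse_blockS; elim: m q => [|m IH] q.
  case: q => [|[|[|q]]] //; rewrite (_ : (q.+3 + 3 < 3 * 1) = false); last by lia.
  rewrite (_ : (q.+3 < 3 * 1) = false); last by lia.
  by rewrite (_ : q.+3 - 3 * 1 = q) //; lia.
case: q => [|[|[|q]]]; rewrite ?[3 * m.+2]mulnS ?[3 * m.+1]mulnS //; rewrite -?mulnS; rewrite (_ : nth _ _ q.+3 = nth 0 (long_block m (2 + delta n')) q) // IH.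
rewrite (_ : q.+3 %% 3 = q %% 3); last by lia.
rewrite (_ : (q.+3 + 3 < 3 * m.+2) = (q + 3 < 3 * m.+1)); last by lia.
rewrite (_ : (q.+3 < 3 * m.+2) = (q < 3 * m.+1)); last by lia.
by rewrite (_ : q.+3 - 3 * m.+2 = q - 3 * m.+1) //; lia.
Qed.

Variables (k : nat) (k_gt0 : 0 < k) (n : 'I_k -> nat).

Let theta := theta_series n.
Let rev := reverse_series n.
Let N i := n (cyc k_gt0 i).
Let c' j := nth 0 theta (j %% size theta).
Let c x := nth 0 rev (x %% size rev).
Let R := block_start k_gt0 (fun i => B_series (n i)).
Let M := block_start k_gt0 (fun i => reverse_block (n i) (n (ordS i))).

Let RS i : R i.+1 = R i + (2 * N i + 3).
Proof. by rewrite /R block_startS size_B_series. Qed.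

Let MS i : M i.+1 = M i + (3 * N i + 4).
Proof. by rewrite /M block_startS size_reverse_block. Qed.

Lemma size_theta_series : size theta = R k.
Proof. exact: size_flatten_blocks. Qed.

Lemma size_reverse_series : size rev = M k.
Proof. exact: size_flatten_blocks. Qed.

Lemma theta_series_gt0 : 0 < size theta.
Proof.
rewrite size_theta_series; have -> : k = k.-1.+1 by rewrite prednK.
by rewrite RS; lia.
Qed.

Let c'E i p : p < 2 * N i + 3 -> c' (R i + p) =
  if p < 2 * N i then 2 + p %% 2 else nth 0 [:: 2; 2; 1] (p - 2 * N i).
Proof.
move=> pi; rewrite -nth_B_series.
have := @nth_blocks k k_gt0 (fun i => B_series (n i)) i p.
by rewrite size_B_series => /(_ pi).
Qed.

Let cE i q : q < 3 * N i + 4 -> c (M i + q) =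
  if q + 3 < 3 * N i then (if q %% 3 == 0 then 3 else 4)
  else if q < 3 * N i then 3 else nth 0 [:: 2; 3; 2; 2 + delta (N i.+1)] (q - 3 * N i).
Proof.
move=> qi; rewrite /N cyc_ordS -nth_reverse_block.
have := @nth_blocks k k_gt0 (fun i => reverse_block (n i) (n (ordS i))) i q.
by rewrite size_reverse_block => /(_ qi).
Qed.

(** Every block starts with 2, also when the (2,3) part is empty, so the last rise of a block does
    not depend on the next one. *)
Let c'0 i : c' (R i) = 2.
Proof. by rewrite -[R i]addn0 c'E; [case: (N i)|lia]. Qed.

Let riseE i p : p < 2 * N i + 3 -> rise c' (R i + p) =
  if p < 2 * N i then 2 - 2 * (p %% 2) else nth 0 [:: 1; 0; 2] (p - 2 * N i).
Proof.
move=> pi; rewrite /rise c'E //.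
have [lt|] := ltnP p (2 * N i).
  rewrite -addnS c'E; last by lia.
  case: ltnP => lt1; first by lia.
  by rewrite (_ : p.+1 - _ = 0) /=; lia.
move=> le; have [d [-> d3]] : exists d, p = 2 * N i + d /\ d < 3 by exists (p - 2 * N i); lia.
rewrite addKn; case: d d3 => [|[|[|//]]] _ /=.
- by rewrite addn0 -addnS c'E; last lia; rewrite ltnNge leqnSn subSnn /=; lia.
- rewrite -addnS c'E; last lia.
  rewrite (_ : ((2 * N i + 1).+1 < 2 * N i) = false); last by lia.
  by rewrite (_ : (2 * N i + 1).+1 - 2 * N i = 2) /=; lia.
- rewrite (_ : (R i + (2 * N i + 2)).+1 = R i.+1); last by rewrite RS; lia.
  by rewrite c'0 RS; lia.
Qed.

(** The offset of top [p] within its block. On the (2,3) part the rises alternate 2, 0 and the gaps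
    2, 1, so two tops take three positions; on the tail 2,2,1 the tops are adjacent. *)
Let tau m p := if p < 2 * m then (3 * p + 1) %/ 2 else p + m.

Let tposE i p : p < 2 * N i + 3 -> tpos c' (R i + p) = M i + tau (N i) p.
Proof.
have step i' p' : p'.+1 < 2 * N i' + 3 -> tpos c' (R i' + p') = M i' + tau (N i') p' ->
    tpos c' (R i' + p'.+1) = M i' + tau (N i') p'.+1.
  move=> lt E; rewrite addnS tposS E riseE; last by lia.
  rewrite /tau; case: (ltnP p' (2 * N i')) => lt1; first by case: ltnP => lt2; lia.
  have [d [-> d3]] : exists d, p' = 2 * N i' + d /\ d < 2 by exists (p' - 2 * N i'); lia.
  rewrite (_ : ((2 * N i' + d).+1 < 2 * N i') = false); last by lia.
  by rewrite addKn; case: d d3 => [|[|//]] _ /=; lia.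
elim: i p => [|i IH] p.
  elim: p => [|p IHp] pi; last by apply: (step _ _ pi (IHp _)); lia.
  by rewrite /R /M /block_start !big_ord0 /tpos big_ord0 /tau; case: (N 0).
elim: p => [|p IHp] pi; last by apply: (step _ _ pi (IHp _)); lia.
have -> : R i.+1 + 0 = (R i + (2 * N i + 2)).+1 by rewrite RS; lia.
rewrite tposS IH ?riseE /tau; try lia.
rewrite (_ : (2 * N i + 2 < 2 * N i) = false); last by lia.
by rewrite addKn MS; case: ltnP => ? /=; lia.
Qed.

Let tau_even m a : a <= m -> tau m (2 * a) = 3 * a.
Proof. by move=> am; rewrite /tau; case: (ltnP (2 * a)) => ?; lia. Qed.

Let tau_odd m a : a < m -> tau m (2 * a + 1) = 3 * a + 2.
Proof. by move=> am; rewrite /tau; case: (ltnP (2 * a + 1)) => ?; lia. Qed.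

Let tau_end m d : tau m (2 * m + d) = 3 * m + d.
Proof. by rewrite /tau; case: ltnP => ?; lia. Qed.

Let tpos_start i : tpos c' (R i) = M i.
Proof.
by rewrite -[R i]addn0 tposE; [rewrite -(muln0 2) tau_even // muln0 addn0|lia].
Qed.

Let realizes_at i p q v s : tpos c' (R i + p) = M i + q -> c' (R i + p) = v ->
  M i + (q + s) + c (M i + (q + s)) = tpos c' (R i + (p + v + s)) ->
  tpos c' (R i + p) + s + c (tpos c' (R i + p) + s) =
  tpos c' (R i + p + c' (R i + p) + s).
Proof. by move=> -> ->; rewrite -!addnA. Qed.

Lemma reverse_series_realizes : realizes (size theta) c' (size rev) c.
Proof.
split; first by rewrite size_theta_series size_reverse_series tpos_start.
move=> j s.
have [|i [p [pi ->]]] := @block_cover k k_gt0 (fun i => B_series (n i)) j.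
  by move=> i; rewrite size_B_series; lia.
rewrite -/R -/(N i) size_B_series in pi *; rewrite riseE // => sj.
have [lt|ge] := ltnP p (2 * N i).
  rewrite lt in sj.
  have vE : c' (R i + p) = 2 + p %% 2 by rewrite c'E // lt.
  have [a [e [pE e2]]] : exists a e, p = 2 * a + e /\ e < 2.
    by exists (p %/ 2), (p %% 2); lia.
  case: e e2 pE => [|[|//]] _ pE.
    rewrite addn0 in pE; subst p.
    have tE : tpos c' (R i + 2 * a) = M i + 3 * a by rewrite tposE // tau_even //; lia.
    apply: (realizes_at tE vE); rewrite (_ : 2 * a %% 2 = 0) in sj *; last by lia.
    case: s sj => [|[|//]] sj; rewrite cE; try lia.
      rewrite tposE; last by lia.
      rewrite (_ : 2 * a + (2 + 0) + 0 = 2 * a.+1) ?tau_even; try lia.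
      by case: ifP => h; [rewrite ifT|rewrite ifT]; lia.
    rewrite tposE; last by lia.
    rewrite (_ : 2 * a + (2 + 0) + 1 = 2 * a.+1 + 1); last by lia.
    (* The target is the top of index [2 * a.+1 + 1]. Inside the (2,3) part this gives the entry 4;
       for the last pair the target lies in the tail, one position closer, and the entry is 3. *)
    case: ltnP => h; first by rewrite tau_odd ?ifF; lia.
    rewrite ifT; last by lia.
    by rewrite (_ : a.+1 = N i) ?tau_end; lia.
  subst p.
  have tE : tpos c' (R i + (2 * a + 1)) = M i + (3 * a + 2).
    by rewrite tposE // tau_odd //; lia.
  apply: (realizes_at tE vE); rewrite (_ : (2 * a + 1) %% 2 = 1) in sj *; last by lia.
  have -> : s = 0 by lia.
  rewrite cE; last by lia.
  rewrite tposE; last by lia.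
  rewrite (_ : 2 * a + 1 + (2 + 1) + 0 = 2 * a.+2); last by lia.
  (* The same boundary effect: for the last pair 4 drops to 3, so that the last triple is 3,3,3. *)
  case: ltnP => h; first by rewrite tau_even ?ifF; lia.
  rewrite ifT; last by lia.
  by rewrite (_ : 2 * a.+2 = 2 * N i + 2) ?tau_end; lia.
have [d [pE d3]] : exists d, p = 2 * N i + d /\ d < 3 by exists (p - 2 * N i); lia.
subst p; rewrite (_ : (2 * N i + d < 2 * N i) = false) in sj; last by lia.
have vE : c' (R i + (2 * N i + d)) = nth 0 [:: 2; 2; 1] d.
  by rewrite c'E // (_ : (2 * N i + d < 2 * N i) = false) ?addKn //; lia.
have tE : tpos c' (R i + (2 * N i + d)) = M i + (3 * N i + d).
  by rewrite tposE // tau_end.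
have cE' q : q < 4 -> c (M i + (3 * N i + q)) = nth 0 [:: 2; 3; 2; 2 + delta (N i.+1)] q.
  move=> q4; rewrite cE; last by lia.
  rewrite (_ : (3 * N i + q + 3 < 3 * N i) = false); last by lia.
  by rewrite (_ : (3 * N i + q < 3 * N i) = false) ?addKn //; lia.
apply: (realizes_at tE vE); rewrite addKn in sj.
case: d d3 {vE tE pi ge} sj => [|[|[|//]]] _ sj; rewrite /= in sj.
- have -> : s = 0 by lia.
  rewrite (_ : 3 * N i + 0 + 0 = 3 * N i + 0); last by lia.
  rewrite cE' // (_ : 2 * N i + 0 + _ + 0 = 2 * N i + 2); last by rewrite /=; lia.
  by rewrite tposE ?tau_end /=; lia.
- have -> : s = 0 by lia.
  rewrite (_ : 3 * N i + 1 + 0 = 3 * N i + 1); last by lia.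
  rewrite cE' // (_ : R i + _ = R i.+1); last by rewrite RS /=; lia.
  by rewrite tpos_start MS /=; lia.
case: s sj => [|[|//]] _.
  rewrite (_ : 3 * N i + 2 + 0 = 3 * N i + 2); last by lia.
  rewrite cE' // (_ : R i + _ = R i.+1); last by rewrite RS /=; lia.
  by rewrite tpos_start MS /=; lia.
(* The last vertex of the block is not a top, and its target is the second top of the next block.
   That top has offset 1 if the next exponent is 0 and offset 2 otherwise, which is the origin of
   [2 + delta]. *)
rewrite (_ : 3 * N i + 2 + 1 = 3 * N i + 3); last by lia.
rewrite cE' // (_ : R i + _ = R i.+1 + (2 * 0 + 1)); last by rewrite RS /=; lia.
rewrite tposE; last by lia.
rewrite MS; case: (N i.+1) => [|m]; first by rewrite tau_end; rewrite /delta /=; lia.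
by rewrite tau_odd // /delta /=; lia.
Qed.

(** Hence there is an arrow at every vertex, as the cyclic case demands. *)
Lemma reverse_series_ge2 x : 1 < c x.
Proof.
have [|i [q [qi ->]]] := @block_cover k k_gt0 (fun i => reverse_block (n i) (n (ordS i))) x.
  by move=> i; rewrite size_reverse_block; lia.
rewrite size_reverse_block -/(N i) in qi; rewrite cE //.
case: ifP => // _; first by case: ifP.
case: (ltnP q) => // le.
have [d [-> d4]] : exists d, q = 3 * N i + d /\ d < 4 by exists (q - 3 * N i); lia.
by rewrite addKn; case: d d4 => [|[|[|[|//]]]].
Qed.

End Series.

(** * Construction of Nakayama algebras *)

Section Construction.
Variables (K : fieldType) (n : nat) (c : nat -> nat).
Hypothesis n_gt0 : (0 < n)%N.
Hypothesis c_gt0 : forall i, (0 < c i)%N.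
Hypothesis c_period : forall i, c (i + n)%N = c i.
Hypothesis c_succ : forall i, (c i <= (c i.+1).+1)%N.

Let m := \max_(i < n) c i.

Let c_mod i : c (i %% n)%N = c i.
Proof.
rewrite [in RHS](divn_eq i n) addnC; elim: (i %/ n)%N => [|q IH]; first by rewrite addn0.
by rewrite mulSn addnCA addnC c_period.
Qed.

Let c_le i : (c i <= m)%N.
Proof.
rewrite -c_mod; pose i' := Ordinal (ltn_pmod i n_gt0).
exact: (leq_bigmax (F := fun i : 'I_n => c i) i').
Qed.

Let m_gt0 : (0 < m)%N.
Proof. exact: leq_trans (c_gt0 0) (c_le 0). Qed.

Let c_shift i l : (c i <= c (i + l) + l)%N.
Proof.
elim: l => [|l IH]; first by rewrite !addn0.
by have := c_succ (i + l)%N; rewrite !addnS; lia.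
Qed.

(** The algebra is realised by matrices, through its right regular representation padded to [m]
    lengths per vertex; associativity then comes for free. Matrix rings need a size of the form
    [D.+1]. *)
Let D := (n * m).-1.

Let D_succ : (D.+1 = n * m)%N.
Proof. by rewrite /D prednK // muln_gt0 n_gt0 m_gt0. Qed.

(* The row indices code the paths [(i, l)] as [i * m + l]; right multiplication
   by the path [(j, k)] sends [(i, l)] to [(i, l + k)] if [(i, l)] ends at [j]. *)
Let row_ok (j : 'I_n) k p : bool :=
  (p %% m + k < c (p %/ m))%N && ((p %/ m + p %% m) %% n == j)%N.

Let B (j : 'I_n) k : 'M[K]_D.+1 :=
  \matrix_(p, q) (row_ok j k p && (q == p + k :> nat)%N)%:R.

Let row_ok_lt (j : 'I_n) k (p : 'I_D.+1) : row_ok j k p ->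
  [/\ (p + k < D.+1)%N, ((p + k) %/ m = p %/ m)%N & ((p + k) %% m = p %% m + k)%N].
Proof.
move=> /andP[lt _]; have lm := leq_trans lt (c_le _).
have E : (p + k = p %/ m * m + (p %% m + k))%N by rewrite addnA -divn_eq.
have pm : (p %/ m < n)%N by rewrite ltn_divLR // -D_succ.
split.
- have : ((p %/ m).+1 * m <= n * m)%N by rewrite leq_mul2r pm orbT.
  by move=> le; rewrite [X in (_ < X)%N]D_succ; move: le; rewrite mulSn; lia.
- by rewrite E divnMDl // (divn_small lm) addn0.
- by rewrite E modnMDl modn_small.
Qed.

Let B_mul i l j k : B i l * B j k = if sh i l == j then B i (l + k)%N else 0.
Proof.
apply/matrixP => p q; rewrite !mxE.
have ok : row_ok i l p -> row_ok j k (p + l)%N = (sh i l == j) && row_ok i (l + k)%N p.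
  move=> pil; have [_ E1 E2] := row_ok_lt pil.
  have /andP[_ pi] := pil; rewrite /row_ok E1 E2 -addnA pi andbT andbC.
  by congr (_ && _); rewrite -val_eqE /= val_sh addnA -modnDml (eqP pi).
have okD : row_ok i (l + k)%N p -> row_ok i l p.
  by move=> /andP[lt pi]; rewrite /row_ok pi andbT; apply: leq_ltn_trans lt; rewrite addnA leq_addr.
have [pil|pil] := boolP (row_ok i l p); last first.
  rewrite big1 => [|u _]; last by rewrite !mxE (negPf pil) mul0r.
  case: ifP => _; rewrite !mxE //; case: (boolP (row_ok i _ p)) => //= /okD.
  by rewrite (negPf pil).
have [lt E1 E2] := row_ok_lt pil.
rewrite (bigD1 (Ordinal lt)) //= big1 ?addr0; last first.
  move=> u; rewrite -val_eqE /= => ul; rewrite !mxE (negPf ul) andbF mul0r //.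
rewrite !mxE pil eqxx mul1r /= ok //.
by case: ifP => _; rewrite !mxE ?addnA.
Qed.

(** A path of length [l] from [i] to [j] can be prolonged by less than [c i - l], which is at most
    [c j] by [c_shift]; so no row survives. *)
Let B_eq0 (j : 'I_n) k : (c j <= k)%N -> B j k = 0.
Proof.
move=> jk; apply/matrixP => p q; rewrite !mxE; case: (boolP (row_ok j k p)) => //= /andP[lt pj].
have := c_shift (p %/ m)%N (p %% m)%N; rewrite -(c_mod (_ + _)) (eqP pj); lia.
Qed.

Let B_last (j : 'I_n) : B j (c j).-1 != 0.
Proof.
have ltp : (j * m < D.+1)%N by rewrite D_succ ltn_mul2r m_gt0 ltn_ord.
have ok : row_ok j (c j).-1 (j * m)%N.
  rewrite /row_ok mulnK // modnMl add0n addn0 modn_small // eqxx andbT.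
  by rewrite prednK.
have [ltq _ _] := @row_ok_lt j (c j).-1 (Ordinal ltp) ok.
apply/eqP => /matrixP/(_ (Ordinal ltp) (Ordinal ltq)); rewrite !mxE ok eqxx /=.
by move/eqP; rewrite oner_eq0.
Qed.

Let U : {vspace 'M[K]_D.+1} := <<path_tuple c B>>%VS.

Let memB j k : B j k \in U.
Proof.
have [lt|/B_eq0 ->] := ltnP k (c j); last exact: mem0v.
rewrite -[B j k]/(B (tag (Tagged (fun i : 'I_n => 'I_(c i)) (Ordinal lt)))
  (tagged (Tagged (fun i : 'I_n => 'I_(c i)) (Ordinal lt)))).
by rewrite -path_tuple_nth memv_span // mem_nth // size_tuple.
Qed.

Let U_dec x : x \in U -> exists w : 'I_n -> nat -> K,
  x = \sum_(i < n) \sum_(l < c i) w i l *: B i l.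
Proof.
move=> /coord_span ->; rewrite path_tuple_sum.
pose w (i : 'I_n) (l : nat) : K := if insub l is Some l' then
  coord (path_tuple c B) (enum_rank (Tagged (fun i : 'I_n => 'I_(c i)) (l' : 'I_(c i)))) x else 0.
exists w; apply: eq_bigr => i _; apply: eq_bigr => l _.
by rewrite /w valK.
Qed.

(** In general not the identity matrix, since the padding rows are zero; it is the unit of the
    subalgebra [U] only. *)
Let one := \sum_(i < n) B i 0%N.

Let one_mull x : x \in U -> one * x = x.
Proof.
move=> /U_dec[w ->]; rewrite mulr_sumr; apply: eq_bigr => i _.
rewrite mulr_sumr; apply: eq_bigr => l _; rewrite -scalerAr mulr_suml; congr (_ *: _).
rewrite (bigD1 i) //= big1 ?addr0; first by rewrite B_mul sh0 eqxx.
by move=> j ji; rewrite B_mul sh0 (negPf ji).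
Qed.

Let one_mulr x : x \in U -> x * one = x.
Proof.
move=> /U_dec[w ->]; rewrite mulr_suml; apply: eq_bigr => i _.
rewrite mulr_suml; apply: eq_bigr => l _; rewrite -scalerAl mulr_sumr; congr (_ *: _).
rewrite (bigD1 (sh i l)) //= big1 ?addr0; first by rewrite B_mul eqxx addn0.
by move=> j ji; rewrite B_mul eq_sym (negPf ji).
Qed.

Let one_in : one \in U.
Proof. by rewrite memv_suml. Qed.

Let U_aspace : is_aspace U.
Proof.
apply/andP; split; last first.
  apply/prodvP => x y /U_dec[w ->] /U_dec[w' ->].
  rewrite mulr_suml memv_suml // => i _; rewrite mulr_suml memv_suml // => l _.
  rewrite mulr_sumr memv_suml // => j _; rewrite mulr_sumr memv_suml // => k _.
  by rewrite -scalerAl -scalerAr !memvZ // B_mul; case: ifP => _; rewrite ?mem0v.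
apply/has_algidP; exists one; split=> // [|x xU]; last by rewrite one_mull // one_mulr.
pose i := Ordinal n_gt0.
apply: contraNneq (B_last i) => one0.
by rewrite -[B i _]one_mull // one0 mul0r.
Qed.

Let A : falgType K := subvs_of (ASpace U_aspace).

Lemma nakayama_basis_exists : exists (A : falgType K) (b : 'I_n -> nat -> A), nakayama_basis c b.
Proof.
exists A.
pose b (j : 'I_n) k : A := vsproj (ASpace U_aspace) (B j k).
have bE j k : vsval (b j k) = B j k by rewrite vsprojK ?memB.
exists b; split.
- move=> i; split=> //; apply: contraNneq (B_last i) => b0.
  by rewrite -bE b0.
- by move=> i l le; apply: subvs_inj; rewrite bE B_eq0.
- move=> i l j k; apply: subvs_inj; rewrite [LHS]/= !bE B_mul.
  by case: ifP => _; rewrite ?bE.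
- have oneE : algid (ASpace U_aspace) = one.
    rewrite -[LHS]one_mulr ?memv_algid //; apply: algidl; exact: one_in.
  apply: subvs_inj; rewrite raddf_sum [RHS]/= oneE.
  by apply: eq_bigr => i _; exact: bE.
move=> x; have [w xE] := U_dec (subvsP x); exists w; apply: subvs_inj.
rewrite [LHS]xE raddf_sum; apply: eq_bigr => i _; rewrite raddf_sum; apply: eq_bigr => l _.
by rewrite -bE; exact: erefl.
Qed.

End Construction.

(** * The syzygy filtered algebra *)

Section Syzygy.
Variables (K : fieldType) (A : falgType K) (n : nat) (c : nat -> nat).
Variable b : 'I_n -> nat -> A.
Hypothesis Hb : nakayama_basis c b.

Lemma sh_last (i : 'I_n) : ordS (sh i (c i).-1) = sh i (c i).
Proof. by rewrite -sh1 -shD addn1 prednK // (nb_gt0 Hb). Qed.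

Lemma projective_socle_at S :
  (exists P, [/\ indecomposable P, projective P & socle_of P S]) <->
  exists i, simple_at c b (sh i (c i).-1) S.
Proof.
split=> [[P [Pi HP PS]]|[i Si]].
  have [i [x Hx]] := indecomposable_projective Hb Pi HP.
  by exists i; apply/(pgen_socle_of Hb Hx).
have Hx := pgen_right_ideal Hb i.
exists (right_ideal (b i 0%N)); split.
- exact: (pgen_indecomposable Hb Hx).
- exact: (pgen_projective Hb Hx).
- exact/(pgen_socle_of Hb Hx).
Qed.

End Syzygy.

Lemma syzygy_tops (K : fieldType) (A : falgType K) n (c : nat -> nat)
    (b : 'I_n -> nat -> A) (Hb : nakayama_basis c b) r (s : 'I_r -> rmodule A)
    (L : 'I_n -> rmodule A) (t : 'I_r -> 'I_n) :
  (forall i : 'I_n, (1 < c i)%N) -> (forall i, simple_at c b i (L i)) ->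
  complete_representatives
    (fun S => exists P, [/\ indecomposable P, projective P & socle_of P S]) s ->
  (forall j, ar_translate (s j) (L (t j))) ->
  (forall i : 'I_n, exists j, sh i (c i) = t j) /\
  (forall j, exists i : 'I_n, sh i (c i) = t j).
Proof.
move=> c_gt1 Lat [sC _ sS] sL.
have tE j (i : 'I_n) : simple_at c b (sh i (c i).-1) (s j) -> sh i (c i) = t j.
  move=> sji; rewrite -(sh_last Hb); apply: (simple_at_inj Hb _ (Lat (t j))).
  exact: (ar_translateP Hb (L (t j)) sji (c_gt1 _)).1 (sL j).
split=> [i|j].
  have [|j Mj] := sS (simple_mod Hb (sh i (c i).-1)).
    by apply/(projective_socle_at Hb); exists i; apply: simple_mod_at.
  by exists j; apply: tE; apply: simple_at_transfer Mj (simple_mod_at Hb _).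
have /(projective_socle_at Hb)[i sji] := sC j.
by exists i; apply: tE.
Qed.

(** The list of simple modules in [syzygy_projectives] may start anywhere on the cycle, so the path
    basis is relabelled along it; then [t] is increasing for the labels in use. *)
Lemma syzygy_labelling (K : fieldType) (A : falgType K) n (c : nat -> nat)
    (b : 'I_n -> nat -> A) (Hb : nakayama_basis c b) r (Q : 'I_r -> rmodule A) :
  (forall i : 'I_n, (1 < c i)%N) -> syzygy_projectives Q ->
  exists m (c1 : nat -> nat) (b1 : 'I_m -> nat -> A) (t : 'I_r -> 'I_m),
  [/\ nakayama_basis c1 b1 /\ (forall i : 'I_m, (1 < c1 i)%N),
      forall i j : 'I_r, (i < j)%N -> (t i < t j)%N,
      forall i : 'I_m, exists j, sh i (c1 i) = t j,
      forall j, exists i : 'I_m, sh i (c1 i) = t j &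
      forall j, exists x : Q j, pgen b1 (t j) x].
Proof.
move=> c_gt1 [m [L [t [s [Lrep Ltau t_lt srep sQ]]]]].
have [sigma [sB sP sS]] := translate_labelling Hb Lrep (fun i _ => Ltau i).
pose c1 := ord_ext (fun i => c (sigma i)).
have cE (i : 'I_m) : c1 i = c (sigma i) by rewrite /c1 ord_extE.
have Hb1 := relabel_basis Hb sB cE sS.
have Lat i := (relabel_simple_at Hb sB cE sS i (L i)).2 (sP i).
have c1_gt1 (i : 'I_m) : (1 < c1 i)%N by rewrite cE.
have [im surj] := syzygy_tops Hb1 c1_gt1 Lat srep (fun j => (sQ j).1).
exists m, c1, (fun i l => b (sigma i) l), t; split=> // j.
have [p Hp] := (sQ j).2.
by have [x Hx _] := projective_cover_pgen Hb1 (Lat (t j)) Hp; exists x.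
Qed.

(** The successor map is a bijection from the socles to the tops, so there are [r] socles. *)
Lemma socle_count (K : fieldType) (A : falgType K) n (c : nat -> nat)
    (b : 'I_n -> nat -> A) (Hb : nakayama_basis c b) r (t : 'I_r -> 'I_n) :
  injective t -> (forall i : 'I_n, exists j, sh i (c i) = t j) ->
  (forall j, exists i : 'I_n, sh i (c i) = t j) ->
  (#|[set v : 'I_n | ~~ [exists i : 'I_n, sh i (c i).-1 == v]]| + r = n)%N.
Proof.
move=> tI im surj; set D := [set v : 'I_n | _].
have -> : D = ~: [set v | ordS v \in codom t].
  apply/setP => v; rewrite !inE; congr negb; apply/existsP/codomP => [[i /eqP <-]|[j jE]].
    by have [j jE] := im i; exists j; rewrite (sh_last Hb).
  have [i iE] := surj j; exists i; apply/eqP/(@ordS_inj n).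
  by rewrite (sh_last Hb) iE jE.
rewrite cardsCs setCK card_ord.
have E : #|[set v | ordS v \in codom t]| = r.
  rewrite -[RHS]card_ord -(card_codom tI) -(card_imset _ (@ordS_inj n)).
  apply: eq_card => v; apply/imsetP/idP => [[w]|vt]; first by rewrite inE => wt ->.
  by exists (ord_pred v); rewrite ?inE ord_predK.
by rewrite E subnK // -E -[X in (_ <= X)%N]card_ord max_card.
Qed.

(** A map from [MP] is determined by its values on the generators [x i]. Their sum [rho] in [Q j]
    loses nothing, since the idempotent at [t k] extracts the value on the generator of index [k].
    The image of [rho] is spanned by the paths from [t j] that end at a top. *)
Lemma hom_sum_dim (K : fieldType) (A B : falgType K) n (c : nat -> nat)
    (b : 'I_n -> nat -> A) (Hb : nakayama_basis c b) r (t : 'I_r -> 'I_n)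
    (Q : 'I_r -> rmodule A) (MP : rmodule A) (phi : 'Hom(B, 'End(MP)))
    (X : rmodule B) j :
  injective t -> (forall i, exists x : Q i, pgen b (t i) x) -> direct_sum_of MP Q ->
  hom_module_iso (Q j) phi X ->
  \dim {:X} = count (fun l => sh (t j) l \in codom t) (iota 0 (c (t j))).
Proof.
move=> tI Qgen [inj [prj [Hinj Hprj pi1 pi0 sum1]]] [psi [_ psi0 psiS]].
have [x Hx] := fin_all_exists Qgen.
have xi i : ract (x i) (b (t i) 0%N) = x i by case: (Hx i).
have bb i k : b (t i) 0%N * b (t k) 0%N = if i == k then b (t k) 0%N else 0.
  by rewrite (nb_mule Hb) (inj_eq tI).
have prj_ne i k : i != k -> prj i (inj k (x k)) = 0.
  by move=> ik; rewrite -comp_lfunE pi0 // zero_lfunE.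
have prj_id k : prj k (inj k (x k)) = x k by rewrite -comp_lfunE pi1 id_lfunE.
have evL : linear (fun y : X => \sum_i psi y (inj i (x i))).
  move=> l y y'; rewrite scaler_sumr -big_split; apply: eq_bigr => i _.
  by rewrite linearP add_lfunE scale_lfunE.
pose rho : 'Hom(X, Q j) := lfun_from evL.
have psi_hom y : rhom (psi y) by apply/psiS; exists y.
have rho_e y k : ract (rho y) (b (t k) 0%N) = psi y (inj k (x k)).
  rewrite lfun_fromE -ractrE linear_sum (bigD1 k) //= big1 ?addr0; first last.
    move=> i ik; rewrite ractrE -psi_hom -Hinj -(xi i) -ractM bb (negPf ik).
    by rewrite ract0r !linear0.
  by rewrite ractrE -psi_hom -Hinj xi.
have rho0 : lker rho = 0%VS.
  apply/vspaceP => y; rewrite memv_ker memv0; apply/eqP/eqP => [ry|->]; last exact: linear0.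
  have psi_y i : psi y (inj i (x i)) = 0 by rewrite -rho_e ry ract0l.
  have /eqP psi0' := psi0; have /lker0P psiI := psi0'.
  apply: psiI; rewrite linear0; apply/lfunP => z; rewrite zero_lfunE.
  rewrite -[z]id_lfunE -sum1 sum_lfunE linear_sum big1 // => i _.
  rewrite /= comp_lfunE; have [_ /(_ (prj i z))[a ->] _] := Hx i.
  by rewrite Hinj psi_hom psi_y ract0l.
rewrite -(limg_dim_eq (f := rho)) ?rho0 ?capv0 //.
pose sel l := sh (t j) l \in codom t.
have -> : limg rho = <<[seq ract (x j) (b (t j) l) | l <- filter sel (iota 0 (c (t j)))]>>%VS.
  apply/eqP; rewrite eqEsubv; apply/andP; split; last first.
    apply/span_subvP => _ /mapP[l ls ->].
    move: ls; rewrite mem_filter mem_iota => /and3P[/codomP[i iE] _ lj].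
    have [|h Hh hx] := @pgen_hom _ _ _ _ _ Hb (t i) (Q i) (x i) (Q j) (ract (x j) (b (t j) l)) (Hx i).
      by rewrite -ractM (nb_emul Hb) iE eqxx.
    have /psiS[y yE] : rhom (h \o prj i)%VF by apply: rhom_comp.
    have -> : ract (x j) (b (t j) l) = rho y.
      rewrite lfun_fromE (bigD1 i) //= big1 ?addr0; first by rewrite yE comp_lfunE prj_id hx.
      by move=> k ki; rewrite yE comp_lfunE prj_ne ?linear0 // eq_sym.
    by rewrite memv_img ?memvf.
  apply/subvP => _ /memv_imgP[y _ ->]; rewrite lfun_fromE memv_suml // => i _.
  have [_ /(_ (psi y (inj i (x i))))[a aE] _] := Hx j.
  have -> : psi y (inj i (x i)) = ract (x j) (b (t j) 0%N * a * b (t i) 0%N).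
    by rewrite !ractM xi -aE -rho_e -ractM bb eqxx.
  have ja : b (t j) 0%N * (b (t j) 0%N * a) = b (t j) 0%N * a by rewrite mulrA (idemE Hb).
  rewrite (right_ideal_dec Hb ja) mulr_suml ract_sumr memv_suml // => l _.
  rewrite -scalerAl ractZr memvZ // (nb_emul Hb); case: eqP => [lE|_]; last by rewrite ract0r mem0v.
  apply: memv_span; apply/mapP; exists (l : nat) => //.
  by rewrite mem_filter mem_iota add0n leq0n ltn_ord /sel lE codom_f.
rewrite (pgen_span Hb (Hx j)) ?size_filter ?filter_uniq ?iota_uniq //.
by apply/allP => l; rewrite mem_filter mem_iota => /and3P[].
Qed.

(** * The syzygy filtered algebra as a corner algebra *)

Section SyzygyFiltration.
Variables (K : fieldType) (A B : falgType K) (n r : nat) (c c' : nat -> nat).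
Variables (bA : 'I_n -> nat -> A) (bB : 'I_r -> nat -> B).
Hypothesis HA : nakayama_basis c bA.
Hypothesis HB : nakayama_basis c' bB.
Hypothesis r_gt0 : (0 < r)%N.
Hypothesis c_gt1 : forall i : 'I_n, (1 < c i)%N.
Hypothesis c_mod : forall x, c (x %% n)%N = c x.
Hypothesis c'_mod : forall x, c' (x %% r)%N = c' x.
Hypothesis Hreal : realizes r c' n c.

Let T := tpos c'.
Let g j := (j + c' j)%N.

Let c'_period j : c' (j + r) = c' j.
Proof. by rewrite -c'_mod modnDr c'_mod. Qed.

Let Tr : T r = n. Proof. by case: Hreal. Qed.

Let T_shift j q : T (j + q * r) = (T j + q * n)%N.
Proof. by rewrite /T tpos_period // -/T Tr. Qed.

Let T_lt j k : (j < k)%N -> (T j < T k)%N.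
Proof. exact: tpos_lt. Qed.

Let T_le j k : (j <= k)%N -> (T j <= T k)%N.
Proof. by rewrite leq_eqVlt => /orP[/eqP ->//|/T_lt/ltnW]. Qed.

Let T_ltE j k : (T j < T k)%N = (j < k)%N.
Proof. by apply/idP/idP => [|/T_lt//]; apply: contraTT; rewrite -!leqNgt => /T_le. Qed.

Let T_inj j k : T j = T k -> j = k.
Proof.
move=> E; apply/eqP; rewrite eqn_leq.
by apply/andP; split; rewrite leqNgt -T_ltE E ltnn.
Qed.

Let T0 : T 0 = 0%N. Proof. by rewrite /T /tpos big_ord0. Qed.

Let n_gt0 : (0 < n)%N.
Proof. by rewrite -Tr -[X in (X < _)%N]T0 T_lt. Qed.

Let f_T j : (T j + c (T j))%N = T (g j).
Proof. by case: Hreal => _ /(_ j 0%N isT); rewrite !addn0. Qed.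

Let tn j : 'I_n := Ordinal (ltn_pmod (T j) n_gt0).

Let tn_val (j : 'I_r) : tn j = T j :> nat.
Proof. by rewrite /= modn_small // -Tr T_lt. Qed.

Let tn_shift j q : tn (j + q * r) = tn j.
Proof. by apply: val_inj; rewrite /= T_shift addnC modnMDl. Qed.

Let tn_mod j : tn (j %% r) = tn j.
Proof. by rewrite [in RHS](divn_eq j r) addnC tn_shift. Qed.

Let tn_inj j k : (tn j == tn k) = (j == k %[mod r])%N.
Proof.
apply/eqP/eqP => [|E]; last by rewrite -tn_mod E tn_mod.
rewrite -tn_mod -[tn k]tn_mod => /(congr1 val).
have := tn_val (Ordinal (ltn_pmod j r_gt0)); have := tn_val (Ordinal (ltn_pmod k r_gt0)).
by rewrite /= => -> -> /T_inj.
Qed.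

Let top (j : 'I_r) : 'I_n := tn j.

Let top_inj : injective top.
Proof.
by move=> i j /eqP; rewrite tn_inj !modn_small // => /eqP /val_inj.
Qed.

Let sh_tn j l : sh (tn j) (T (j + l) - T j) = tn (j + l).
Proof.
apply: val_inj; rewrite /= val_sh /= modnDml subnKC //.
by apply: T_le; apply: leq_addr.
Qed.

(** On the unrolled line the end [T j + l] is congruent to a top, hence is itself some [T m], so [l]
    is a difference of values of [T]. *)
Let sh_top j l : sh (tn j) l \in codom top ->
  exists l', l = (T (j + l') - T j)%N.
Proof.
move=> /codomP[k kE].
have : (T j + l = T k %[mod n])%N.
  by have := congr1 (@nat_of_ord n) kE; rewrite val_sh /= modnDml.
have kn : (T k < n)%N by rewrite -Tr T_lt.
move=> E; have {}E : (T j + l)%N = T (k + (T j + l) %/ n * r).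
  by rewrite T_shift {1}(divn_eq (T j + l) n) E (modn_small kn) addnC.
set m := (k + _)%N in E.
have jm : (j <= m)%N by rewrite leqNgt -T_ltE; lia.
by exists (m - j)%N; rewrite subnKC //; lia.
Qed.

Lemma syzygy_im (i : 'I_n) : exists j, sh i (c i) = top j.
Proof.
have [j [s [sj iE]]] := tpos_cover c' i.
have [_ /(_ j s sj)] := Hreal; rewrite -iE => E.
exists (Ordinal (ltn_pmod (j + c' j + s) r_gt0)).
by rewrite /top tn_mod; apply: val_inj; rewrite /= val_sh /= E.
Qed.

Hypothesis g_mono : forall j, (g j <= g j.+1)%N.

Lemma syzygy_surj (j : 'I_r) : exists i : 'I_n, sh i (c i) = top j.
Proof.
have [x [q xE]] := realizes_surj r_gt0 c'_period Hreal g_mono j.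
exists (Ordinal (ltn_pmod x n_gt0)); apply: val_inj.
by rewrite /= val_sh /= c_mod modnDml xE addnC modnMDl.
Qed.

Let Q (j : 'I_r) : rmodule A := right_ideal (bA (top j) 0%N).

Lemma syzygy_projectivesP : syzygy_projectives Q.
Proof.
have at_s (j : 'I_r) : exists i : 'I_n, sh i (c i).-1 = ord_pred (top j).
  have [i iE] := syzygy_surj j; exists i; apply: (@ordS_inj n).
  by rewrite (sh_last HA) iE ord_predK.
exists n, (simple_mod HA), top, (fun j => simple_mod HA (ord_pred (top j))); split.
- split=> [i|i j iij|M /(simple_atP HA)[j Mj]]; first exact: simple_mod_simple.
    exact: (simple_at_inj HA (simple_at_transfer iij (simple_mod_at HA i)) (simple_mod_at HA j)).
  by exists j; apply: simple_at_iso Mj (simple_mod_at HA j).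
- by move=> i; apply/(ar_translateP HA _ (simple_mod_at HA i)) => //; apply: simple_mod_at.
- by move=> i j ij; rewrite [nat_of_ord (top i)]tn_val [nat_of_ord (top j)]tn_val T_lt.
- split=> [j|i j iij|M /(projective_socle_at HA)[i Mi]].
  + apply/(projective_socle_at HA); have [i iE] := at_s j; exists i; rewrite iE.
    exact: simple_mod_at.
  + apply: top_inj; apply: (@ord_pred_inj n).
    exact: (simple_at_inj HA (simple_at_transfer iij (simple_mod_at HA _)) (simple_mod_at HA _)).
  + have [j jE] := syzygy_im i; exists j; apply: simple_at_iso Mi _.
    suff <- : sh i (c i).-1 = ord_pred (top j) by exact: simple_mod_at.
    by apply: (@ordS_inj n); rewrite (sh_last HA) jE ord_predK.
move=> j; split.
  apply/(ar_translateP HA _ (simple_mod_at HA _)) => //.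
  by rewrite ord_predK; apply: simple_mod_at.
have [p Hp _] := pgen_cover HA (simple_mod_at HA (top j)) (pgen_right_ideal HA (top j)).
by exists p.
Qed.

Let e := \sum_j bA (top j) 0%N.

Let eb (i : 'I_n) l : e * bA i l = if i \in codom top then bA i l else 0.
Proof.
rewrite mulr_suml; case: ifP => [/codomP[j ->]|ni].
  rewrite (bigD1 j) //= big1 ?addr0; first by rewrite (nb_mule HA) eqxx.
  by move=> k kj; rewrite (nb_mule HA) (inj_eq top_inj) (negPf kj).
rewrite big1 // => k _; rewrite (nb_mule HA); case: eqP => // ki.
by rewrite -ki codom_f in ni.
Qed.

Let be (i : 'I_n) l : bA i l * e = if sh i l \in codom top then bA i l else 0.
Proof.
rewrite mulr_sumr; case: ifP => [/codomP[j jE]|ni].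
  rewrite (bigD1 j) //= big1 ?addr0; first by rewrite (nb_emul HA) jE eqxx.
  by move=> k kj; rewrite (nb_emul HA) jE (inj_eq top_inj) eq_sym (negPf kj).
rewrite big1 // => k _; rewrite (nb_emul HA); case: eqP => // ki.
by rewrite ki codom_f in ni.
Qed.

Let ee : e * e = e.
Proof.
by rewrite {2}/e mulr_sumr; apply: eq_bigr => j _; rewrite eb codom_f.
Qed.

Let et j : e * bA (top j) 0%N = bA (top j) 0%N.
Proof. by rewrite eb codom_f. Qed.

(* The path of [A] corresponding to the path [(j, l)] of [B]. *)
Let beta j l : A := bA (tn j) (T (j + l) - T j).

Let beta_eq0 j l : (c' j <= l)%N -> beta j l = 0.
Proof.
move=> le; apply: (nb_eq0 HA); rewrite /= c_mod.
have := f_T j; have : (T (g j) <= T (j + l))%N by rewrite T_le // leq_add2l.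
lia.
Qed.

Let T_diff j l : (T (j %% r + l) - T (j %% r) = T (j + l) - T j)%N.
Proof.
have E : j = (j %% r + j %/ r * r)%N by rewrite addnC -divn_eq.
by rewrite [in RHS]E addnAC !T_shift subnDr.
Qed.

Let beta_mul j l k m :
  beta j l * beta k m = if (j + l == k %[mod r])%N then beta j (l + m) else 0.
Proof.
rewrite {1 2}/beta (nb_mul HA) sh_tn tn_inj; case: eqP => // E.
rewrite -/(beta k m).
have : (T (k + m) - T k = T (j + l + m) - T (j + l))%N.
  by rewrite -(T_diff k) -(T_diff (j + l)) E.
move=> ->; rewrite /beta; congr (bA _ _).
have := T_le (leq_addr l j); have := T_le (leq_addr m (j + l)%N).
by rewrite addnA; lia.
Qed.

Let iota_linear : linear (fun x : B =>
  \sum_(j < r) \sum_(l < c' j) cf c' bB j l x *: beta j l).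
Proof.
move=> k x y; rewrite scaler_sumr -big_split; apply: eq_bigr => j _ /=.
rewrite scaler_sumr -big_split; apply: eq_bigr => l _ /=.
by rewrite linearP /= scalerDl scalerA.
Qed.

Let iota : 'Hom(B, A) := lfun_from iota_linear.

Let iota_b (j : 'I_r) l : iota (bB j l) = beta j l.
Proof.
have [lt|ge] := ltnP l (c' j); last by rewrite (nb_eq0 HB) // beta_eq0 // linear0.
rewrite lfun_fromE (bigD1 j) //= (bigD1 (Ordinal lt)) //= !big1 ?addr0.
- by rewrite (cfE HB) // !eqxx scale1r.
- by move=> k kj; rewrite big1 // => m _; rewrite (cfE HB) // (negPf kj) scale0r.
- by move=> m; rewrite -val_eqE /= => ml; rewrite (cfE HB) // (negPf ml) andbF scale0r.
Qed.

Let iotaM x y : iota (x * y) = iota x * iota y.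
Proof.
pose f y := (iota \o amulr y)%VF; pose h y := (amulr (iota y) \o iota)%VF.
suff /(_ x) : f y =1 h y by rewrite !comp_lfunE !amulrE.
apply: (nb_lfunP HB) => j l _; rewrite !comp_lfunE !amulrE iota_b.
pose f' := (iota \o amull (bB j l))%VF; pose h' := (amull (beta j l) \o iota)%VF.
suff /(_ y) : f' =1 h' by rewrite !comp_lfunE !amullE.
apply: (nb_lfunP HB) => k m _; rewrite !comp_lfunE !amullE iota_b beta_mul (nb_mul HB).
have -> : (sh j l == k) = (j + l == k %[mod r])%N.
  by rewrite -val_eqE /= val_sh (modn_small (ltn_ord k)).
by case: ifP => _; rewrite ?linear0 ?iota_b.
Qed.

Let iota1 : iota 1 = e.
Proof.
rewrite -(nb_one HB) linear_sum; apply: eq_bigr => j _.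
by rewrite /= iota_b /beta addn0 subnn.
Qed.

Let iota_e j : iota (bB j 0%N) = bA (top j) 0%N.
Proof. by rewrite iota_b /beta addn0 subnn. Qed.

Let iota0 x : iota x = 0 -> x = 0.
Proof.
move=> x0; rewrite [x](nb_dec HB) big1 // => j _; rewrite big1 // => l _.
(* Since [T] is injective, distinct paths of [B] go to distinct paths of [A], and each coordinate of
   [x] reappears as a coordinate of [iota x]. *)
suff -> : cf c' bB j l x = cf c bA (tn j) (T (j + l) - T j) (iota x).
  by rewrite x0 linear0 scale0r.
rewrite -comp_lfunE; move: x {x0}; apply: (nb_lfunP HB) => k m mk.
rewrite comp_lfunE iota_b /beta (cfE HB) // (cfE HA); last first.
  rewrite /= c_mod; have := f_T k.
  have : (T (k + m) < T (g k))%N by rewrite T_lt // ltn_add2l.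
  have := T_le (leq_addr m k); lia.
rewrite (inj_eq top_inj); have [jk|//] := eqVneq j k; rewrite /= -jk.
congr (_%:R : K); congr nat_of_bool; apply/eqP/eqP => [->//|E].
apply: (@addnI j); apply: T_inj.
by have := T_le (leq_addr m j); have := T_le (leq_addr l j); lia.
Qed.

(** The corner [e A e] is spanned by the paths from a top to a top, and by [sh_top] these are the
    elements [beta]. *)
Let iota_surj u : e * u * e = u -> exists x, u = iota x.
Proof.
suff H v : e * v * e \in limg iota.
  by move=> <-; have /memv_imgP[x _ ->] := H u; exists x.
rewrite -amulrE -amullE -comp_lfunE memv_preim; move: v; apply: (nb_ind HA) => i l.
rewrite -memv_preim comp_lfunE amulrE amullE eb.
case: ifP => [/codomP[j ->]|_]; last by rewrite mul0r mem0v.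
rewrite be; case: ifP => [|_]; last exact: mem0v.
by move=> /sh_top[l' ->]; rewrite -/(beta j l') -iota_b memv_img ?memvf.
Qed.

Let iota_corner x : e * iota x = iota x /\ iota x * e = iota x.
Proof. by rewrite -iota1 -!iotaM mul1r mulr1. Qed.

Let MP : rmodule A := right_ideal e.

Let MP_sum : direct_sum_of MP Q.
Proof.
pose inj (j : 'I_r) : 'Hom(Q j, MP) := ri_hom (bA (top j) 0%N) (ri_mk e 1).
pose prj (j : 'I_r) : 'Hom(MP, Q j) := ri_hom e (ri_mk (bA (top j) 0%N) 1).
have tt j := idemE HA (top j).
have injE j y : ri_val (inj j y) = ri_val y.
  by rewrite ri_homE ri_valE ri_mkK // mulr1 -[ri_val y]ri_valP mulrA et.
have prjE j y : ri_val (prj j y) = bA (top j) 0%N * ri_val y.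
  by rewrite ri_homE ri_valE ri_mkK // mulr1.
exists inj, prj; split.
- by move=> j; apply: rhom_ri_hom.
- by move=> j; apply: rhom_ri_hom.
- move=> j; apply/lfunP => y; apply: ri_val_inj.
  by rewrite comp_lfunE id_lfunE prjE injE ri_valP.
- move=> i j ij; apply/lfunP => y; apply: ri_val_inj.
  rewrite comp_lfunE zero_lfunE prjE injE ri_val0 -[ri_val y]ri_valP mulrA (nb_mule HA).
  by rewrite (inj_eq top_inj) (negPf ij) mul0r.
apply/lfunP => y; apply: ri_val_inj; rewrite id_lfunE sum_lfunE -ri_incE linear_sum.
rewrite -[RHS]ri_valP mulr_suml; apply: eq_bigr => j _.
by rewrite /= ri_incE comp_lfunE injE prjE.
Qed.

Let phi_linear : linear (fun x : B => ri_hom e (ri_mk e (iota x)) : 'End(MP)).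
Proof.
move=> k x y; apply/lfunP => z; rewrite add_lfunE scale_lfunE !ri_homE.
by rewrite linearP ri_mk_linear ractDl ractZl.
Qed.

(** Left multiplication by [iota x]: the usual identification of the endomorphisms of [e A] with
    [e A e]. *)
Let phi : 'Hom(B, 'End(MP)) := lfun_from phi_linear.

Let phiE x y : ri_val (phi x y) = iota x * ri_val y.
Proof. by rewrite lfun_fromE ri_homE ri_valE ri_mkK // (iota_corner x).1. Qed.

Let gen : MP := ri_mk e 1.

Let gen_val : ri_val gen = e.
Proof. by rewrite ri_mkK // mulr1. Qed.

Let gen_e : ract gen e = gen.
Proof. by apply: ri_val_inj; rewrite ri_valE gen_val ee. Qed.

Let phi_iso : end_algebra_iso phi.
Proof.
split.
- by apply/lfunP => y; apply: ri_val_inj; rewrite phiE iota1 id_lfunE ri_valP.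
- by move=> x y; apply/lfunP => z; apply: ri_val_inj; rewrite comp_lfunE !phiE iotaM mulrA.
- apply/vspaceP => x; rewrite memv_ker memv0; apply/eqP/eqP => [|->]; last exact: linear0.
  move=> /lfunP/(_ gen)/(congr1 (ri_val (e := e))); rewrite phiE gen_val.
  by rewrite (iota_corner x).2 zero_lfunE ri_val0 => /iota0.
move=> f; split=> [Hf|[x <-]]; last first.
  by move=> y a; apply: ri_val_inj; rewrite phiE !ri_valE phiE mulrA.
have [|x xE] := @iota_surj (ri_val (f gen)).
  by rewrite ri_valP -ri_valE -Hf gen_e.
exists x; apply/lfunP => y; apply: ri_val_inj; rewrite phiE -xE -ri_valE -Hf.
by rewrite ri_gen.
Qed.

(** Evaluation at [gen] identifies the maps from [e A] to [Q j] with [bA (top j) 0 * A * e], which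
    [iota] matches with the right ideal of [B] at [j]. *)
Lemma hom_pgen_iso (j : 'I_r) (X : rmodule B) (x : X) :
  pgen bB j x -> hom_module_iso (Q j) phi X.
Proof.
move=> Hx; have [rep [r1 r2]] := pgen_rep HB Hx.
have tt := idemE HA (top j).
have jrep y : bA (top j) 0%N * iota (rep y) = iota (rep y).
  by rewrite -iota_e -iotaM (rep_lid r1 r2).
have psiL : linear (fun y : X => ri_hom e (ri_mk (bA (top j) 0%N) (iota (rep y))) : 'Hom(MP, Q j)).
  move=> k y z; apply/lfunP => w; rewrite add_lfunE scale_lfunE !ri_homE.
  by rewrite !linearP ri_mk_linear ractDl ractZl.
pose psi : 'Hom(X, 'Hom(MP, Q j)) := lfun_from psiL.
have psiE y z : ri_val (psi y z) = iota (rep y) * ri_val z.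
  by rewrite lfun_fromE ri_homE ri_valE ri_mkK // jrep.
exists psi; split.
- move=> y a; apply/lfunP => z; apply: ri_val_inj.
  by rewrite comp_lfunE !psiE phiE (rep_ract r1 r2) iotaM mulrA.
- apply/vspaceP => y; rewrite memv_ker memv0; apply/eqP/eqP => [|->]; last exact: linear0.
  move=> /lfunP/(_ gen)/(congr1 (ri_val (e := _))); rewrite psiE gen_val.
  rewrite (iota_corner _).2 zero_lfunE ri_val0 => /iota0 y0.
  by rewrite -(r1 y) y0 ract0r.
move=> f; split=> [Hf|[y <-]]; last first.
  by move=> z a; apply: ri_val_inj; rewrite psiE !ri_valE psiE mulrA.
have uj := ri_valP (f gen).
have [|a aE] := @iota_surj (ri_val (f gen)).
  by rewrite -uj mulrA et uj -ri_valE -Hf gen_e.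
exists (ract x a); apply/lfunP => y; apply: ri_val_inj.
rewrite psiE r2 iotaM iota_e -aE uj -ri_valE -Hf.
by rewrite ri_gen.
Qed.

Lemma syzygy_end_iso (PB : 'I_r -> rmodule B) :
  (forall j, exists x : PB j, pgen bB j x) ->
  exists (Q : 'I_r -> rmodule A) (MP : rmodule A) (phi : 'Hom(B, 'End(MP))),
    [/\ syzygy_projectives Q, direct_sum_of MP Q, end_algebra_iso phi &
        forall j, hom_module_iso (Q j) phi (PB j)].
Proof.
move=> PBgen; exists Q, MP, phi; split=> // [|j]; first exact: syzygy_projectivesP.
by have [x Hx] := PBgen j; apply: hom_pgen_iso Hx.
Qed.

Lemma syzygy_defect_eq : exists2 d, has_defect A d & has_defect B d.
Proof.
have c'_gt0 j : (0 < c' j)%N.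
  by rewrite -c'_mod; have := nb_gt0 HB (Ordinal (ltn_pmod j r_gt0)).
exists (\sum_(j < r) (rise c' j).-1)%N; last first.
  by apply/(has_defectP HB); rewrite defect_count.
apply/(has_defectP HA).
have := socle_count HA top_inj syzygy_im syzygy_surj.
by have := Tr; rewrite /T tpos_sum; lia.
Qed.

End SyzygyFiltration.

Local Close Scope ring_scope.

Section PeriodicSeries.
Variables (K : fieldType) (A : falgType K) (n : nat) (c : nat -> nat).
Variable b : 'I_n -> nat -> A.
Hypothesis Hb : nakayama_basis c b.

Lemma nakayama_basis_ext (c1 : nat -> nat) :
  (forall i : 'I_n, c1 i = c i) -> nakayama_basis c1 b.
Proof.
by move=> cE; apply: (relabel_basis Hb (sigma := id)) => //; exists id.
Qed.

(** This is the Kupisch inequality [nb_succ], made periodic; where the length is 1 the claim is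
    immediate. *)
Lemma nakayama_basis_mono : (0 < n)%N -> (forall x, c (x %% n)%N = c x) ->
  forall j, (j + c j <= j.+1 + c j.+1)%N.
Proof.
move=> n_gt0 c_mod j; pose i := Ordinal (ltn_pmod j n_gt0).
have ci : c i = c j by rewrite /= c_mod.
have cS : c (ordS i) = c j.+1.
  by rewrite /= -[X in (X %% n)%N]addn1 modnDml addn1 c_mod.
have [/(nb_succ Hb)|] := ltnP 1 (c i); first by rewrite cS ci; lia.
by rewrite ci; lia.
Qed.

End PeriodicSeries.

(** Gives the reverse series the Kupisch inequality from which [nakayama_basis_exists] builds an
    algebra. Within a gap [f] moves to the next top; at the end of a gap monotonicity of [j + c' j]
    takes over. *)
Lemma realizes_mono r c' N c : realizes r c' N c ->
  (forall j, (j + c' j <= j.+1 + c' j.+1)%N) ->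
  forall x, (x + c x <= x.+1 + c x.+1)%N.
Proof.
move=> [_ H] g_mono x; have [j [s [sj ->]]] := tpos_cover c' x.
have [lt|ge] := ltnP s (rise c' j).-1.
  rewrite H // -addnS H //; apply: ltnW; apply: tpos_lt; lia.
have E : (tpos c' j + s).+1 = tpos c' j.+1 by rewrite tposS; lia.
rewrite E H //; have := H j.+1 0%N isT; rewrite !addn0 => ->.
have : (j + c' j + s <= j.+1 + c' j.+1)%N by have := g_mono j; move: sj; rewrite /rise; lia.
by rewrite leq_eqVlt => /orP[/eqP ->//|/(tpos_lt c')/ltnW].
Qed.

(** * Every reverse realizes the series of Theta *)

Section ReverseUnique.
Variables (K : fieldType) (A B : falgType K) (n r : nat) (c c' : nat -> nat).
Variables (b : 'I_n -> nat -> A) (bB : 'I_r -> nat -> B) (PB : 'I_r -> rmodule B).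
Hypothesis Hb : nakayama_basis c b.
Hypothesis HB : nakayama_basis c' bB.
Hypothesis r_gt0 : (0 < r)%N.
Hypothesis c'_mod : forall x, c' (x %% r)%N = c' x.
Hypothesis PBgen : forall j, exists x : PB j, pgen bB j x.
Variables (t : 'I_r -> 'I_n) (Q : 'I_r -> rmodule A) (MP : rmodule A).
Variable phi : 'Hom(B, 'End(MP)).
Hypothesis t_lt : forall i j : 'I_r, (i < j)%N -> (t i < t j)%N.
Hypothesis t_im : forall i : 'I_n, exists j, sh i (c i) = t j.
Hypothesis t_surj : forall j, exists i : 'I_n, sh i (c i) = t j.
Hypothesis Qgen : forall j, exists x : Q j, pgen b (t j) x.
Hypothesis MPsum : direct_sum_of MP Q.
Hypothesis Qhom : forall j, hom_module_iso (Q j) phi (PB j).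
Hypothesis Hdef : exists2 d, has_defect A d & has_defect B d.

Let n_gt0 : (0 < n)%N.
Proof. exact: leq_ltn_trans (ltn_ord (t (Ordinal r_gt0))). Qed.

Let cp x := c (x %% n)%N.

Let cp_mod x : cp (x %% n) = cp x.
Proof. by rewrite /cp modn_mod. Qed.

Let Hbp : nakayama_basis cp b.
Proof. by apply: (nakayama_basis_ext Hb) => i; rewrite /cp modn_small. Qed.

Let res j : 'I_r := Ordinal (ltn_pmod j r_gt0).
(** The tops on the unrolled line: [r] indices further means [n] vertices further. *)
Let tt j := (t (res j) + j %/ r * n)%N.

Let t_inj : injective t.
Proof.
move=> i j E; apply/val_inj/eqP; rewrite /= eqn_leq.
by apply/andP; split; rewrite leqNgt; apply/negP => /t_lt; rewrite E ltnn.
Qed.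

Let tt_shift j q : tt (j + q * r) = (tt j + q * n)%N.
Proof.
rewrite /tt; have -> : res (j + q * r) = res j.
  by apply: val_inj; rewrite /= addnC modnMDl.
by rewrite divnDMl // mulnDl addnA.
Qed.

Let tt_res (j : 'I_r) : tt j = t j.
Proof.
rewrite /tt divn_small // addn0; congr (nat_of_ord (t _)).
by apply: val_inj; rewrite /= modn_small.
Qed.

Let tt_lt j : (tt j < tt j.+1)%N.
Proof.
have Ej : j = (res j + j %/ r * r)%N by rewrite addnC -divn_eq.
rewrite Ej -addSn !tt_shift ltn_add2r tt_res.
have [lt|ge] := ltnP (res j).+1 r.
  by rewrite -[(res j).+1]/(nat_of_ord (Ordinal lt)) tt_res t_lt.
have -> : (res j).+1 = (0 + 1 * r)%N by have := ltn_ord (res j); lia.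
by rewrite tt_shift mul1n; apply: ltn_addl.
Qed.

Let f_im i : exists j, (i + cp i)%N = tt j.
Proof.
have [j jE] := t_im (Ordinal (ltn_pmod i n_gt0)).
have {}jE : ((i + cp i) %% n = t j)%N.
  by rewrite -jE val_sh /= modnDml.
exists (j + (i + cp i) %/ n * r)%N.
by rewrite tt_shift tt_res -jE [RHS]addnC -divn_eq.
Qed.

Let f_surj j : exists i q, (i + cp i)%N = (tt j + q * n)%N.
Proof.
have [i iE] := t_surj (res j).
have {}iE : ((i + c i) %% n = t (res j))%N by rewrite -iE val_sh.
exists (i + j %/ r * n)%N, ((i + c i) %/ n)%N.
have -> : cp (i + j %/ r * n) = c i.
  by rewrite /cp addnC modnMDl modn_small.
by rewrite /tt -iE; have := divn_eq (i + c i) n; lia.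
Qed.

Let isT x := Ordinal (ltn_pmod x n_gt0) \in codom t.

Let isTP x : isT x <-> exists u, x = tt u.
Proof.
split=> [/codomP[j jE]|[u ->]].
  have {}jE : (x %% n = t j)%N := congr1 (@nat_of_ord n) jE.
  exists (j + x %/ n * r)%N.
  by rewrite tt_shift tt_res -jE [RHS]addnC -divn_eq.
rewrite /isT (_ : Ordinal _ = t (res u)) ?codom_f //.
by apply: val_inj; rewrite /= /tt addnC modnMDl modn_small.
Qed.

(** The dimension of [PB] is [c' j], while [hom_sum_dim] and [tpos_count] evaluate it as [m - j],
    where [tt m] is the value of [f] at [tt j]. *)
Let f_tt j : (tt j + cp (tt j))%N = tt (j + c' j).
Proof.
have [m mE] := f_im (tt j).
have tt_homo : {homo tt : i j / (i < j)%N} by exact: homo_ltn ltn_trans tt_lt.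
have jm : (j <= m)%N.
  by rewrite leqNgt; apply/negP => /tt_homo; rewrite -mE; lia.
have := tpos_count tt_lt isTP jm; rewrite -mE addKn.
have tjE : cp (tt j) = c (t (res j)) by rewrite /cp /tt addnC modnMDl modn_small.
have [x Hx] := PBgen (res j).
have := hom_sum_dim Hb t_inj Qgen MPsum (Qhom (res j)).
rewrite (pgen_dim HB Hx) /= c'_mod -tjE => ->.
rewrite -[X in iota X _]addn0 iotaDl count_map => E.
rewrite mE; congr tt.
rewrite -(subnKC jm) -E; congr (_ + _)%N; apply: eq_count => l /=.
rewrite /isT (_ : Ordinal _ = sh (t (res j)) l) //; apply: val_inj.
by rewrite /= val_sh /tt -addnA addnCA modnMDl.
Qed.

(** The series is read from the first top on because [tpos] puts the top of index 0 at position
    0. *)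
Lemma reverse_realizes : realizes r c' n (fun x => c ((tt 0 + x) %% n)%N).
Proof.
have c'_period j : c' (j + r)%N = c' j by rewrite -c'_mod modnDr c'_mod.
have c'_gt0 j : (0 < c' j)%N.
  by rewrite -c'_mod; have := nb_gt0 HB (Ordinal (ltn_pmod j r_gt0)).
have g_mono := nakayama_basis_mono HB r_gt0 c'_mod.
apply: (realizes_shift r_gt0 c'_period (c := cp) (tt := tt)) => //.
- by move=> i; rewrite -cp_mod modnDr cp_mod.
- exact: (nakayama_basis_mono Hbp n_gt0 cp_mod).
- by move=> j; rewrite -[X in tt (j + X)]mul1n tt_shift mul1n.
have [d dA dB] := Hdef.
have dE := (has_defectP Hb d).1 dA; have := socle_count Hb t_inj t_im t_surj.
by rewrite -dE ((has_defectP HB d).1 dB) defect_count // addnC.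
Qed.

End ReverseUnique.

Theorem proposition4p6p5 (K : fieldType) (k : nat) (k_gt0 : (0 < k)%N)
  (n : 'I_k -> nat) (Theta : falgType K)
  (S P : 'I_(size (theta_series n)) -> rmodule Theta)
  (Theta_linear : linear_nakayama Theta)
  (Theta_series : kupisch_labelling S P) :
  (exists Lambda : falgType K,
     cyclic_nakayama Lambda /\ has_kupisch_series Lambda (reverse_series n)) /\
  (forall Lambda : falgType K, cyclic_nakayama Lambda ->
     (defect_invariant_reverse Lambda P <->
      has_kupisch_series Lambda (reverse_series n))).
Proof.
set r := size (theta_series n) in S P Theta_series *.
set N := size (reverse_series n).
pose c' j := nth 0%N (theta_series n) (j %% r)%N.
pose c x := nth 0%N (reverse_series n) (x %% N)%N.
have r_gt0 : (0 < r)%N by apply: theta_series_gt0.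
have Hreal : realizes r c' N c by apply: reverse_series_realizes.
have [v [arr [_ /bound_quiver_basis[c0 [b0 [Hb0 _]]]]]] := Theta_linear.
have [bT [HbT _ Pgen]] := kupisch_labelling_basis Hb0 Theta_series.
have c'_mod x : c' (x %% r)%N = c' x by rewrite /c' modn_mod.
have c_mod x : c (x %% N)%N = c x by rewrite /c modn_mod.
have {}HbT : nakayama_basis c' bT.
  by apply: (nakayama_basis_ext HbT) => i; rewrite /c' modn_small.
have g_mono := nakayama_basis_mono HbT r_gt0 c'_mod.
have c_gt1 x : (1 < c x)%N by apply: reverse_series_ge2.
have N_gt0 : (0 < N)%N.
  by case: Hreal => <- _; apply: leq_ltn_trans (tpos_lt c' r_gt0).
have nthE (i : 'I_N) : c i = nth 0%N (reverse_series n) i by rewrite /c modn_small.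
have kupischP (L : falgType K) : cyclic_nakayama L ->
    has_kupisch_series L (reverse_series n) <->
    exists b : 'I_N -> nat -> L, nakayama_basis c b.
  move=> [m /bound_quiver_basis[c1 [b1 [Hb1 _]]]].
  split=> [/(has_kupisch_seriesP _ Hb1)[b Hb]|[b Hb]].
    by exists b; apply: (nakayama_basis_ext Hb).
  apply/(has_kupisch_seriesP _ Hb1); exists b.
  by apply: (nakayama_basis_ext Hb) => i; rewrite nthE.
split.
  (* An algebra exists because the announced series is positive, periodic and, being realized,
     satisfies the Kupisch inequality. *)
  have [|||L [b Hb]] := @nakayama_basis_exists K N c N_gt0.
  - by move=> i; apply: ltnW.
  - by move=> i; rewrite -c_mod modnDr c_mod.
  - by move=> i; have := realizes_mono Hreal g_mono i; lia.
  have Lcyc : cyclic_nakayama L by apply: (nakayama_basis_cyclic Hb).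
  by exists L; split=> //; apply/kupischP => //; exists b.
move=> L Lcyc; split=> [[_ [Q [MP [phi [syz MPsum _ Qhom]]]] Hdef]|].
  apply/kupischP => //.
  have [m0 /bound_quiver_basis[cL [bL [HbL arrL]]]] := Lcyc.
  have cL_gt1 (i : 'I_m0) : (1 < cL i)%N by rewrite arrL.
  have [m [c1 [b1 [t [[Hb1 c1_gt1] t_lt t_im t_surj Qgen]]]]] :=
    syzygy_labelling HbL cL_gt1 syz.
  have Hm := reverse_realizes Hb1 HbT r_gt0 c'_mod Pgen t_lt t_im t_surj Qgen MPsum Qhom Hdef.
  have [mN cE] := realizes_inj Hm Hreal.
  have m_gt0 : (0 < m)%N by rewrite mN.
  (* This is the position of the first top; rotating the labels by it aligns them with the announced
     series. *)
  set t0 := (_ + _ * m)%N in cE.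
  pose sigma (i : 'I_N) : 'I_m := Ordinal (ltn_pmod (t0 + i) m_gt0).
  exists (fun i => b1 (sigma i)); apply: (relabel_basis Hb1).
  - apply: inj_card_bij; last by rewrite !card_ord mN.
    move=> i j /(congr1 (@nat_of_ord m)) /= /eqP; rewrite eqn_modDl mN !modn_small // => /eqP.
    exact: val_inj.
  - by move=> i; rewrite -cE.
  - move=> i _; apply: val_inj; rewrite /= (_ : i.+1 %% N = i.+1 %% m)%N; last by rewrite mN.
    by rewrite modnDmr addnS -[in RHS]addn1 modnDml addn1.
move=> /(kupischP _ Lcyc)[b Hb]; split=> //.
  exact: (syzygy_end_iso Hb HbT r_gt0 (fun i => c_gt1 i) c_mod c'_mod Hreal g_mono Pgen).
exact: (syzygy_defect_eq Hb HbT r_gt0 c_mod c'_mod Hreal g_mono).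
Qed.
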